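(* Let $\mu\in\mathbb{C}$ and let $I=(-1,1)$. For a function $f$ on $I$ write $$F_\mu(s)=\frac{1}{\pi}\int_{-1}^{1}\frac{\cosh[\mu(s-u)]}{s-u}f(u)\,du,\qquad s\in I,$$ for its cosh-weighted finite Hilbert transform. (i) If $f\in L_d^2(I)$, then for almost every $t\in I$ $$f(t)=\cos(\mu\sqrt{1-t^2})\sqrt{1-t^2}\left[\frac{1}{\pi}\int_{-1}^{1}\frac{F_\mu(s)}{s-t}\frac{\cos(\mu\sqrt{1-s^2})}{\sqrt{1-s^2}}\,ds\right]+\sin(\mu\sqrt{1-t^2})\left[\frac{1}{\pi}\int_{-1}^{1}\frac{F_\mu(s)}{s-t}\sin(\mu\sqrt{1-s^2})\,ds\right].$$ (ii) If $f\in L_m^2(I)$, then for almost every $t\in I$ $$f(t)=\frac{\cos(\mu\sqrt{1-t^2})}{\sqrt{1-t^2}}\left[\frac{1}{\pi}\int_{-1}^{1}\frac{F_\mu(s)}{s-t}\cos(\mu\sqrt{1-s^2})\sqrt{1-s^2}\,ds+\frac{1}{\pi}\int_{-1}^{1}\cosh(\mu u)f(u)\,du\right]+\sin(\mu\sqrt{1-t^2})\left[\frac{1}{\pi}\int_{-1}^{1}\frac{F_\mu(s)}{s-t}\sin(\mu\sqrt{1-s^2})\,ds\right].$$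
   Context: Functions are complex-valued and measurable on $I=(-1,1)$, identified when equal almost everywhere. The weighted spaces are $$L_m^2(I)=\Big\{f:\int_{-1}^{1}|f(t)|^2\sqrt{1-t^2}\,dt<\infty\Big\},\qquad L_d^2(I)=\Big\{f:\int_{-1}^{1}|f(t)|^2\frac{1}{\sqrt{1-t^2}}\,dt<\infty\Big\}.$$ All integrals with kernels $1/(s-u)$ or $1/(s-t)$ are Cauchy principal values at the interior singularity. For $t\in I$, $\sqrt{1-t^2}$ is the positive square root, and $\cos,\sin,\cosh$ are the entire functions evaluated at complex arguments. *)

(* Defs.v *)
From mathcomp Require Import all_boot all_order all_algebra.
From mathcomp Require Import complex.
From mathcomp Require Import all_classical all_reals all_analysis.

Set Implicit Arguments.
Unset Strict Implicit.
Unset Printing Implicit Defensive.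

Import Order.TTheory GRing.Theory Num.Theory.
Import numFieldNormedType.Exports.

Local Open Scope classical_set_scope.
Local Open Scope ring_scope.
Local Open Scope complex_scope.

Section ComplexFunctions.
Variable R : realType.

Definition cexp (z : R[i]) : R[i] :=
  (expR (complex.Re z) * cos (complex.Im z)) +i*
  (expR (complex.Re z) * sin (complex.Im z)).

Definition ccos (z : R[i]) : R[i] :=
  (cexp ('i%C * z) + cexp (- ('i%C * z))) / 2.

Definition csin (z : R[i]) : R[i] :=
  (cexp ('i%C * z) - cexp (- ('i%C * z))) / (2 * 'i%C).

Definition ccosh (z : R[i]) : R[i] := (cexp z + cexp (- z)) / 2.

End ComplexFunctions.

Section ComplexIntegration.
Variable R : realType.
Local Notation leb := (@lebesgue_measure R).

Definition cmeasurable_fun (D : set R) (f : R -> R[i]) : Prop :=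
  measurable_fun D (fun x => complex.Re (f x)) /\
  measurable_fun D (fun x => complex.Im (f x)).

Definition cintegrable (D : set R) (f : R -> R[i]) : Prop :=
  leb.-integrable D (fun x => (complex.Re (f x))%:E) /\
  leb.-integrable D (fun x => (complex.Im (f x))%:E).

Definition cintegral (D : set R) (f : R -> R[i]) : R[i] :=
  (\int[leb]_(x in D) complex.Re (f x)) +i*
  (\int[leb]_(x in D) complex.Im (f x)).

Definition unit_itv : set R := `]-1, 1[%classic.

(* The type R[i]^o gives the limits below the norm topology of the numeric
   field R[i]. *)
Definition pv_trunc (g : R -> R[i]) (t e : R) : R[i]^o :=
  cintegral [set s | unit_itv s /\ e < `|s - t|] g.

(* The principal value at t of the integral of g over (-1, 1) exists:
   the truncated integrals converge absolutely and have a (finite) limit. *)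
Definition has_pv (g : R -> R[i]) (t : R) : Prop :=
  (forall e : R, 0 < e ->
     cintegrable [set s | unit_itv s /\ e < `|s - t|] g) /\
  cvg (pv_trunc g t e @[e --> 0^'+]).

(* Meaningful only under has_pv g t. *)
Definition pv (g : R -> R[i]) (t : R) : R[i] :=
  lim (pv_trunc g t e @[e --> 0^'+]).

Definition wt (t : R) : R := Num.sqrt (1 - t ^+ 2).

Definition L2m (f : R -> R[i]) : Prop :=
  cmeasurable_fun unit_itv f /\
  (\int[leb]_(t in unit_itv) (Normc.normc (f t) ^+ 2 * wt t)%:E < +oo)%E.

Definition L2d (f : R -> R[i]) : Prop :=
  cmeasurable_fun unit_itv f /\
  (\int[leb]_(t in unit_itv) (Normc.normc (f t) ^+ 2 / wt t)%:E < +oo)%E.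

Definition cosh_kernel (m : R[i]) (f : R -> R[i]) (s u : R) : R[i] :=
  ccosh (m * (s - u)%:C) / (s - u)%:C * f u.

Definition cosh_FHT (m : R[i]) (f : R -> R[i]) (s : R) : R[i] :=
  (pi^-1)%:C * pv (cosh_kernel m f s) s.

End ComplexIntegration.
Arguments unit_itv {R}.

(* Main.v *)
(* Write V f(s) for the principal value of the integral of f(u) / (s - u) over
   I = (-1, 1), and w(t) = sqrt(1 - t^2).  Since cosh is a sum of two
   exponentials, F = (1/2 pi) (e^{mu s} G+ + e^{-mu s} G-), where
   G+- = V (e^{-+mu u} f).  The proof rests on Tricomi's formula
     V (phi V psi + psi V phi) = V phi V psi - pi^2 phi psi
   for phi in L^2(w) and psi in L^2(1/w), which computes V (F K) for the three
   kernels K = cos(mu w) w^{-1}, cos(mu w) w, sin(mu w) as soon as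
   V (K e^{+-mu s}) is known explicitly.  The latter transforms come from
   applying the formula to the powers of z = s + i w(s), which gives
   V (Im z^n) = pi Re z^n, and summing the exponential series in mu z.  When
   these values of V (F K) are combined, the terms containing G+- cancel and
   what remains is (cos^2 + sin^2) f.

   Tricomi's formula itself is an identity between the real parts of Cauchy
   transforms at height y > 0.  It is exact for Holder functions; the bound
   of V on L^2(w), obtained from the pair (w, f), and on L^2(1/w), obtained by
   duality, carries it over to the weighted spaces before letting y -> 0. *)

Require Import Defs.
From mathcomp Require Import all_boot all_order all_algebra.
From mathcomp Require Import complex.
From mathcomp Require Import all_classical all_reals all_analysis.
From mathcomp Require Import measurable_realfun ring lra.

Set Implicit Arguments.
Unset Strict Implicit.
Unset Printing Implicit Defensive.

Import Order.TTheory GRing.Theory Num.Theory.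
Import numFieldNormedType.Exports.

Local Open Scope classical_set_scope.
Local Open Scope ring_scope.

(** * Integrable real functions *)

Section Integration.
Variable R : realType.
Local Notation leb := (@lebesgue_measure R).
Implicit Types (D : set R) (f g h : R -> R).

(** The Cauchy kernel at height y > 0 is preferred to truncated integrals because products of Cauchy
    integrals obey exact identities at each height. Principal values come back only at the end: at a
    Lebesgue point the truncated and the conjugate Poisson integrals have the same limit. In
    Tricomi's formula one factor from L^2(w) and one from L^2(1/w) make every product integrable by
    Cauchy-Schwarz, but no better than integrable, so all limits of products are taken in L^1. This
    also separates the two parts of the theorem: the kernel cos(mu w) / w takes the place in L^2(w),
    so f has to come from L^2(1/w), whereas a bounded kernel leaves f free to be in L^2(w). The
    extra integral in (ii) is the price of commuting V with multiplication by x. A last obstacle is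
    that F is a [lim], hence a total function. The outer principal values require F itself to be
    measurable, also where its own principal value fails to exist. *)

Lemma ae_imply (P Q : set R) : (forall x, P x -> Q x) ->
  {ae leb, forall x, P x} -> {ae leb, forall x, Q x}.
Proof. exact: (@filterS _ _ (ae_filter_ringOfSetsType leb)). Qed.

Lemma ae_imply2 (P P' Q : set R) : (forall x, P x -> P' x -> Q x) ->
  {ae leb, forall x, P x} -> {ae leb, forall x, P' x} -> {ae leb, forall x, Q x}.
Proof. exact: (@filterS2 _ _ (ae_filter_ringOfSetsType leb)). Qed.

Definition L1 D f := leb.-integrable D (EFin \o f).

Lemma meas_EFin D f : measurable_fun D f ->
  @measurable_fun _ _ (measurableTypeR R) _ D (EFin \o f).
Proof. by move=> mf; apply/measurable_EFinP. Qed.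

Lemma L1_meas D f : L1 D f -> measurable_fun D f.
Proof. by move=> /measurable_int /measurable_EFinP. Qed.

Lemma L1_eq D f g : measurable D -> (forall x, D x -> f x = g x) -> L1 D f -> L1 D g.
Proof.
move=> mD fg; apply: eq_integrable => // x /set_mem Dx /=.
by rewrite fg.
Qed.

Lemma L1_le D f g : measurable D -> measurable_fun D f ->
  (forall x, D x -> `|f x| <= g x) -> L1 D g -> L1 D f.
Proof.
move=> mD mf fg; rewrite /L1; apply: (@le_integrable _ _ _ leb D mD) => //; first exact/measurable_EFinP.
by move=> x Dx; rewrite lee_fin; apply: le_trans (fg x Dx) (ler_norm _).
Qed.

Lemma L1_abs D f : L1 D f -> L1 D (fun x => `|f x|).
Proof. exact: integrable_norm. Qed.

Lemma L1D D f g : measurable D -> L1 D f -> L1 D g -> L1 D (fun x => f x + g x).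
Proof. by move=> mD If Ig; exact: (@integrableD _ _ _ leb D mD _ _ If Ig). Qed.

Lemma L1B D f g : measurable D -> L1 D f -> L1 D g -> L1 D (fun x => f x - g x).
Proof. by move=> mD If Ig; exact: (@integrableB _ _ _ leb D mD _ _ If Ig). Qed.

Lemma L1Z D k f : measurable D -> L1 D f -> L1 D (fun x => k * f x).
Proof. by move=> mD If; exact: (@integrableZl _ _ _ leb D mD k _ If). Qed.

Lemma L1_bndM D f h C : measurable D -> L1 D f -> measurable_fun D h ->
  (forall x, D x -> `|h x| <= C) -> L1 D (fun x => f x * h x).
Proof.
move=> mD If meas_h hC; apply: (@L1_le _ _ (fun x => C * `|f x|)) => //.
- by apply: measurable_funM => //; exact: L1_meas.
- by move=> x Dx; rewrite normrM mulrC ler_wpM2r// hC.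
- exact/L1Z/L1_abs.
Qed.

Lemma L1S D E f : measurable D -> measurable E -> E `<=` D -> L1 D f -> L1 E f.
Proof. by move=> mD mE ED; apply: integrableS. Qed.

Lemma L1_bnd D f C : measurable D -> (leb D < +oo)%E -> measurable_fun D f ->
  (forall x, D x -> `|f x| <= C) -> L1 D f.
Proof.
move=> mD fD mf fC; apply: measurable_bounded_integrable => //.
exists C; split; first exact: num_real.
by move=> M CM x Dx; apply: le_trans (fC x Dx) (ltW CM).
Qed.

Lemma eq_int D f g : (forall x, D x -> f x = g x) ->
  \int[leb]_(x in D) f x = \int[leb]_(x in D) g x.
Proof. by move=> fg; apply: eq_Rintegral => x /set_mem; exact: fg. Qed.

Lemma int_EFin D f : measurable D -> L1 D f ->
  (\int[leb]_(x in D) (f x)%:E)%E = (\int[leb]_(x in D) f x)%:E.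
Proof. by move=> mD If; rewrite fineK//; exact: integrable_fin_num. Qed.

Lemma int_absle D f g : measurable D -> L1 D f -> L1 D g ->
  (forall x, D x -> `|f x| <= g x) ->
  `|\int[leb]_(x in D) f x| <= \int[leb]_(x in D) g x.
Proof.
move=> mD If Ig fg; apply: (le_trans (@le_normr_Rintegral _ _ _ leb D f mD If)).
by apply: (@le_Rintegral _ _ _ leb D) => //; exact: L1_abs.
Qed.

Lemma int_ae_eq D f g : measurable D -> measurable_fun D f -> measurable_fun D g ->
  {ae leb, forall x, D x -> f x = g x} ->
  \int[leb]_(x in D) f x = \int[leb]_(x in D) g x.
Proof.
move=> mD mf mg fg; congr fine; apply: (@ae_eq_integral _ _ _ leb D (EFin \o g) (EFin \o f) mD).
- exact: meas_EFin.
- exact: meas_EFin.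
- by apply: ae_imply fg => x /= + Dx => ->//.
Qed.

Lemma int_le0_ae D f : measurable D -> L1 D f -> (forall x, D x -> 0 <= f x) ->
  \int[leb]_(x in D) f x <= 0 -> {ae leb, forall x, D x -> f x = 0}.
Proof.
move=> mD If f0 i0.
have : (\int[leb]_(x in D) `|(f x)%:E|)%E = 0.
  have -> : (\int[leb]_(x in D) `|(f x)%:E|)%E = (\int[leb]_(x in D) (f x)%:E)%E.
    by apply: eq_integral => x /set_mem Dx /=; rewrite ger0_norm ?f0.
  rewrite int_EFin//; congr EFin; apply/eqP.
  by rewrite eq_le i0 Rintegral_ge0.
move/(@ae_eq_integral_abs _ _ _ leb D mD _ (meas_EFin (L1_meas If))).
by apply: ae_imply => x /= + Dx => /(_ Dx) [].
Qed.

Lemma dct (D : set R) (f_ : (R -> R)^nat) f g : measurable D ->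
  (forall n, measurable_fun D (f_ n)) -> measurable_fun D f ->
  {ae leb, forall x, D x -> f_ ^~ x @ \oo --> f x} ->
  L1 D g -> (forall n x, D x -> `|f_ n x| <= g x) ->
  L1 D f /\ (fun n => \int[leb]_(x in D) f_ n x) @ \oo --> \int[leb]_(x in D) f x.
Proof.
move=> mD mf_ mf cf Ig fg.
have If_ n : L1 D (f_ n) by apply: L1_le Ig => //; exact: fg.
have [||||| If _ cv] := @dominated_convergence _ _ _ leb D mD
    (fun n x => (f_ n x)%:E) (EFin \o f) (EFin \o g).
- by move=> n; exact: meas_EFin.
- exact: meas_EFin.
- apply: ae_imply cf => x /= + Dx => /(_ Dx) cx; apply: cvg_EFin cx; exact: nearW.
- exact: Ig.
- by apply: aeW => x n Dx; rewrite /= lee_fin fg.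
split => //.
move: cv; rewrite /comp int_EFin//.
under eq_fun do rewrite int_EFin//.
by move/fine_cvg.
Qed.

(** A right limit at 0 is tested on sequences of positive numbers tending to 0, which reduces the
    claim to [dct]. *)
Lemma dct_right (D : set R) (F : R -> R -> R) f g : measurable D ->
  (forall y, 0 < y -> measurable_fun D (F y)) -> measurable_fun D f ->
  {ae leb, forall x, D x -> F y x @[y --> 0^'+] --> f x} ->
  L1 D g -> (forall y x, 0 < y -> D x -> `|F y x| <= g x) ->
  L1 D f /\ (\int[leb]_(x in D) F y x) @[y --> 0^'+] --> \int[leb]_(x in D) f x.
Proof.
move=> mD mF mf cF Ig Fg.
have H (u : R^nat) : (forall n, 0 < u n) -> u @ \oo --> 0 ->
   L1 D f /\ (fun n => \int[leb]_(x in D) F (u n) x) @ \oo --> \int[leb]_(x in D) f x.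
  move=> u0 cu; apply: (@dct D (fun n => F (u n)) f g) => //.
  - by move=> n; exact: mF.
  - apply: ae_imply cF => x + Dx => /(_ Dx) /cvg_at_rightP; apply; split => //.
  - by move=> n x Dx; exact: Fg.
split; last first.
  by apply/cvg_at_rightP => u [u0 cu]; have [] := H u u0 cu.
have c0 : (fun n => n.+1%:R^-1 : R) @ \oo --> 0 by exact: cvg_harmonic.
by have [] := H (fun n => n.+1%:R^-1) (fun n => _ (ltr0Sn R n)) c0.
Qed.

Lemma meas_right (D : set R) (F : R -> R -> R) f :
  (forall y, 0 < y -> measurable_fun D (F y)) ->
  (forall x, D x -> F y x @[y --> 0^'+] --> f x) -> measurable_fun D f.
Proof.
move=> mF cF; apply: (@measurable_fun_cvg _ _ _ _ (fun n => F (n.+1%:R^-1))).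
  by move=> n; exact: mF.
move=> x /cF /cvg_at_rightP; apply; split => //; exact: cvg_harmonic.
Qed.

(** The uniform bound also yields integrability of the limit; this is how membership in a weighted
    space passes to almost everywhere limits. *)
Lemma fatou_R (D : set R) (f_ : (R -> R)^nat) f C : measurable D ->
  (forall n, L1 D (f_ n)) -> measurable_fun D f ->
  (forall n x, D x -> 0 <= f_ n x) ->
  {ae leb, forall x, D x -> f_ ^~ x @ \oo --> f x} ->
  (forall n, \int[leb]_(x in D) f_ n x <= C) ->
  L1 D f /\ \int[leb]_(x in D) f x <= C.
Proof.
move=> mD If_ mf f0 cf HC.
have aeEl : {ae leb, forall x, D x -> `|(f x)%:E|%E = limn_einf (fun n => (f_ n x)%:E)}.
  apply: ae_imply cf => x + Dx => /(_ Dx) cx.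
  have reimE : (fun n => (f_ n x)%:E) @ \oo --> (f x)%:E by apply: cvg_EFin cx; exact: nearW.
  rewrite (cvg_limn_einf_sup reimE).1 /= ger0_norm//.
  by apply: (cvgr_to_ge cx); apply: nearW => n; exact: f0.
have mEf_ n : @measurable_fun _ _ (measurableTypeR R) _ D (EFin \o f_ n).
  by apply: meas_EFin; exact: L1_meas.
have key : (\int[leb]_(x in D) `|(f x)%:E| <= C%:E)%E.
  rewrite (@ae_eq_integral _ _ _ leb D (fun x => limn_einf (fun n => (f_ n x)%:E)) (fun x => `|(f x)%:E|%E) mD _ _ aeEl); last first.
  - apply: (@emeasurable_fun_cvg _ (measurableTypeR R) _ _
      (fun m x => einfs (fun n => (f_ n x)%:E) m)).
      by move=> m; exact: measurable_fun_einfs.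
    by move=> x Dx; rewrite limn_einf_lim; exact: is_cvg_einfs.
  - apply: measurableT_comp => //; exact: meas_EFin.
  apply: (le_trans (@fatou _ _ _ leb D mD (fun n x => (f_ n x)%:E) _ _)).
  - by move=> n; exact: mEf_.
  - by move=> n x Dx; rewrite lee_fin f0.
  rewrite limn_einf_lim; apply: lime_le; first exact: is_cvg_einfs.
  apply: nearW => n; apply: (@le_trans _ _ (\int[leb]_(x in D) (f_ n x)%:E)%E).
    by apply: ereal_inf_lbound; exists n => /=.
  by rewrite int_EFin// lee_fin.
have If : L1 D f.
  apply/integrableP; split; first exact: meas_EFin.
  by apply: le_lt_trans key _; rewrite ltry.
split=> //; rewrite -lee_fin -int_EFin//; apply: le_trans key.
apply: le_integral => //; first exact: (integrable_abse If).
by move=> x Dx; rewrite lee_fin ler_norm.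
Qed.

(** Integrating 2 t |a b| <= r a^2 + t^2 b^2 / r gives an inequality for every real t, which is then
    optimised. *)
Lemma cauchy_schwarz D (r a b : R -> R) : measurable D ->
  (forall x, D x -> 0 < r x) -> measurable_fun D a -> measurable_fun D b ->
  L1 D (fun x => r x * a x ^+ 2) -> L1 D (fun x => b x ^+ 2 / r x) ->
  L1 D (fun x => a x * b x) /\
  (\int[leb]_(x in D) `|a x * b x|) ^+ 2 <=
  \int[leb]_(x in D) (r x * a x ^+ 2) * \int[leb]_(x in D) (b x ^+ 2 / r x).
Proof.
move=> mD r0 ma mb Ia Ib.
have pw t x : D x -> 2 * t * `|a x * b x| <= r x * a x ^+ 2 + t ^+ 2 * (b x ^+ 2 / r x).
  move=> Dx; rewrite -subr_ge0 normrM.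
  have -> : r x * a x ^+ 2 + t ^+ 2 * (b x ^+ 2 / r x) - 2 * t * (`|a x| * `|b x|)
      = (r x * `|a x| - t * `|b x|) ^+ 2 / r x.
    rewrite -(real_normK (num_real (a x))) -(real_normK (num_real (b x))).
    by have := lt0r_neq0 (r0 x Dx) => ?; field.
  by rewrite mulr_ge0 ?sqr_ge0// invr_ge0 ltW// r0.
have Iab : L1 D (fun x => a x * b x).
  apply: (@L1_le _ _ (fun x => r x * a x ^+ 2 + b x ^+ 2 / r x)) => //.
  - exact: measurable_funM.
  - move=> x Dx; have := pw 1 x Dx; rewrite expr1n mul1r mulr1.
    apply: le_trans; rewrite -[leLHS]mul1r ler_wpM2r// lerDl//.
  - exact: L1D.
split=> //.
set X := \int[leb]_(x in D) `|a x * b x|.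
set A := \int[leb]_(x in D) (r x * a x ^+ 2); set B := \int[leb]_(x in D) (b x ^+ 2 / r x).
have X0 : 0 <= X by apply: Rintegral_ge0 => x Dx.
have A0 : 0 <= A by apply: Rintegral_ge0 => x Dx; rewrite mulr_ge0 ?sqr_ge0// ltW// r0.
have B0 : 0 <= B.
  by apply: Rintegral_ge0 => x Dx; rewrite mulr_ge0 ?sqr_ge0// invr_ge0 ltW// r0.
have H t : 2 * t * X <= A + t ^+ 2 * B.
  rewrite /X /A /B -(@RintegralZl _ _ _ leb D)//; last exact: L1_abs.
  rewrite -(@RintegralZl _ _ _ leb D)// -(@RintegralD _ _ _ leb D)//; last exact: (L1Z _ mD Ib).
  apply: (@le_Rintegral _ _ _ leb D) => //.
  - exact: (L1Z _ mD (L1_abs Iab)).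
  - exact: (L1D mD Ia (L1Z _ mD Ib)).
  - exact: pw.
(* If B = 0 and X is nonzero, t = (A + 1) / X gives 2 (A + 1) <= A, which is absurd. Otherwise t = X
   / B is the optimal choice. *)
have [B00|Bn0] := eqVneq B 0.
  have HX := H (A + 1).
  have HX1 := H ((A + 1) / X).
  have [->|Xn0] := eqVneq X 0; first by rewrite expr0n/= mulr_ge0.
  move: HX1; rewrite B00 mulr0 addr0.
  have -> : 2 * ((A + 1) / X) * X = 2 * (A + 1) by field.
  by move=> ?; exfalso; lra.
have Bp : 0 < B by rewrite lt_neqAle eq_sym Bn0.
have := H (X / B).
have -> : A + (X / B) ^+ 2 * B = A + X ^+ 2 / B by field.
have -> : 2 * (X / B) * X = X ^+ 2 / B + X ^+ 2 / B by field.
by rewrite lerD2r ler_pdivrMr.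
Qed.

End Integration.

(** * Poisson and conjugate Poisson integrals *)

Section Kernels.
Variable R : realType.
Local Notation leb := (@lebesgue_measure R).
Local Notation I := (@unit_itv R).
Implicit Types (D : set R) (f g h : R -> R) (x y t u v : R).

Lemma mI : measurable I.
Proof. exact: measurable_itv. Qed.

Lemma I_lty : (leb I < +oo)%E.
Proof. by rewrite /unit_itv lebesgue_measure_itv/= lte_fin; case: ifP => _; rewrite ltry. Qed.

Lemma LID f g : L1 I f -> L1 I g -> L1 I (fun x => f x + g x).
Proof. exact: L1D mI. Qed.

Lemma LIB f g : L1 I f -> L1 I g -> L1 I (fun x => f x - g x).
Proof. exact: L1B mI. Qed.

Lemma LIZ k f : L1 I f -> L1 I (fun x => k * f x).
Proof. exact: L1Z mI. Qed.

Lemma LI_eq f g : (forall x, I x -> f x = g x) -> L1 I f -> L1 I g.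
Proof. exact: L1_eq mI. Qed.

Lemma LI_le f g : measurable_fun I f -> (forall x, I x -> `|f x| <= g x) -> L1 I g -> L1 I f.
Proof. exact: L1_le mI. Qed.

Lemma LI_bndM f h C : L1 I f -> measurable_fun I h ->
  (forall x, I x -> `|h x| <= C) -> L1 I (fun x => f x * h x).
Proof. exact: L1_bndM mI. Qed.

Lemma LI_bnd f C : measurable_fun I f -> (forall x, I x -> `|f x| <= C) -> L1 I f.
Proof. exact: L1_bnd mI I_lty. Qed.

Lemma iD f g : L1 I f -> L1 I g -> \int[leb]_(x in I) (f x + g x) =
  \int[leb]_(x in I) f x + \int[leb]_(x in I) g x.
Proof. exact: (@RintegralD _ _ _ leb I _ _ mI). Qed.

Lemma iB f g : L1 I f -> L1 I g -> \int[leb]_(x in I) (f x - g x) =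
  \int[leb]_(x in I) f x - \int[leb]_(x in I) g x.
Proof. exact: (@RintegralB _ _ _ leb I _ _ mI). Qed.

Lemma iZ k f : L1 I f -> \int[leb]_(x in I) (k * f x) = k * \int[leb]_(x in I) f x.
Proof. exact: (@RintegralZl _ _ _ leb I _ k mI). Qed.

Lemma i_le f g : L1 I f -> L1 I g -> (forall x, I x -> f x <= g x) ->
  \int[leb]_(x in I) f x <= \int[leb]_(x in I) g x.
Proof. exact: (@le_Rintegral _ _ _ leb I _ _ mI). Qed.

Lemma i_absle f g : L1 I f -> L1 I g -> (forall x, I x -> `|f x| <= g x) ->
  `|\int[leb]_(x in I) f x| <= \int[leb]_(x in I) g x.
Proof. exact: (int_absle mI). Qed.

Lemma in_I x : I x <-> -1 < x < 1.
Proof. by rewrite /unit_itv/= in_itv/=. Qed.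

(** * Fubini's theorem for a bounded kernel *)

Section BoundedKernel.
Variables (K : R -> R -> R) (C : R).
Hypothesis mK :
  measurable_fun [set: measurableTypeR R * measurableTypeR R] (fun z => K z.1 z.2).
Hypothesis KC : forall x u, `|K x u| <= C.

Lemma L1_patch f : L1 I f -> L1 setT (f \_ I).
Proof.
move=> If; have := (@integrable_mkcond _ _ _ leb I (EFin \o f) mI).1 If.
by rewrite /L1 restrict_EFin.
Qed.

Lemma meas_patch f : measurable_fun I f -> measurable_fun setT (f \_ I).
Proof. by move/(@measurable_restrictT _ _ (measurableTypeR R) _ _ f mI). Qed.

Lemma meas_K x : measurable_fun setT (K x).
Proof.
exact: (measurableT_comp mK (@pair1_measurable _ _ (measurableTypeR R) (measurableTypeR R) x)).
Qed.

Lemma meas_K2 u : measurable_fun setT (K ^~ u).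
Proof.
exact: (measurableT_comp mK (@pair2_measurable _ _ (measurableTypeR R) (measurableTypeR R) u)).
Qed.

(** Extension by zero lets Fubini's theorem be used on the whole plane; the product is dominated by
    C |f(x)| |g(u)|. *)
Let h f g (z : measurableTypeR R * measurableTypeR R) : \bar R :=
  ((f \_ I) z.1 * (K z.1 z.2 * (g \_ I) z.2))%:E.

Lemma meas_h f g : L1 I f -> L1 I g -> measurable_fun setT (h f g).
Proof.
move=> If Ig; apply/measurable_EFinP; apply: measurable_funM.
  apply: (@measurableT_comp _ _ _ _ _ _ (f \_ I)); last exact: measurable_fst.
  by apply: meas_patch; exact: L1_meas.
apply: measurable_funM => //.
apply: (@measurableT_comp _ _ _ _ _ _ (g \_ I)); last exact: measurable_snd.
by apply: meas_patch; exact: L1_meas.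
Qed.

Lemma L1_K x g : L1 I g -> L1 setT (fun u => K x u * (g \_ I) u).
Proof.
move=> Ig; apply: (@L1_eq _ _ (fun u => (g \_ I) u * K x u)) => //.
  by move=> u _; rewrite mulrC.
by apply: (@L1_bndM _ _ _ _ C) => //; [exact: L1_patch|exact: meas_K].
Qed.

Lemma L1_K2 u f : L1 I f -> L1 setT (fun x => K x u * (f \_ I) x).
Proof.
move=> Ig; apply: (@L1_eq _ _ (fun x => (f \_ I) x * K x u)) => //.
  by move=> x _; rewrite mulrC.
by apply: (@L1_bndM _ _ _ _ C) => //; [exact: L1_patch|exact: meas_K2].
Qed.

Lemma integrable_h f g : L1 I f -> L1 I g -> (leb \x leb)%E.-integrable setT (h f g).
Proof.
move=> If Ig; apply/(integrable12ltyP leb leb (meas_h If Ig)).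
set N := \int[leb]_(u in setT) `|(g \_ I) u|.
have IF := L1_abs (L1_patch If); have IG := L1_abs (L1_patch Ig).
apply: (@le_lt_trans _ _ (\int[leb]_(x in setT) ((C * N) * `|(f \_ I) x|)%:E)%E).
  apply: ge0_le_integral => //.
  - by move=> x _; apply: integral_ge0.
  - apply: (@measurable_fun_fubini_tonelli_F _ _ _ _ _ leb (fun z => `|h f g z|%E)) => //.
    by apply: measurableT_comp => //; exact: meas_h.
  - by apply: meas_EFin; apply: L1_meas; exact: (L1Z _ measurableT IF).
  move=> x _.
  apply: (@le_trans _ _ (\int[leb]_(u in setT) ((C * `|(f \_ I) x|) * `|(g \_ I) u|)%:E)%E).
    apply: ge0_le_integral => //.
    - apply: (@measurableT_comp _ _ _ _ _ _ (@abse R)) => //.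
      exact: (meas_EFin (L1_meas (L1Z ((f \_ I) x) measurableT (L1_K x Ig)))).
    - by apply: meas_EFin; apply: L1_meas; exact: (L1Z _ measurableT IG).
    - move=> u _; rewrite lee_fin !normrM mulrCA -mulrA ler_wpM2r ?mulr_ge0//.
  rewrite int_EFin//; last exact: (L1Z _ measurableT IG).
  by rewrite (@RintegralZl _ _ _ leb)// mulrAC.
rewrite int_EFin ?ltry//; exact: (L1Z _ measurableT IF).
Qed.

Lemma inner_int f g x : L1 I g ->
  (\int[leb]_u h f g (x, u))%E = ((f \_ I) x * \int[leb]_(u in I) (K x u * g u))%:E.
Proof.
move=> Ig; rewrite /h/=.
rewrite int_EFin//; last exact: (L1Z _ measurableT (L1_K x Ig)).
rewrite (@RintegralZl _ _ _ leb)//; last exact: L1_K.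
congr (_ * _)%:E; rewrite [RHS](@Rintegral_mkcond _ _ _ leb).
by apply: eq_Rintegral => u _; rewrite !patchE; case: ifP => //; rewrite mulr0.
Qed.

Lemma inner_int2 f g u : L1 I f ->
  (\int[leb]_x h f g (x, u))%E = ((g \_ I) u * \int[leb]_(x in I) (K x u * f x))%:E.
Proof.
move=> If; rewrite /h/=.
have -> : (\int[leb]_x ((f \_ I) x * (K x u * (g \_ I) u))%:E)%E =
  (\int[leb]_x ((g \_ I) u * (K x u * (f \_ I) x))%:E)%E.
  by apply: eq_integral => x _; congr EFin; ring.
rewrite int_EFin//; last exact: (L1Z _ measurableT (L1_K2 u If)).
rewrite (@RintegralZl _ _ _ leb)//; last exact: L1_K2.
congr (_ * _)%:E; rewrite [RHS](@Rintegral_mkcond _ _ _ leb).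
by apply: eq_Rintegral => x _; rewrite !patchE; case: ifP => //; rewrite mulr0.
Qed.

Lemma fubini_bnd f g : L1 I f -> L1 I g ->
  \int[leb]_(x in I) (f x * \int[leb]_(u in I) (K x u * g u)) =
  \int[leb]_(u in I) (g u * \int[leb]_(x in I) (K x u * f x)).
Proof.
move=> If Ig; have := Fubini (integrable_h If Ig).
under eq_integral do rewrite inner_int//.
under [in X in _ = X -> _]eq_integral do rewrite inner_int2//.
move/(congr1 fine); rewrite -!/(Rintegral _ _ _).
rewrite [X in _ -> X = _](@Rintegral_mkcond _ _ _ leb) [X in _ -> _ = X](@Rintegral_mkcond _ _ _ leb).
congr (_ = _); apply: eq_Rintegral => x _; rewrite !patchE; case: ifP => //; by rewrite mul0r.
Qed.

(** Fubini's theorem against the constant function 1 on I provides the measurability of the inner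
    integral. *)
Lemma meas_param g : L1 I g ->
  measurable_fun I (fun x => \int[leb]_(u in I) (K x u * g u)).
Proof.
move=> Ig.
have I1 : L1 I (fun=> 1 : R) by apply: (@L1_bnd _ _ _ 1); [exact: mI|exact: I_lty| |move=> x _; rewrite normr1].
have := measurable_fubini_F (integrable_h I1 Ig).
rewrite /fubini_F; under eq_fun do rewrite inner_int//.
move/measurable_EFinP => H.
have H' : measurable_fun I (fun x => ((fun=> 1 : R) \_ I) x * \int[leb]_(u in I) (K x u * g u)).
  exact: (measurable_funTS H).
apply: eq_measurable_fun H' => x Ix.
by rewrite patchE Ix/= mul1r.
Qed.

End BoundedKernel.

(** [qk y t] and [- pk y t] are the real and imaginary parts of 1 / (t + i y). *)
Definition qk (y t : R) := t / (t ^+ 2 + y ^+ 2).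
Definition pk (y t : R) := y / (t ^+ 2 + y ^+ 2).

Lemma den_gt0 y t : 0 < y -> 0 < t ^+ 2 + y ^+ 2.
Proof. by move=> y0; rewrite ltr_wpDl ?sqr_ge0// exprn_gt0. Qed.

Lemma pk_ge0 y t : 0 < y -> 0 <= pk y t.
Proof. by move=> y0; rewrite divr_ge0 ?ltW// den_gt0. Qed.

Lemma pk_bnd y t : 0 < y -> `|pk y t| <= y^-1.
Proof.
move=> y0; rewrite ger0_norm ?pk_ge0// /pk ler_pdivrMr ?den_gt0//.
by rewrite mulrC ler_pdivlMr// -expr2 lerDr sqr_ge0.
Qed.

Lemma qk_bnd y t : 0 < y -> `|qk y t| <= y^-1.
Proof.
move=> y0; have d0 := den_gt0 t y0.
rewrite /qk normrM normfV (gtr0_norm d0) ler_pdivrMr// mulrC ler_pdivlMr//.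
rewrite -(real_normK (num_real t)); have := sqr_ge0 (`|t| - y); have := normr_ge0 t.
by nra.
Qed.

Lemma qkN y t : qk y (- t) = - qk y t.
Proof. by rewrite /qk sqrrN mulNr. Qed.

(** Real part of 1 / a - 1 / b = (b - a) / (a b) for a = x - u + i y and b = x - v + i y; [pk_qk] is
    the imaginary part. *)
Lemma qk_pk y u v x : 0 < y -> qk y (x - u) - qk y (x - v) =
  (u - v) * (qk y (x - u) * qk y (x - v) - pk y (x - u) * pk y (x - v)).
Proof.
move=> y0; rewrite /qk /pk.
have := lt0r_neq0 (den_gt0 (x - u) y0); have := lt0r_neq0 (den_gt0 (x - v) y0).
by move=> ? ?; field; apply/andP.
Qed.

Lemma pk_qk y u v x : 0 < y -> pk y (x - u) - pk y (x - v) =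
  (u - v) * (qk y (x - u) * pk y (x - v) + pk y (x - u) * qk y (x - v)).
Proof.
move=> y0; rewrite /qk /pk.
have := lt0r_neq0 (den_gt0 (x - u) y0); have := lt0r_neq0 (den_gt0 (x - v) y0).
by move=> ? ?; field; apply/andP.
Qed.

Lemma cont_qk y : 0 < y -> continuous (qk y).
Proof.
move=> y0 t; apply: cvgM; first exact: cvg_id.
apply: cvgV; first by rewrite gt_eqF// den_gt0.
by apply: cvgD; [exact: exprn_continuous|exact: cvg_cst].
Qed.

Lemma cont_pk y : 0 < y -> continuous (pk y).
Proof.
move=> y0 t; apply: cvgM; first exact: cvg_cst.
apply: cvgV; first by rewrite gt_eqF// den_gt0.
by apply: cvgD; [exact: exprn_continuous|exact: cvg_cst].
Qed.

Lemma meas_subr D x : measurable_fun D (fun u => x - u).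
Proof. exact: measurable_funB. Qed.

Lemma meas_qk D y x : 0 < y -> measurable_fun D (fun u => qk y (x - u)).
Proof.
move=> y0; apply: (@measurableT_comp _ _ _ _ _ _ (qk y)); last exact: meas_subr.
by apply: continuous_measurable_fun; exact: cont_qk.
Qed.

Lemma meas_pk D y x : 0 < y -> measurable_fun D (fun u => pk y (x - u)).
Proof.
move=> y0; apply: (@measurableT_comp _ _ _ _ _ _ (pk y)); last exact: meas_subr.
by apply: continuous_measurable_fun; exact: cont_pk.
Qed.

Lemma meas2_qk y : 0 < y ->
  measurable_fun [set: measurableTypeR R * measurableTypeR R] (fun z => qk y (z.1 - z.2)).
Proof.
move=> y0; apply: (@measurableT_comp _ _ _ _ _ _ (qk y)).
  by apply: continuous_measurable_fun; exact: cont_qk.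
by apply: measurable_funB; [exact: measurable_fst|exact: measurable_snd].
Qed.

(* As y -> 0+, [Q y f] tends to the Hilbert transform of f, taken without the
   factor 1/pi, and [P y f] tends to pi f. *)
Definition Q y f x := \int[leb]_(u in I) (qk y (x - u) * f u).
Definition P y f x := \int[leb]_(u in I) (pk y (x - u) * f u).

Lemma L1_qk y x f : 0 < y -> L1 I f -> L1 I (fun u => qk y (x - u) * f u).
Proof.
move=> y0 If; apply: (@L1_eq _ _ (fun u => f u * qk y (x - u))) => //; first exact: mI.
  by move=> u _; rewrite mulrC.
by apply: (@L1_bndM _ _ _ _ y^-1) => //; [exact: mI|exact: meas_qk|move=> *; exact: qk_bnd].
Qed.

Lemma L1_pk y x f : 0 < y -> L1 I f -> L1 I (fun u => pk y (x - u) * f u).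
Proof.
move=> y0 If; apply: (@L1_eq _ _ (fun u => f u * pk y (x - u))) => //; first exact: mI.
  by move=> u _; rewrite mulrC.
by apply: (@L1_bndM _ _ _ _ y^-1) => //; [exact: mI|exact: meas_pk|move=> *; exact: pk_bnd].
Qed.

Lemma QD y f g x : 0 < y -> L1 I f -> L1 I g -> Q y (fun u => f u + g u) x = Q y f x + Q y g x.
Proof.
move=> y0 If Ig; rewrite /Q -(@RintegralD _ _ _ leb I)//; last 3 first.
- exact: mI.
- exact: L1_qk.
- exact: L1_qk.
by apply: eq_int => u _; rewrite mulrDr.
Qed.

Lemma QZ y k f x : 0 < y -> L1 I f -> Q y (fun u => k * f u) x = k * Q y f x.
Proof.
move=> y0 If; rewrite /Q -(@RintegralZl _ _ _ leb I)//; last 2 first.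
- exact: mI.
- exact: L1_qk.
by apply: eq_int => u _; rewrite mulrCA.
Qed.

Lemma QB y f g x : 0 < y -> L1 I f -> L1 I g -> Q y (fun u => f u - g u) x = Q y f x - Q y g x.
Proof.
move=> y0 If Ig; rewrite -mulN1r -QZ// -QD//; last exact: (L1Z _ mI Ig).
by apply: eq_int => u _; rewrite mulN1r.
Qed.

Lemma PB y f g x : 0 < y -> L1 I f -> L1 I g -> P y (fun u => f u - g u) x = P y f x - P y g x.
Proof.
move=> y0 If Ig; rewrite /P -(@RintegralB _ _ _ leb I)//; last 3 first.
- exact: mI.
- exact: L1_pk.
- exact: L1_pk.
by apply: eq_int => u _; rewrite mulrBr.
Qed.

Lemma Q_le y f x : 0 < y -> L1 I f -> `|Q y f x| <= y^-1 * \int[leb]_(u in I) `|f u|.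
Proof.
move=> y0 If; rewrite -(@RintegralZl _ _ _ leb I _ _ mI (L1_abs If)).
apply: int_absle; [exact: mI|exact: L1_qk|exact: (L1Z _ mI (L1_abs If))|].
by move=> u _; rewrite normrM ler_wpM2r// qk_bnd.
Qed.

Lemma P_le y f x : 0 < y -> L1 I f -> `|P y f x| <= y^-1 * \int[leb]_(u in I) `|f u|.
Proof.
move=> y0 If; rewrite -(@RintegralZl _ _ _ leb I _ _ mI (L1_abs If)).
apply: int_absle; [exact: mI|exact: L1_pk|exact: (L1Z _ mI (L1_abs If))|].
by move=> u _; rewrite normrM ler_wpM2r// pk_bnd.
Qed.

Lemma meas_Q y f : 0 < y -> L1 I f -> measurable_fun I (Q y f).
Proof.
move=> y0 If; apply: (@meas_param (fun x u => qk y (x - u)) y^-1) => //.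
  exact: meas2_qk.
by move=> *; exact: qk_bnd.
Qed.

Lemma meas2_pk y : 0 < y ->
  measurable_fun [set: measurableTypeR R * measurableTypeR R] (fun z => pk y (z.1 - z.2)).
Proof.
move=> y0; apply: (@measurableT_comp _ _ _ _ _ _ (pk y)).
  by apply: continuous_measurable_fun; exact: cont_pk.
by apply: measurable_funB; [exact: measurable_fst|exact: measurable_snd].
Qed.

Lemma meas_P y f : 0 < y -> L1 I f -> measurable_fun I (P y f).
Proof.
move=> y0 If; apply: (@meas_param (fun x u => pk y (x - u)) y^-1) => //.
  exact: meas2_pk.
by move=> *; exact: pk_bnd.
Qed.

(** The kernel is odd, and at positive height it is bounded, so the order of integration can be
    exchanged. Antisymmetry of V is obtained from this by letting y -> 0. *)
Lemma Q_antisym y f g : 0 < y -> L1 I f -> L1 I g ->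
  \int[leb]_(x in I) (f x * Q y g x) = - \int[leb]_(x in I) (g x * Q y f x).
Proof.
move=> y0 If Ig.
rewrite (@fubini_bnd (fun x u => qk y (x - u)) y^-1)//; last 2 first.
- exact: meas2_qk.
- by move=> *; exact: qk_bnd.
rewrite -mulN1r -(@RintegralZl _ _ _ leb I _ _ mI); last first.
  apply: (@L1_bndM _ _ _ _ (y^-1 * \int[leb]_(u in I) `|f u|)) => //; first exact: mI.
  - exact: meas_Q.
  - by move=> x _; exact: Q_le.
apply: eq_int => u Iu; rewrite mulrCA; congr (_ * _).
rewrite /Q mulN1r -mulN1r -(@RintegralZl _ _ _ leb I _ _ mI); last exact: L1_qk.
by apply: eq_int => x _; rewrite -opprB qkN mulrA mulN1r.
Qed.

End Kernels.

Arguments mI {R}.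
Arguments I_lty {R}.

(** * Lebesgue points and truncated integrals *)

Section LebesguePoints.
Variable R : realType.
Local Notation leb := (@lebesgue_measure R).
Local Notation I := (@unit_itv R).
Implicit Types (D : set R) (f g h : R -> R) (x y t u v a b c e d r l : R).

(** * Integration by antiderivatives and the rules of differentiation *)

Lemma ftc_oo a b f F : a < b -> {within `[a, b], continuous f} ->
  {within `[a, b], continuous F} ->
  (forall x, a < x < b -> is_derive x 1 F (f x)) ->
  L1 `]a, b[ f /\ \int[leb]_(x in `]a, b[) f x = F b - F a.
Proof.
move=> ab cf cF dF.
have If : L1 `[a, b] f.
  by apply: continuous_compact_integrable => //; exact: segment_compact.
have If' : L1 `]a, b[ f.
  apply: L1S If => //; exact: subset_itv_oo_cc.
split=> //.
have -> : \int[leb]_(x in `]a, b[) f x = \int[leb]_(x in `[a, b]) f x.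
  rewrite Rintegral_itv_bndo_bndc ?Rintegral_itv_obnd_cbnd//.
  apply: L1S If => //; apply: subset_itvr; by rewrite bnd_simp.
rewrite /Rintegral; have := @continuous_FTC2 R f F a b ab cf.
have [cL1 c2 c3] := (continuous_within_itvP F ab).1 cF.
move=> -> //; first by split => // x; rewrite in_itv/= => /dF H; exact: ex_derive.
by move=> x; rewrite in_itv/= => /dF H; rewrite derive1E derive_val.
Qed.

(** The rules that follow are assembled into a proof term whose derivative has an unsimplified
    value; this lemma then leaves an equation for [ring] or [field]. *)
Lemma is_derive1_eq f u a b : is_derive u 1 f a -> a = b -> is_derive u 1 f b.
Proof. by move=> h <-. Qed.

Lemma dX u : is_derive u 1 (fun z : R => z) 1.
Proof. exact: is_derive_id. Qed.

Lemma dC c u : is_derive u 1 (fun _ : R => c) 0.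
Proof. exact: is_derive_cst. Qed.

Lemma dD f g u a b : is_derive u 1 f a -> is_derive u 1 g b ->
  is_derive u 1 (fun z => f z + g z) (a + b).
Proof. by move=> ? ?; exact: is_deriveD. Qed.

Lemma dB f g u a b : is_derive u 1 f a -> is_derive u 1 g b ->
  is_derive u 1 (fun z => f z - g z) (a - b).
Proof. by move=> ? ?; exact: is_deriveB. Qed.

Lemma dN f u a : is_derive u 1 f a -> is_derive u 1 (fun z => - f z) (- a).
Proof. by move=> ?; exact: is_deriveN. Qed.

Lemma dM f g u a b : is_derive u 1 f a -> is_derive u 1 g b ->
  is_derive u 1 (fun z => f z * g z) (f u * b + g u * a).
Proof. by move=> ? ?; exact: is_deriveM. Qed.

Lemma dV f u a : f u != 0 -> is_derive u 1 f a ->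
  is_derive u 1 (fun z => (f z)^-1) (- (f u) ^- 2 * a).
Proof. by move=> ? ?; exact: is_deriveV. Qed.

Lemma dcomp f g u a b : is_derive (g u) 1 f a -> is_derive u 1 g b ->
  is_derive u 1 (fun z => f (g z)) (a * b).
Proof. exact: is_derive1_comp. Qed.

Lemma dcont f u a : is_derive u 1 f a -> {for u, continuous f}.
Proof. by move=> h; apply: differentiable_continuous; apply/derivable1_diffP; exact: ex_derive. Qed.

(** The truncation is put into the kernel, so that the domain of integration in [H] stays I. The
    limit of [H e f x] as e -> 0 is the principal value. *)
Definition hk e t := if e < `|t| then t^-1 else 0.
Definition H e f x := \int[leb]_(u in I) (hk e (x - u) * f u).

(** This includes t = 0, where [qk y 0] is 0 and the inverse of 0 is 0 by convention. *)
Lemma qk_cvg t : qk y t @[y --> 0^'+] --> t^-1.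
Proof.
have [->|t0] := eqVneq t 0.
  rewrite invr0 [X in X @ _](_ : _ = fun=> 0); first exact: cvg_cst.
  by apply/funext => y; rewrite /qk mul0r.
have -> : t^-1 = t / (t ^+ 2 + 0 ^+ 2) by field.
apply: cvgM; first exact: cvg_cst.
apply: cvgV; first by rewrite expr0n addr0 expf_neq0.
apply: cvgD; first exact: cvg_cst.
apply: cvg_at_right_filter; exact: exprn_continuous.
Qed.

Lemma meas_hk1 e : measurable_fun setT (hk e).
Proof.
apply: measurable_fun_ifT => //.
  by apply: measurable_fun_ltr => //; exact: measurableT_comp.
apply: (@meas_right _ _ (@qk R)).
  by move=> y y0; apply: continuous_measurable_fun; exact: cont_qk.
by move=> t _; exact: qk_cvg.
Qed.

Lemma meas_hk D e x : measurable_fun D (fun u => hk e (x - u)).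
Proof.
apply: (@measurableT_comp _ _ _ _ _ _ (hk e)); last exact: meas_subr.
exact: meas_hk1.
Qed.

Lemma meas2_hk e :
  measurable_fun [set: measurableTypeR R * measurableTypeR R] (fun z => hk e (z.1 - z.2)).
Proof.
apply: (@measurableT_comp _ _ _ _ _ _ (hk e)); first exact: meas_hk1.
by apply: measurable_funB; [exact: measurable_fst|exact: measurable_snd].
Qed.

Lemma hk_bnd e t : 0 < e -> `|hk e t| <= e^-1.
Proof.
move=> e0; rewrite /hk; case: ifPn => [et|_]; last by rewrite normr0 invr_ge0 ltW.
have t0 : 0 < `|t| by exact: lt_trans et.
by rewrite normfV lef_pV2 ?posrE// ltW.
Qed.

(** The difference is e^2 / (t (t^2 + e^2)) for |t| > e and -t / (t^2 + e^2) otherwise. With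
    truncation and height at the same scale, the Poisson kernel thus controls the passage from one
    to the other. *)
Lemma hk_qk e t : 0 < e -> `|hk e t - qk e t| <= pk e t.
Proof.
move=> e0; have d0 := den_gt0 t e0; have d0' := lt0r_neq0 d0; rewrite /hk /qk /pk; case: ifPn => [et|].
  have t0 : t != 0 by rewrite -normr_gt0 (lt_trans e0).
  have -> : t^-1 - t / (t ^+ 2 + e ^+ 2) = (e / t) * (e / (t ^+ 2 + e ^+ 2)) by field; apply/andP.
  have p0 : 0 <= e / (t ^+ 2 + e ^+ 2) by rewrite divr_ge0 ?ltW.
  rewrite normrM [X in _ * X]ger0_norm// ler_piMl// normrM normfV gtr0_norm//.
  by rewrite ler_pdivrMr ?normr_gt0// mul1r ltW.
rewrite -leNgt sub0r normrN normrM normfV (gtr0_norm d0) => te.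
by rewrite ler_wpM2r// invr_ge0 ltW.
Qed.

(* The Poisson form of a Lebesgue point, centred at the value f x. *)
Definition lebp f x :=
  (fun y => \int[leb]_(u in I) (pk y (x - u) * `|f u - f x|)) @ 0^'+ --> 0.

(** * Poisson integrals at a Lebesgue point *)

Definition bk r t : R := if `|t| < r then 1 else 0.

Lemma bk_bnd r t : `|bk r t| <= 1.
Proof. by rewrite /bk; case: ifP; rewrite ?normr1 ?normr0. Qed.

Lemma bk_ge0 r t : 0 <= bk r t.
Proof. by rewrite /bk; case: ifP. Qed.

Definition J f x r := \int[leb]_(u in I) (bk (r) (x - u) * `|f u - f x|).

Lemma meas_ball D x r : measurable_fun D (fun u => bk r (x - u)).
Proof.
apply: (@measurableT_comp _ _ _ _ _ _ (bk r)); last exact: meas_subr.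
apply: measurable_fun_ifT => //.
by apply: measurable_fun_ltr => //; exact: measurableT_comp.
Qed.

Lemma L1_cst c : L1 I (fun=> c).
Proof.
by apply: (@L1_bnd _ _ _ `|c|); [exact: mI|exact: I_lty| |].
Qed.

Lemma L1_dev f x : L1 I f -> L1 I (fun u => `|f u - f x|).
Proof.
by move=> If; apply/L1_abs/L1B => //; [exact: mI|exact: L1_cst].
Qed.

Lemma L1_J f x r : L1 I f -> L1 I (fun u => bk (r) (x - u) * `|f u - f x|).
Proof.
move=> If; apply: (@L1_eq _ _ (fun u => `|f u - f x| * bk (r) (x - u))); first exact: mI.
  by move=> u _; rewrite mulrC.
apply: (@L1_bndM _ _ _ _ 1); [exact: mI|exact: L1_dev|exact: meas_ball|].
by move=> u _; exact: bk_bnd.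
Qed.

Lemma lebpt_J f x : L1 I f -> I x -> lebesgue_pt (f \_ I) x ->
  forall e, 0 < e -> exists2 d, 0 < d & forall r, 0 < r -> r < d -> J f x r <= e * r.
Proof.
move=> If Ix lx e e0.
(* The ball has measure 2 r, so an average below e / 2 gives an integral below e r. *)
have e20 : (0 < (e / 2)%:E)%E by rewrite lte_fin divr_gt0.
have : \forall r \near 0^'+, (davg (f \_ I) x r < (e / 2)%:E)%E.
  exact: (lx _ (open_ereal_lt' e20)).
case=> d /= d0 Hd; exists d => // r r0 rd.
have {Hd} := Hd r; rewrite /= sub0r normrN gtr0_norm// => /(_ rd r0).
rewrite /davg /iavg (lebesgue_measure_ball _ (ltW r0)) => Hr.
have r2 : 0 < r *+ 2 by rewrite mulrn_wgt0.
rewrite -lee_fin -int_EFin; [|exact: mI|exact: L1_J].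
apply: (@le_trans _ _ (\int[leb]_(u in ball x r) `|(f \_ I) u - (f \_ I) x|%:E)%E).
  have -> : (\int[leb]_(u in I) (bk r (x - u) * `|f u - f x|)%:E =
     \int[leb]_(u in I) ((fun u => (`|(f \_ I) u - (f \_ I) x|)%:E) \_ (ball x r)) u)%E.
    apply: eq_integral => u; rewrite inE => Iu; rewrite [RHS]patchE /bk.
    have -> : (u \in (ball x r : set R)) = (`|x - u| < r) by apply/idP/idP; rewrite inE.
    case: ifPn => _; last by rewrite mul0r.
    by rewrite mul1r !patchE !mem_set.
  rewrite -integral_mkcondr; apply: ge0_subset_integral => //.
  - by apply: measurableI; [exact: mI|exact: measurable_ball].
  - exact: measurable_ball.
  - apply: meas_EFin; apply: measurableT_comp => //; apply: measurable_funB => //.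
    by apply: measurable_funTS; apply: meas_patch; exact: L1_meas.
move: Hr; rewrite inver gt_eqF// lte_pdivrMl// => /ltW /le_trans; apply.
rewrite -EFinM lee_fin mulr2n; lra.
Qed.

Lemma pk_le y t : 0 < y -> t != 0 -> pk y t <= y / t ^+ 2.
Proof.
move=> y0 t0; rewrite /pk ler_wpM2l ?(ltW y0)// lef_pV2 ?posrE ?den_gt0 ?exprn_even_gt0//.
by rewrite lerDl sqr_ge0.
Qed.

(* Splits the Poisson integral over the dyadic balls of radius 2^k y. *)
Lemma pk_dyadic f x y e N : L1 I f -> 0 < y ->
  (forall k, (k <= N)%N -> J f x (2 ^+ k * y) <= e * (2 ^+ k * y)) ->
  \int[leb]_(u in I) (bk (2 ^+ N * y) (x - u) * (pk y (x - u) * `|f u - f x|)) <=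
  e * (8 - 4 / 2 ^+ N).
Proof.
move=> If y0; have Idev := L1_dev x If.
have Ipk : L1 I (fun u => pk y (x - u) * `|f u - f x|) by exact: L1_pk.
have IB r : L1 I (fun u => bk (r) (x - u) * (pk y (x - u) * `|f u - f x|)).
  apply: (@L1_eq _ _ (fun u => (pk y (x - u) * `|f u - f x|) * bk (r) (x - u))); first exact: mI.
    by move=> u _; rewrite mulrC.
  apply: (@L1_bndM _ _ _ _ 1); [exact: mI|by []|exact: meas_ball|].
  by move=> u _; exact: bk_bnd.
elim: N => [|N IH] HJ.
  have := HJ 0%N isT; rewrite expr0 mul1r divr1 => H0.
  have e0 : 0 <= e.
    rewrite -(pmulr_lge0 _ y0); apply: le_trans H0; apply: Rintegral_ge0 => u _.
    by rewrite mulr_ge0// bk_ge0.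
  apply: (@le_trans _ _ (y^-1 * J f x y)).
    rewrite -(@RintegralZl _ _ _ leb I _ _ mI); last exact: L1_J.
    apply: i_le => //; first exact: (LIZ _ (L1_J _ _ If)).
    move=> u _; rewrite [leRHS]mulrCA ler_wpM2l ?bk_ge0// ler_wpM2r//.
    by rewrite (le_trans (ler_norm _))// pk_bnd.
  rewrite mulrC ler_pdivrMr//; apply: (le_trans H0); rewrite ler_wpM2r ?(ltW y0)//.
  by rewrite ler_peMr//; lra.
have {}IH := IH (fun k kN => HJ k (leqW kN)).
(* On the shell 2^N y <= |x - u| the kernel is at most 1 / (4^N y) = c, and c e 2^(N+1) y = 2 e /
   2^N is exactly the increment of the bound from N to N + 1. *)
set c := 4 / (4 ^+ N.+1 * y).
have c0 : 0 <= c by rewrite divr_ge0// ltW// mulr_gt0// exprn_gt0.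
apply: (@le_trans _ _ (e * (8 - 4 / 2 ^+ N) + c * J f x (2 ^+ N.+1 * y))).
  apply: (le_trans _ (lerD IH (lexx _))).
  rewrite -iZ; last exact: L1_J.
  rewrite -iD//; last exact: (LIZ _ (L1_J _ _ If)).
  apply: i_le => //; first exact: (LID (IB _) (LIZ _ (L1_J _ _ If))).
  move=> u _; rewrite /bk; case: ifPn => hN1; last first.
    by rewrite !mul0r mulr0 addr0; apply: mulr_ge0; [case: (_ < _)|rewrite mulr_ge0// pk_ge0].
  have [h1|h1] := ltP `|x - u| (2 ^+ N * y).
    by rewrite !mul1r lerDl mulr_ge0.
  rewrite mul0r add0r !mul1r ler_wpM2r//.
  have xu : x - u != 0 by rewrite -normr_gt0 (lt_le_trans _ h1)// mulr_gt0// exprn_gt0.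
  apply: (le_trans (pk_le y0 xu)).
  rewrite ler_pdivrMr ?exprn_even_gt0// -(real_normK (num_real (x - u))).
  have h2 : (2 ^+ N * y) ^+ 2 <= `|x - u| ^+ 2.
    by rewrite ler_pXn2r// ?nnegrE ?mulr_ge0 ?exprn_ge0 ?ltW.
  apply: (le_trans _ (ler_wpM2l c0 h2)).
  have -> : c * (2 ^+ N * y) ^+ 2 = y; last by [].
  rewrite /c (_ : 4 ^+ N.+1 = 4 * (2 ^+ N) ^+ 2); last first.
    by rewrite exprS -exprM mulnC exprM; congr (_ * _ ^+ _); ring.
  have : (2 : R) ^+ N != 0 by rewrite expf_neq0.
  by have := lt0r_neq0 y0 => ? ?; field; apply/andP.
have HJN := HJ N.+1 (leqnn _).
apply: (le_trans (lerD (lexx _) (ler_wpM2l c0 HJN))).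
rewrite /c.
have -> : (4 : R) ^+ N.+1 = 2 ^+ N.+1 * 2 ^+ N.+1 by rewrite -exprMn -natrM.
rewrite !exprS.
have := lt0r_neq0 y0; have : (2 : R) ^+ N != 0 by rewrite expf_neq0.
by move=> ? ?; rewrite le_eqVlt; apply/orP; left; apply/eqP; field; apply/andP; split.
Qed.

(** Inside a ball of radius comparable to d the dyadic estimate applies with e / 16 and yields at
    most e / 2. Outside, |x - u| >= d / 2 and the kernel is at most 4 y / d^2, which is small
    against the fixed integral M. *)
Lemma lebpt_lebp f x : L1 I f -> I x -> lebesgue_pt (f \_ I) x -> lebp f x.
Proof.
move=> If Ix lx; have Idev := L1_dev x If.
have Ipk y : 0 < y -> L1 I (fun u => pk y (x - u) * `|f u - f x|).
  by move=> y0; exact: L1_pk.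
set M := \int[leb]_(u in I) `|f u - f x|.
have M0 : 0 <= M by apply: Rintegral_ge0.
apply/cvgrPdist_le => e e0.
have e16 : 0 < e / 16 by rewrite divr_gt0.
have [d d0 Hd] := lebpt_J If Ix lx e16.
(* For y below this value the outer part 4 y M / d^2 is at most e / 2; M + 1 replaces M to avoid
   dividing by zero. *)
have c0 : 0 < e * d ^+ 2 / (8 * (M + 1)).
  by rewrite divr_gt0 ?mulr_gt0 ?exprn_gt0// ltr_wpDl.
near=> y.
have y0 : 0 < y by near: y; exact: nbhs_right_gt.
have yd : y < d by near: y; exact: nbhs_right_lt.
have yM : y < e * d ^+ 2 / (8 * (M + 1)) by near: y; exact: nbhs_right_lt.
rewrite sub0r normrN ger0_norm; last first.
  by apply: Rintegral_ge0 => u _; rewrite mulr_ge0// pk_ge0.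
(* The least such exponent is positive because y < d, and its predecessor N satisfies 2^N y < d <=
   2^(N+1) y. *)
have exn : exists n, d <= 2 ^+ n * y.
  have dy0 : 0 <= d / y by rewrite divr_ge0// ltW.
  exists (Num.Def.archi_bound (d / y)); rewrite -ler_pdivrMr//.
  apply: (le_trans (ltW (archi_boundP dy0))).
  by rewrite -natrX ler_nat ltnW// ltn_expl.
case: (ex_minnP exn) => -[|N]; first by rewrite expr0 mul1r leNgt yd.
move=> dN Hmin.
have NJ k : (k <= N)%N -> J f x (2 ^+ k * y) <= e / 16 * (2 ^+ k * y).
  move=> kN; apply: Hd; first by rewrite mulr_gt0// exprn_gt0.
  rewrite ltNge; apply/negP => /Hmin; by rewrite ltnNge kN.
have := pk_dyadic If y0 NJ.
set A := \int[leb]_(u in I) _ => HA.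
apply: (@le_trans _ _ (A + 4 * y / d ^+ 2 * M)).
  have dN2 : d / 2 <= 2 ^+ N * y by move: dN; rewrite exprS; lra.
  rewrite -(@RintegralZl _ _ _ leb I _ _ mI)//.
  have IB : L1 I (fun u => bk (2 ^+ N * y) (x - u) * (pk y (x - u) * `|f u - f x|)).
    apply: (@L1_eq _ _ (fun u => (pk y (x - u) * `|f u - f x|) * bk (2 ^+ N * y) (x - u))); first exact: mI.
      by move=> u _; rewrite mulrC.
    apply: (@L1_bndM _ _ _ _ 1); [exact: mI|exact: Ipk|exact: meas_ball|].
    by move=> u _; exact: bk_bnd.
  rewrite -(@RintegralD _ _ _ leb I)//; last 2 first.
  - exact: mI.
  - exact: (L1Z _ mI Idev).
  apply: (@le_Rintegral _ _ _ leb I); [exact: mI|exact: Ipk|exact: (L1D mI IB (L1Z _ mI Idev))|].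
  move=> u _; rewrite /bk; case: ifPn => h; first by rewrite mul1r lerDl mulr_ge0// mulr_ge0 ?invr_ge0 ?sqr_ge0 ?mulr_ge0// ltW.
  rewrite -leNgt in h; rewrite mul0r add0r ler_wpM2r//.
  have h1 : d / 2 <= `|x - u| by exact: le_trans h.
  have xu : x - u != 0 by rewrite -normr_gt0 (lt_le_trans _ h1)// divr_gt0.
  apply: (le_trans (pk_le y0 xu)).
  rewrite ler_pdivrMr ?exprn_even_gt0// -(real_normK (num_real (x - u))).
  have h2 : (d / 2) ^+ 2 <= `|x - u| ^+ 2.
    by rewrite ler_pXn2r// ?nnegrE ?divr_ge0 ?ltW.
  have cL1 : 0 <= 4 * y / d ^+ 2 by rewrite mulr_ge0 ?invr_ge0 ?sqr_ge0 ?mulr_ge0// ltW.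
  apply: (le_trans _ (ler_wpM2l cL1 h2)).
  rewrite le_eqVlt; apply/orP; left; apply/eqP; field; exact: lt0r_neq0.
have h1 : 0 <= (e / 16) * (4 / 2 ^+ N) by rewrite mulr_ge0 ?divr_ge0 ?exprn_ge0// ltW.
have h2 : 4 * y / d ^+ 2 * M <= e / 2.
  have MM : 0 < M + 1 by rewrite ltr_wpDl.
  have : 4 * y / d ^+ 2 * M <= 4 * y / d ^+ 2 * (M + 1).
    by rewrite ler_wpM2l ?lerDl// mulr_ge0 ?invr_ge0 ?sqr_ge0 ?mulr_ge0// ltW.
  move=> /le_trans; apply.
  have : 4 * y / d ^+ 2 * (M + 1) = y * (4 * (M + 1) / d ^+ 2) by field; exact: lt0r_neq0.
  move=> ->; apply: (@le_trans _ _ (e * d ^+ 2 / (8 * (M + 1)) * (4 * (M + 1) / d ^+ 2))).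
    by rewrite ler_wpM2r ?ltW// divr_gt0 ?exprn_gt0// mulr_gt0.
  rewrite le_eqVlt; apply/orP; left; apply/eqP; field.
  by rewrite !lt0r_neq0.
move: HA; rewrite mulrBr; lra.
Unshelve. all: by end_near.
Qed.

Lemma lebp_ae f : L1 I f -> {ae leb, forall x, I x -> lebp f x}.
Proof.
move=> If.
have : locally_integrable setT (f \_ I).
  by apply: open_integrable_locally => //; [exact: openT|exact: L1_patch].
move/lebesgue_differentiation; apply: ae_imply => x lx Ix; exact: lebpt_lebp.
Qed.

(** * Boundary limits of the Poisson, conjugate Poisson and truncated integrals *)

Lemma cvg_invr_pinfty (c : R) : 0 < c -> c / y @[y --> 0^'+] --> +oo.
Proof.
move=> c0.
apply/cvgryPge => A; near=> y.
have y0 : 0 < y by near: y; exact: nbhs_right_gt.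
rewrite ler_pdivlMr//.
have yA : y < c / (`|A| + 1) by near: y; apply: nbhs_right_lt; rewrite divr_gt0// ltr_wpDl.
move: yA; rewrite ltr_pdivlMr ?ltr_wpDl// => yA.
apply: le_trans (ltW yA); rewrite mulrC ler_wpM2l ?(ltW y0)//.
by rewrite (le_trans (ler_norm A))// lerDl.
Unshelve. all: by end_near. Qed.

Lemma contF_cst_subr x : continuous (fun u => x - u).
Proof. by move=> u; apply: cvgB; [exact: cvg_cst|exact: cvg_id]. Qed.

Lemma P_cst1 y x : 0 < y -> I x -> P y (fun=> 1) x = atan ((1 - x) / y) + atan ((1 + x) / y).
Proof.
move=> y0 /in_I/andP[x1 x2].
have yn0 := lt0r_neq0 y0.
have dF u : is_derive u 1 (fun u => - atan ((x - u) / y)) (pk y (x - u)).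
  have h : is_derive u 1 (fun u => (x - u) * y^-1) (- y^-1).
    apply: (is_derive1_eq (dM (dB (dC x u) (dX u)) (dC y^-1 u))); ring.
  have h2 : is_derive u 1 (fun z => atan ((x - z) / y)) _ := @dcomp atan (fun z => (x - z) / y) u _ _ (is_derive1_atan ((x - u) / y)) h.
  apply: (is_derive1_eq (dN h2)).
  rewrite /pk; have := lt0r_neq0 (den_gt0 (x - u) y0) => ?; field; by rewrite yn0 andbT.
have [|||_] := @ftc_oo (-1) 1 (fun u => pk y (x - u)) (fun u => - atan ((x - u) / y)).
- lra.
- apply: continuous_subspaceT => u; apply: (@continuous_comp _ _ _ (fun u => x - u) (pk y)).
    exact: contF_cst_subr.
  exact: cont_pk.
- apply: continuous_subspaceT => u; exact: dcont (dF u).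
rewrite /P /unit_itv => H'; under eq_Rintegral do rewrite mulr1.
rewrite H' !opprK.
have -> : (x - 1) / y = - ((1 - x) / y) by rewrite -mulNr opprB.
by rewrite atanN opprK [x + 1]addrC.
Qed.

(** The difference between P f and f(x) P 1 is bounded by the integral in [lebp], and P 1 is a sum
    of two arctangents, each tending to pi / 2 at an interior point. *)
Lemma P_cvg f x : L1 I f -> I x -> lebp f x -> P y f x @[y --> 0^'+] --> pi * f x.
Proof.
move=> If Ix lx.
have H1 : P y (fun=> 1) x @[y --> 0^'+] --> pi.
  have [x1 x2] : -1 < x /\ x < 1 by move/in_I : Ix => /andP.
  apply: (@cvg_trans _ ((fun y => atan ((1 - x) / y) + atan ((1 + x) / y)) @ 0^'+)).
    apply: near_eq_cvg; near=> y; rewrite P_cst1//; near: y; exact: nbhs_right_gt.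
  rewrite [pi](splitr pi); apply: cvgD.
    by apply: (@cvg_comp _ _ _ (fun y => (1 - x) / y) atan); [apply: cvg_invr_pinfty; lra|exact: cvgy_atan].
  by apply: (@cvg_comp _ _ _ (fun y => (1 + x) / y) atan); [apply: cvg_invr_pinfty; lra|exact: cvgy_atan].
have H2 : P y f x - f x * P y (fun=> 1) x @[y --> 0^'+] --> 0.
  apply/cvgr0Pnorm_le => e e0.
  move/cvgr0Pnorm_le : lx => /(_ e e0); apply: filterS2 (nbhs_right_gt 0) => y y0.
  apply: le_trans; rewrite [leRHS]ger0_norm; last first.
    by apply: Rintegral_ge0 => u _; rewrite mulr_ge0// pk_ge0.
  rewrite /P -iZ; last by apply: L1_pk => //; exact: L1_cst.
  rewrite -iB; [|exact: L1_pk|by apply: LIZ; apply: L1_pk => //; exact: L1_cst].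
  apply: i_absle.
  - by apply: LIB; [exact: L1_pk|apply: LIZ; apply: L1_pk => //; exact: L1_cst].
  - by apply: L1_pk => //; exact: L1_dev.
  - move=> u _; rewrite mulr1 [f x * _]mulrC -mulrBr.
    by rewrite normrM ger0_norm// pk_ge0.
have -> : pi * f x = 0 + f x * pi by rewrite add0r mulrC.
have H3 : (P y f x - f x * P y (fun=> 1) x) + f x * P y (fun=> 1) x @[y --> 0^'+] --> 0 + f x * pi.
  by apply: cvgD => //; apply: cvgM => //; exact: cvg_cst.
apply: cvg_trans H3; apply: near_eq_cvg; near=> y; by rewrite /= subrK.
Unshelve. all: by end_near. Qed.

(** By [hk_qk] the expression is bounded by the Poisson integral of |f - f(x)|. *)
Lemma kap_cvg f x : L1 I f -> lebp f x ->
  (H y f x - Q y f x) - f x * (H y (fun=> 1) x - Q y (fun=> 1) x) @[y --> 0^'+] --> 0.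
Proof.
move=> If lx.
have LH y g : 0 < y -> L1 I g -> L1 I (fun u => hk y (x - u) * g u).
  move=> y0 Ig; apply: (@LI_eq _ (fun u => g u * hk y (x - u))); first by move=> u _; rewrite mulrC.
  by apply: (@LI_bndM _ _ _ y^-1) => //; [exact: meas_hk|move=> u _; exact: hk_bnd].
apply/cvgr0Pnorm_le => e e0.
move/cvgr0Pnorm_le : lx => /(_ e e0); apply: filterS2 (nbhs_right_gt 0) => y y0.
apply: le_trans; rewrite [leRHS]ger0_norm; last first.
  by apply: Rintegral_ge0 => u _; rewrite mulr_ge0// pk_ge0.
have I1 := @L1_cst 1.
rewrite /H /Q -!iB; try exact: LH; try exact: L1_qk.
rewrite -iZ; last by apply: LIB; [exact: LH|exact: L1_qk].
rewrite -iB; last 2 first.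
- by apply: LIB; [exact: LH|exact: L1_qk].
- by apply: LIZ; apply: LIB; [exact: LH|exact: L1_qk].
apply: i_absle.
- by apply: LIB; [|apply: LIZ]; apply: LIB; by [exact: LH|exact: L1_qk].
- by apply: L1_pk => //; exact: L1_dev.
- move=> u _; rewrite !mulr1 -mulrBl [f x * _]mulrC -mulrBr normrM.
  by rewrite ler_wpM2r// hk_qk.
Qed.

Lemma within_cont D f : {in D, continuous f} -> {within D, continuous f}.
Proof. by move=> h; apply: continuous_in_subspaceT => u uD; exact: h. Qed.

Lemma H_split e f x : 0 < e -> I x -> -1 < x - e -> x + e < 1 -> L1 I f ->
  H e f x = \int[leb]_(u in `]-1, (x - e)[) (f u / (x - u)) +
            \int[leb]_(u in `](x + e), 1[) (f u / (x - u)).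
Proof.
move=> e0 /in_I/andP[x1 x2] h1 h2 If.
have LH : L1 I (fun u => hk e (x - u) * f u).
  apply: (@LI_eq _ (fun u => f u * hk e (x - u))); first by move=> u _; rewrite mulrC.
  by apply: (@LI_bndM _ _ _ e^-1) => //; [exact: meas_hk|move=> u _; exact: hk_bnd].
pose A := `]-1, (x - e)[%classic; pose B := `](x + e), 1[%classic.
have AB0 : [disjoint A & B].
  apply/disj_setPS => u []; rewrite /A /B /= !in_itv/= => /andP[_ u1] /andP[u2 _]; lra.
have eqA : \int[leb]_(u in A) (f u / (x - u)) = \int[leb]_(u in A) (hk e (x - u) * f u).
  apply: eq_int => u; rewrite /A /B /= in_itv/= => /andP[u1 u2].
  by rewrite /hk gtr0_norm ?ifT 1?mulrC//; lra.
have eqB : \int[leb]_(u in B) (f u / (x - u)) = \int[leb]_(u in B) (hk e (x - u) * f u).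
  apply: eq_int => u; rewrite /A /B /= in_itv/= => /andP[u1 u2].
  by rewrite /hk ltr0_norm ?ifT 1?mulrC//; lra.
have sAB : A `|` B `<=` I.
  by move=> u []; rewrite /A /B /unit_itv/= !in_itv/= => /andP[u1 u2]; apply/andP; split; lra.
have mA : measurable A by exact: measurable_itv.
have mB : measurable B by exact: measurable_itv.
rewrite eqA eqB -(@Rintegral_setU _ _ _ leb A B _ mA mB)//; last first.
  exact: (L1S mI (measurableU _ _ mA mB) sAB LH).
rewrite /H [LHS](@Rintegral_mkcond _ _ _ leb) [RHS](@Rintegral_mkcond _ _ _ leb).
apply: eq_Rintegral => u _; rewrite !patchE.
case: ifPn => [/set_mem Iu|nIu]; case: ifPn => [/set_mem ABu|nAB] //.
- rewrite /hk; case: ifPn => h; last by rewrite mul0r.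
  exfalso; move/negP : nAB; apply; apply/mem_set.
  move/in_I : Iu => /andP[u1 u2].
  have [ux|ux] := ltP u x.
    left; rewrite /A/= in_itv/= u1/=; move: h; rewrite gtr0_norm; lra.
  right; rewrite /B/= in_itv/= u2 andbT; move: h; rewrite ler0_norm; lra.
- by exfalso; move/negP : nIu; apply; apply/mem_set; exact: sAB.
Qed.

(** The truncation is symmetric about x, so the terms ln e from the two sides cancel and the value
    does not depend on e. *)
Lemma H_cst1 e x : 0 < e -> I x -> -1 < x - e -> x + e < 1 ->
  H e (fun=> 1) x = ln (1 + x) - ln (1 - x).
Proof.
move=> e0 Ix h1 h2; rewrite (H_split e0 Ix h1 h2); last exact: L1_cst.
have /andP[x1 x2] := (in_I x).1 Ix.
have dF1 u : u < x -> is_derive u 1 (fun z => - ln (x - z)) (1 / (x - u)).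
  move=> ux; have xu : 0 < x - u by lra.
  have h3 : is_derive u 1 (fun z => ln (x - z)) _ :=
    @dcomp (@ln R) (fun z => x - z) u _ _ (is_derive1_ln xu) (dB (dC x u) (dX u)).
  apply: (is_derive1_eq (dN h3)); field; exact: lt0r_neq0.
have dF2 u : x < u -> is_derive u 1 (fun z => - ln (z - x)) (1 / (x - u)).
  move=> ux; have xu : 0 < u - x by lra.
  have h3 : is_derive u 1 (fun z => ln (z - x)) _ :=
    @dcomp (@ln R) (fun z => z - x) u _ _ (is_derive1_ln xu) (dB (dX u) (dC x u)).
  apply: (is_derive1_eq (dN h3)); field; rewrite -oppr_eq0 opprB; have := lt0r_neq0 xu.
  by move=> ->.
have dI u : u != x -> {for u, continuous (fun z => 1 / (x - z))}.
  move=> ux; have xu : x - u != 0 by rewrite subr_eq0 eq_sym.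
  exact: dcont (dM (dC 1 u) (@dV (fun z => x - z) u _ xu (dB (dC x u) (dX u)))).
have [||||_ ->] := @ftc_oo (-1) (x - e) (fun u => 1 / (x - u)) (fun z => - ln (x - z)) => //.
- apply: within_cont => u; rewrite inE/= in_itv/= => /andP[u1 u2]; apply: dI; apply/eqP; lra.
- apply: within_cont => u; rewrite inE/= in_itv/= => /andP[u1 u2]; apply: dcont; apply: dF1; lra.
- move=> u /andP[u1 u2]; apply: dF1; lra.
have [||||_ ->] := @ftc_oo (x + e) 1 (fun u => 1 / (x - u)) (fun z => - ln (z - x)) => //.
- apply: within_cont => u; rewrite inE/= in_itv/= => /andP[u1 u2]; apply: dI; apply/eqP; lra.
- apply: within_cont => u; rewrite inE/= in_itv/= => /andP[u1 u2]; apply: dcont; apply: dF2; lra.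
- move=> u /andP[u1 u2]; apply: dF2; lra.
rewrite (_ : x - (x - e) = e); last by ring.
rewrite (_ : x + e - x = e); last by ring.
rewrite (_ : x - -1 = 1 + x); last by ring.
ring.
Qed.

Lemma Q_cst1 y x : 0 < y -> I x ->
  Q y (fun=> 1) x = (ln ((1 + x) ^+ 2 + y ^+ 2) - ln ((1 - x) ^+ 2 + y ^+ 2)) / 2.
Proof.
move=> y0 /in_I/andP[x1 x2].
have dF u : is_derive u 1 (fun u => - (ln ((x - u) * (x - u) + y ^+ 2) / 2)) (qk y (x - u)).
  have d0 : 0 < (x - u) * (x - u) + y ^+ 2 by rewrite -expr2 den_gt0.
  have hs := dB (dC x u) (dX u).
  have hq := dD (dM hs hs) (dC (y ^+ 2) u).
  have h2 : is_derive u 1 (fun z => ln ((x - z) * (x - z) + y ^+ 2)) _ :=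
    @dcomp (@ln R) (fun z => (x - z) * (x - z) + y ^+ 2) u _ _ (is_derive1_ln d0) hq.
  apply: (is_derive1_eq (dN (dM h2 (dC 2^-1 u)))).
  rewrite /qk; have := lt0r_neq0 d0 => ?; field; by rewrite expr2.
have [|||_] := @ftc_oo (-1) 1 (fun u => qk y (x - u)) (fun u => - (ln ((x - u) * (x - u) + y ^+ 2) / 2)).
- lra.
- apply: continuous_subspaceT => u; apply: (@continuous_comp _ _ _ (fun u => x - u) (qk y)).
    exact: contF_cst_subr.
  exact: cont_qk.
- by apply: continuous_subspaceT => u; exact: dcont (dF u).
rewrite /Q /unit_itv => H'; under eq_Rintegral do rewrite mulr1.
rewrite H' opprK -!expr2 (_ : (x - 1) ^+ 2 = (1 - x) ^+ 2); last by ring.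
rewrite (_ : x - -1 = 1 + x); last by ring.
ring.
Qed.

Lemma HQ_cst1 x : I x -> H y (fun=> 1) x - Q y (fun=> 1) x @[y --> 0^'+] --> 0.
Proof.
move=> Ix; have /andP[x1 x2] := (in_I x).1 Ix.
have c (a : R) : 0 < a -> ln (a ^+ 2 + y ^+ 2) / 2 @[y --> 0^'+] --> ln a.
  move=> a0.
  have -> : ln a = ln (a ^+ 2 + 0 ^+ 2) / 2.
    by rewrite expr0n/= addr0 lnXn// mulr2n; field.
  apply: cvgM; last exact: cvg_cst.
  apply: (@cvg_comp _ _ _ (fun y => a ^+ 2 + y ^+ 2) (@ln R) _ (nbhs (a ^+ 2 + 0 ^+ 2))); last first.
    by apply: continuous_ln; rewrite expr0n addr0 exprn_gt0.
  apply: cvgD; first exact: cvg_cst.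
  apply: cvg_at_right_filter; exact: exprn_continuous.
have H3 : (ln (1 + x) - ln (1 - x)) - (ln ((1 + x) ^+ 2 + y ^+ 2) / 2 - ln ((1 - x) ^+ 2 + y ^+ 2) / 2)
  @[y --> 0^'+] --> (ln (1 + x) - ln (1 - x)) - (ln (1 + x) - ln (1 - x)).
  apply: cvgB; first exact: cvg_cst.
  by apply: cvgB; apply: c; lra.
rewrite subrr in H3; apply: cvg_trans H3; apply: near_eq_cvg; near=> y.
have y0 : 0 < y by near: y; exact: nbhs_right_gt.
rewrite H_cst1// ?Q_cst1//.
- by rewrite mulrBl.
- have : y < x + 1 by near: y; apply: nbhs_right_lt; lra.
  lra.
- have : y < 1 - x by near: y; apply: nbhs_right_lt; lra.
  lra.
Unshelve. all: by end_near. Qed.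

(** [kap_cvg] replaces f by the constant f(x), for which both regularisations are explicit and have
    the same limit. Hence principal values may be computed as limits of conjugate Poisson
    integrals. *)
Lemma HQ_cvg f x : L1 I f -> I x -> lebp f x ->
  H y f x - Q y f x @[y --> 0^'+] --> 0.
Proof.
move=> If Ix lx.
have := kap_cvg If lx => h1.
have h2 : f x * (H y (fun=> 1) x - Q y (fun=> 1) x) @[y --> 0^'+] --> f x * 0.
  by apply: cvgM; [exact: cvg_cst|exact: HQ_cst1].
have h3 : ((H y f x - Q y f x) - f x * (H y (fun=> 1) x - Q y (fun=> 1) x))
   + f x * (H y (fun=> 1) x - Q y (fun=> 1) x) @[y --> 0^'+] --> 0 + f x * 0 by exact: cvgD.
rewrite mulr0 addr0 in h3; apply: cvg_trans h3; apply: near_eq_cvg; near=> y.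
by rewrite subrK.
Unshelve. all: by end_near. Qed.

Lemma Q_to_H f x l : L1 I f -> I x -> lebp f x ->
  Q y f x @[y --> 0^'+] --> l -> H y f x @[y --> 0^'+] --> l.
Proof.
move=> If Ix lx h; rewrite -[l]add0r.
have h3 : (H y f x - Q y f x) + Q y f x @[y --> 0^'+] --> 0 + l.
  by apply: cvgD => //; exact: HQ_cvg.
apply: cvg_trans h3; apply: near_eq_cvg; near=> y.
by rewrite subrK.
Unshelve. all: by end_near. Qed.

Lemma H_to_Q f x l : L1 I f -> I x -> lebp f x ->
  H y f x @[y --> 0^'+] --> l -> Q y f x @[y --> 0^'+] --> l.
Proof.
move=> If Ix lx h; rewrite -[l]subr0.
have h3 : H y f x - (H y f x - Q y f x) @[y --> 0^'+] --> l - 0.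
  by apply: cvgB => //; exact: HQ_cvg.
apply: cvg_trans h3; apply: near_eq_cvg; near=> y.
by rewrite subKr.
Unshelve. all: by end_near. Qed.

End LebesguePoints.

(** * Holder functions *)

Section Holder.
Variable R : realType.
Local Notation leb := (@lebesgue_measure R).
Local Notation I := (@unit_itv R).
Implicit Types (D : set R) (f g h : R -> R) (x y t u v a b c e d r l L : R).

Lemma L1U A B f : measurable A -> measurable B -> [disjoint A & B] ->
  L1 A f -> L1 B f -> L1 (A `|` B) f.
Proof.
move=> mA mB AB IA IB.
have mf : @measurable_fun _ _ (measurableTypeR R) _ (A `|` B) (EFin \o f).
  apply: meas_EFin; apply/measurable_funU => //.
  by split; exact: L1_meas.
apply/integrableP; split => //.
rewrite (@ge0_integral_setU _ _ _ leb A B mA mB)//; last exact: measurableT_comp.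
by move/integrableP : IA => [_ IA]; move/integrableP : IB => [_ IB]; exact: lte_add_pinfty.
Qed.

Lemma L1_set1 x f : L1 [set x] f.
Proof.
apply: (@L1_bnd _ _ _ `|f x|); first exact: measurable_set1.
- by rewrite lebesgue_measure_set1 ltry.
- exact: measurable_fun_set1.
- by move=> u ->.
Qed.

(** Here f may blow up at the end points. Its sign lets Fatou's lemma deduce integrability from the
    bounded increments of F; after that f dominates its own truncations. *)
Lemma ftc_improper a b f F : a < b -> {in `]a, b[, continuous f} ->
  (forall x, a < x < b -> 0 <= f x) ->
  {within `[a, b], continuous F} ->
  (forall x, a < x < b -> is_derive x 1 F (f x)) ->
  L1 `]a, b[ f /\ \int[leb]_(x in `]a, b[) f x = F b - F a.
Proof.
move=> ab cf f0 cF dF.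
have mD : measurable `]a, b[%classic by exact: measurable_itv.
have mf : measurable_fun `]a, b[ f.
  apply: open_continuous_measurable_fun; first exact: interval_open.
  by move=> x /set_mem; exact: cf.
(* Dividing by 3 keeps a + d n below b - d n. *)
pose d n : R := (b - a) / 3 / n.+1%:R.
have d0 n : 0 < d n by rewrite /d !divr_gt0// subr_gt0.
have d1 n : d n <= (b - a) / 3.
  by rewrite /d ler_pdivrMr// ler_peMr ?ler1n// divr_ge0// subr_ge0 ltW.
have cd : d @ \oo --> 0.
  rewrite -(mulr0 ((b - a) / 3)); apply: cvgM; [exact: cvg_cst|exact: cvg_harmonic].
pose fn n x := if (a + d n < x) && (x < b - d n) then f x else 0.
have fnE n : L1 `]a, b[ (fn n) /\ \int[leb]_(x in `]a, b[) fn n x = F (b - d n) - F (a + d n).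
  have sub : `](a + d n), (b - d n)[ `<=` `]a, b[.
    move=> x; rewrite /= !in_itv/= => /andP[x1 x2].
    have := d0 n; move=> ?; apply/andP; split; lra.
  have [||||If EF] := @ftc_oo R (a + d n) (b - d n) f F.
  - have := d1 n; have := d0 n; lra.
  - apply: within_cont => x; rewrite inE/= in_itv/= => /andP[x1 x2].
    apply: cf; rewrite in_itv/=; have := d0 n; move=> ?; apply/andP; split; lra.
  - apply: continuous_subspaceW cF => x; rewrite /= !in_itv/= => /andP[x1 x2].
    have := d0 n; move=> ?; apply/andP; split; lra.
  - move=> x /andP[x1 x2]; apply: dF; have := d0 n; move=> ?; apply/andP; split; lra.
  have mS : measurable `](a + d n), (b - d n)[%classic by exact: measurable_itv.
  have fnp x : (`]a, b[%classic x) -> fn n x = (f \_ `](a + d n), (b - d n)[) x.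
    move=> _; rewrite /fn patchE; have -> : (x \in `](a + d n), (b - d n)[%classic) = (a + d n < x) && (x < b - d n).
      by apply/idP/idP; rewrite inE/= in_itv/=.
    by [].
  split.
    apply: (@L1_eq _ _ (f \_ `](a + d n), (b - d n)[)) => //.
      by move=> x /fnp.
    apply: (L1S measurableT mD) => //; rewrite /L1 -restrict_EFin.
    exact: (@integrable_mkcond _ _ _ leb _ (EFin \o f) mS).1 If.
  rewrite (eq_int fnp) -Rintegral_mkcondr -EF; congr (Rintegral _ _ _).
  by apply/setIidPr.
have reimE : (fun n => F (b - d n) - F (a + d n)) @ \oo --> F b - F a.
  have [_ cFa cFb] := (continuous_within_itvP F ab).1 cF.
  apply: cvgB.
    have := (cvg_at_leftP F b (F b)).1 cFb (fun n => b - d n); apply; split.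
      by move=> n; rewrite ltrBlDr ltrDl.
    rewrite -[X in _ --> X]subr0; apply: cvgB => //; exact: cvg_cst.
  have := (cvg_at_rightP F a (F a)).1 cFa (fun n => a + d n); apply; split.
    by move=> n; rewrite ltrDl.
  rewrite -[X in _ --> X]addr0; apply: cvgD => //; exact: cvg_cst.
have [C HC] : exists C, forall n, F (b - d n) - F (a + d n) <= C.
  have [M [_ HM]] := cvg_seq_bounded (cvgP _ reimE).
  exists (M + 1) => n; apply: le_trans (ler_norm _) _.
  by apply: HM => //; rewrite ltrDl.
have cfn : {ae leb, forall x, `]a, b[%classic x -> fn ^~ x @ \oo --> f x}.
  apply: aeW => x; rewrite /= in_itv/= => /andP[x1 x2].
  apply: (@cvg_trans _ ((fun=> f x) @ \oo)); last exact: cvg_cst.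
  apply: near_eq_cvg; near=> n.
  have h1 : d n < x - a by near: n; apply: (cvgr_lt 0 cd); lra.
  have h2 : d n < b - x by near: n; apply: (cvgr_lt 0 cd); lra.
  rewrite /fn ifT//; apply/andP; split; lra.
have [If _] : L1 `]a, b[ f /\ \int[leb]_(x in `]a, b[) f x <= C.
  apply: (@fatou_R _ _ fn f C mD) => //.
  - by move=> n; exact: (fnE n).1.
  - by move=> n x; rewrite /= in_itv/= => xab; rewrite /fn; case: ifP => // _; exact: f0.
  - by move=> n; rewrite (fnE n).2.
split=> //.
have [|||||_ cI] := @dct _ _ fn f f mD => //.
- by move=> n; exact: L1_meas (fnE n).1.
- move=> n x; rewrite /= in_itv/= => xab; rewrite /fn; case: ifP => _.
    by rewrite ger0_norm ?f0.
  by rewrite normr0 f0.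
move: cI; under eq_fun do rewrite (fnE _).2.
move=> cI; exact: (cvg_unique _ cI reimE).
Unshelve. all: by end_near. Qed.

(** The function |t|^(-1/2), with value 0 at 0; by [qk_isq] it majorises |qk y t| |t|^(1/2)
    uniformly in y. *)
Definition isq t := Num.sqrt `|t| / `|t|.

Lemma isq_ge0 t : 0 <= isq t.
Proof. by rewrite /isq divr_ge0// sqrtr_ge0. Qed.

Lemma dsqrt t : 0 < t -> is_derive t 1 (@Num.sqrt R) (2 * Num.sqrt t)^-1.
Proof. exact: is_derive1_sqrt. Qed.

Lemma L1_isq x : L1 `](x - 2), (x + 2)[ (fun u => isq (x - u)) /\
  \int[leb]_(u in `](x - 2), (x + 2)[) isq (x - u) = 4 * Num.sqrt 2.
Proof.
have dE t : 0 < t -> (2 * Num.sqrt t)^-1 *+ 2 = Num.sqrt t / t.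
  move=> t0; rewrite -{3}(sqr_sqrtr (ltW t0)); have := t0; rewrite -sqrtr_gt0 => /lt0r_neq0 h.
  by field.
have d1 u : u < x -> is_derive u 1 (fun z => -2 * Num.sqrt (x - z)) (isq (x - u)).
  move=> ux; have xu : 0 < x - u by rewrite subr_gt0.
  have h : is_derive u 1 (fun z => Num.sqrt (x - z)) _ :=
    @dcomp _ (@Num.sqrt R) (fun z => x - z) u _ _ (dsqrt xu) (dB (dC x u) (dX u)).
  apply: (is_derive1_eq (dM (dC (-2) u) h)).
  rewrite /isq (gtr0_norm xu) -(dE _ xu); ring.
have d2 u : x < u -> is_derive u 1 (fun z => 2 * Num.sqrt (z - x)) (isq (x - u)).
  move=> ux; have xu : 0 < u - x by rewrite subr_gt0.
  have h : is_derive u 1 (fun z => Num.sqrt (z - x)) _ :=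
    @dcomp _ (@Num.sqrt R) (fun z => z - x) u _ _ (dsqrt xu) (dB (dX u) (dC x u)).
  apply: (is_derive1_eq (dM (dC 2 u) h)).
  rewrite /isq distrC (gtr0_norm xu) -(dE _ xu); ring.
have cq u : u != x -> {for u, continuous (fun z => isq (x - z))}.
  move=> ux; have xu : `|x - u| != 0 by rewrite normr_eq0 subr_eq0 eq_sym.
  have cn : {for u, continuous (fun z => `|x - z|)}.
    by apply: cvg_norm; apply: cvgB; [exact: cvg_cst|exact: cvg_id].
  apply: cvgM; last by apply: cvgV.
  by apply: (@continuous_comp _ _ _ (fun z => `|x - z|) (@Num.sqrt R)) => //; exact: sqrt_continuous.
have [I1 E1] : L1 `](x - 2), x[ (fun u => isq (x - u)) /\
  \int[leb]_(u in `](x - 2), x[) isq (x - u) = 2 * Num.sqrt 2.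
  have [|||||I1 ->] := @ftc_improper (x - 2) x (fun u => isq (x - u)) (fun z => -2 * Num.sqrt (x - z)).
  - lra.
  - move=> u; rewrite in_itv/= => /andP[u1 u2]; apply: cq; apply/eqP; lra.
  - by move=> u _; exact: isq_ge0.
  - apply: continuous_subspaceT => u; apply: cvgM; first exact: cvg_cst.
    apply: (@continuous_comp _ _ _ (fun z => x - z) (@Num.sqrt R)); last exact: sqrt_continuous.
    exact: contF_cst_subr.
  - by move=> u /andP[u1 u2]; apply: d1.
  split=> //; rewrite subrr sqrtr0 (_ : x - (x - 2) = 2); ring.
have [I2 E2] : L1 `]x, (x + 2)[ (fun u => isq (x - u)) /\
  \int[leb]_(u in `]x, (x + 2)[) isq (x - u) = 2 * Num.sqrt 2.
  have [|||||I2 ->] := @ftc_improper x (x + 2) (fun u => isq (x - u)) (fun z => 2 * Num.sqrt (z - x)).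
  - lra.
  - move=> u; rewrite in_itv/= => /andP[u1 u2]; apply: cq; apply/eqP; lra.
  - by move=> u _; exact: isq_ge0.
  - apply: continuous_subspaceT => u; apply: cvgM; first exact: cvg_cst.
    apply: (@continuous_comp _ _ _ (fun z => z - x) (@Num.sqrt R)); last exact: sqrt_continuous.
    by apply: cvgB; [exact: cvg_id|exact: cvg_cst].
  - by move=> u /andP[u1 u2]; apply: d2.
  split=> //; rewrite subrr sqrtr0 (_ : x + 2 - x = 2); ring.
have m1 : measurable `](x - 2), x[%classic by exact: measurable_itv.
have m2 : measurable `]x, (x + 2)[%classic by exact: measurable_itv.
have dj1 : [disjoint `](x - 2), x[ & [set x]].
  by apply/disj_setPS => u [] /= + ux; rewrite ux in_itv/= ltxx andbF.
have dj2 : [disjoint `](x - 2), x[ `|` [set x] & `]x, (x + 2)[].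
  apply/disj_setPS => u [] /= [|->]; rewrite !in_itv/=; last by rewrite ltxx.
  by move=> /andP[_ u1] /andP[u2 _]; have := lt_trans u1 u2; rewrite ltxx.
have I11 : L1 (`](x - 2), x[ `|` [set x]) (fun u => isq (x - u)).
  by apply: L1U => //; exact: L1_set1.
have I12 : L1 ((`](x - 2), x[ `|` [set x]) `|` `]x, (x + 2)[) (fun u => isq (x - u)).
  by apply: L1U => //; exact: measurableU.
have -> : `](x - 2), (x + 2)[%classic = (`](x - 2), x[ `|` [set x]) `|` `]x, (x + 2)[.
  apply/seteqP; split=> u /=; rewrite !in_itv/=.
    move=> /andP[u1 u2].
    by have [ux|ux|->] := ltgtP u x; [left; left; rewrite u1|right; rewrite u2|left; right].
  by move=> [[/andP[? ?]|->]|/andP[? ?]]; apply/andP; split; lra.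
split=> //; rewrite (@Rintegral_setU _ _ _ leb)//; last exact: measurableU.
rewrite (@Rintegral_setU _ _ _ leb)// Rintegral_set1 E1 E2; ring.
Qed.

Lemma sqrt_le t M : 0 <= M -> t <= M ^+ 2 -> Num.sqrt t <= M.
Proof. by move=> M0 tM; rewrite -[leRHS](ger0_norm M0) -sqrtr_sqr ler_wsqrtr. Qed.

(* Exponent 1/2 is what the weight sqrt(1 - t^2), extended by 0, satisfies. *)
Definition holder L f := (forall x, ~ I x -> f x = 0) /\
  (forall a b, `|f a - f b| <= L * Num.sqrt `|a - b|).

Lemma holder_ge0 L f : holder L f -> 0 <= L.
Proof.
case=> _ /(_ 1 0); rewrite subr0 normr1 sqrtr1 mulr1; exact: le_trans.
Qed.

Lemma holder_bnd L f x : holder L f -> `|f x| <= L * 2.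
Proof.
move=> hf; have L0 := holder_ge0 hf; have [f0 fL] := hf.
have [Ix|nIx] := pselect (I x); last by rewrite f0// normr0 mulr_ge0.
have := fL x 1; rewrite (f0 1); last by move/in_I; rewrite ltxx andbF.
rewrite subr0 => /le_trans; apply; rewrite ler_wpM2l//.
move/in_I : Ix => /andP[x1 x2]; rewrite ler0_norm; last lra.
by apply: sqrt_le => //; lra.
Qed.

Lemma holder_cont L f : holder L f -> continuous f.
Proof.
move=> hf x; have L0 := holder_ge0 hf; have [f0 fL] := hf.
apply/cvgrPdist_le => e e0.
have L1 : 0 < L + 1 by rewrite ltr_wpDl.
apply/nbhs_ballP; exists ((e / (L + 1)) ^+ 2) => /=; first by rewrite exprn_gt0// divr_gt0.
move=> z /= h; apply: (le_trans (fL x z)).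
apply: (@le_trans _ _ ((L + 1) * (e / (L + 1)))); last by rewrite mulrC divfK// gt_eqF.
apply: ler_pM => //; first by rewrite lerDl.
by apply: sqrt_le; [rewrite divr_ge0// ltW|exact: ltW].
Qed.

Lemma holder_meas D L f : holder L f -> measurable_fun D f.
Proof.
move=> hf; apply: measurable_funS (continuous_measurable_fun (holder_cont hf)) => //.
Qed.

Lemma holder_L1 L f : holder L f -> L1 I f.
Proof.
move=> hf; apply: (@LI_bnd _ _ (L * 2)); first exact: holder_meas hf.
by move=> x _; exact: holder_bnd.
Qed.

(** On I a Lipschitz bound implies one of exponent 1/2, since |a - b| <= 2 |a - b|^(1/2) there.
    Outside I the factor f vanishes, so if only one of the two points is in I the estimate for f
    alone suffices, whatever g does. *)
Lemma holderM L M K f g : holder L f -> 0 <= M -> 0 <= K ->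
  (forall a, I a -> `|g a| <= M) ->
  (forall a b, I a -> I b -> `|g a - g b| <= K * `|a - b|) -> exists L', holder L' (fun x => f x * g x).
Proof.
move=> hf M0 K0 gM gL; have L0 := holder_ge0 hf; have [f0 fL] := hf.
have sq2 a b : I a -> I b -> `|a - b| <= 2 * Num.sqrt `|a - b|.
  move=> /in_I/andP[a1 a2] /in_I/andP[b1 b2].
  have h : `|a - b| <= 4 by rewrite ler_norml; lra.
  rewrite -{1}(sqr_sqrtr (normr_ge0 (a - b))) expr2 ler_wpM2r ?sqrtr_ge0//.
  apply: sqrt_le => //; apply: (le_trans h); rewrite -natrX ler_nat//.
exists (L * M + L * 2 * K * 2); split; first by move=> x /f0 ->; rewrite mul0r.
have asym a b : I a -> `|f a * g a - f b * g b| <= (L * M + L * 2 * K * 2) * Num.sqrt `|a - b|.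
  move=> Ia; have [Ib|nIb] := pselect (I b); last first.
    rewrite (f0 b)// mul0r subr0 normrM.
    have := fL a b; rewrite (f0 b)// subr0 => h.
    rewrite mulrDl; apply: (@le_trans _ _ (L * M * Num.sqrt `|a - b|)).
      rewrite mulrAC; apply: ler_pM => //; exact: gM.
    by rewrite lerDl !mulr_ge0// sqrtr_ge0.
  have -> : f a * g a - f b * g b = (f a - f b) * g a + f b * (g a - g b) by ring.
  apply: (le_trans (ler_normD _ _)); rewrite !normrM mulrDl lerD//.
    by rewrite mulrAC; apply: ler_pM => //; exact: gM.
  rewrite -[leRHS]mulrA -mulrA; apply: ler_pM => //; first exact: holder_bnd.
  apply: (le_trans (gL a b Ia Ib)); rewrite ler_wpM2l//; exact: sq2.
move=> a b; have [Ia|nIa] := pselect (I a); first exact: asym.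
have [Ib|nIb] := pselect (I b); first by rewrite distrC (distrC a); exact: asym.
by rewrite !f0// !mul0r subr0 normr0 !mulr_ge0// ?addr_ge0 ?mulr_ge0// sqrtr_ge0.
Qed.

Lemma qk_isq y t : 0 < y -> `|qk y t| * Num.sqrt `|t| <= isq t.
Proof.
move=> y0; have [->|t0] := eqVneq t 0; first by rewrite normr0 sqrtr0 mulr0 isq_ge0.
rewrite mulrC /isq ler_wpM2l ?sqrtr_ge0// /qk normrM normfV (gtr0_norm (den_gt0 _ y0)).
rewrite ler_pdivrMr ?den_gt0// mulrC ler_pdivlMr ?normr_gt0// -expr2 (real_normK (num_real t)).
by rewrite lerDl sqr_ge0.
Qed.

(** The interval is symmetric about x, so the odd kernel has integral 0 over it and f(x) may be
    subtracted. It contains I, outside of which f vanishes. *)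
Lemma Q_holder L f x y : holder L f -> I x -> 0 < y ->
  Q y f x = \int[leb]_(u in `](x - 2), (x + 2)[) (qk y (x - u) * (f u - f x)).
Proof.
move=> hf Ix y0; have [f0 fL] := hf; have If := holder_L1 hf.
set D := `](x - 2), (x + 2)[%classic.
have mD : measurable D by exact: measurable_itv.
have lD : (leb D < +oo)%E.
  by rewrite /D lebesgue_measure_itv/= lte_fin; case: ifP; rewrite ?ltry.
have ID : I `<=` D.
  move=> u /in_I/andP[u1 u2]; move/in_I : Ix => /andP[x1 x2].
  rewrite /D/= in_itv/=; apply/andP; split; lra.
have Iq : L1 D (fun u => qk y (x - u)).
  apply: (@L1_bnd _ _ _ y^-1) => //; first exact: meas_qk.
  by move=> u _; exact: qk_bnd.
have Iqf : L1 D (fun u => qk y (x - u) * f u).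
  apply: (@L1_bndM _ _ _ _ (L * 2)) => //; first exact: holder_meas hf.
  by move=> u _; exact: holder_bnd.
have -> : Q y f x = \int[leb]_(u in D) (qk y (x - u) * f u).
  rewrite /Q [LHS](@Rintegral_mkcond _ _ _ leb) [RHS](@Rintegral_mkcond _ _ _ leb).
  apply: eq_Rintegral => u _; rewrite !patchE; case: ifPn => [/set_mem Iu|/negP nIu].
    by rewrite mem_set//; exact: ID.
  by rewrite f0 ?mulr0 ?if_same// => Iu; apply: nIu; rewrite inE.
have q0 : \int[leb]_(u in D) qk y (x - u) = 0.
  have dF u : is_derive u 1 (fun u => - (ln ((x - u) * (x - u) + y ^+ 2) / 2)) (qk y (x - u)).
    have d0 : 0 < (x - u) * (x - u) + y ^+ 2 by rewrite -expr2 den_gt0.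
    have hs := dB (dC x u) (dX u).
    have hq := dD (dM hs hs) (dC (y ^+ 2) u).
    have h2 : is_derive u 1 (fun z => ln ((x - z) * (x - z) + y ^+ 2)) _ :=
      @dcomp _ (@ln R) (fun z => (x - z) * (x - z) + y ^+ 2) u _ _ (is_derive1_ln d0) hq.
    apply: (is_derive1_eq (dN (dM h2 (dC 2^-1 u)))).
    rewrite /qk; have := lt0r_neq0 d0 => ?; field; by rewrite expr2.
  have [|||_ ->] := @ftc_oo _ (x - 2) (x + 2) (fun u => qk y (x - u)) (fun u => - (ln ((x - u) * (x - u) + y ^+ 2) / 2)).
  - lra.
  - apply: continuous_subspaceT => u; apply: (@continuous_comp _ _ _ (fun u => x - u) (qk y)).
      exact: contF_cst_subr.
    exact: cont_qk.
  - by apply: continuous_subspaceT => u; exact: dcont (dF u).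
  have -> : (x - (x + 2)) * (x - (x + 2)) = (x - (x - 2)) * (x - (x - 2)) by ring.
  by rewrite subrr.
rewrite -[LHS]subr0 -(mulr0 (f x)) -q0 -(@RintegralZl _ _ _ leb D)// -(@RintegralB _ _ _ leb D)//.
  by apply: eq_int => u _; ring.
exact: (L1Z _ mD Iq).
Qed.

(** For every y the integrand in [Q_holder] is dominated by L |x - u|^(-1/2), whose integral over
    the interval is the same for all x. This gives both the uniform bound and convergence at every
    point of I. *)
Lemma holder_Q L f : holder L f -> exists C g, [/\ measurable_fun I g,
  (forall x, I x -> `|g x| <= C),
  (forall x y, I x -> 0 < y -> `|Q y f x| <= C) &
  (forall x, I x -> Q y f x @[y --> 0^'+] --> g x)].
Proof.
move=> hf; have L0 := holder_ge0 hf; have [f0 fL] := hf; have If := holder_L1 hf.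
pose g x := \int[leb]_(u in `](x - 2), (x + 2)[) ((x - u)^-1 * (f u - f x)).
pose C := L * (4 * Num.sqrt 2).
have mq x u y : 0 < y -> `|qk y (x - u) * (f u - f x)| <= L * isq (x - u).
  move=> y0; rewrite normrM; apply: (le_trans (ler_wpM2l (normr_ge0 _) (fL u x))).
  by rewrite mulrCA ler_wpM2l// distrC qk_isq.
have mfx D x : measurable_fun D (fun u => f u - f x).
  by apply: measurable_funB => //; exact: holder_meas hf.
have QC x y : I x -> 0 < y -> `|Q y f x| <= C.
  move=> Ix y0; rewrite (Q_holder hf Ix y0) /C -(L1_isq x).2.
  have mD : measurable `](x - 2), (x + 2)[%classic by exact: measurable_itv.
  rewrite -(@RintegralZl _ _ _ leb)//; last exact: (L1_isq x).1.
  apply: int_absle => //; last by move=> u _; exact: mq.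
  - apply: (L1_le mD _ (fun u _ => mq x u y y0)); last exact: (L1Z _ mD (L1_isq x).1).
    by apply: measurable_funM => //; exact: meas_qk.
  - exact: (L1Z _ mD (L1_isq x).1).
have Qg x : I x -> Q y f x @[y --> 0^'+] --> g x.
  move=> Ix.
  have mD : measurable `](x - 2), (x + 2)[%classic by exact: measurable_itv.
  have [|||||_] := @dct_right R `](x - 2), (x + 2)[ (fun y u => qk y (x - u) * (f u - f x))
    (fun u => (x - u)^-1 * (f u - f x)) (fun u => L * isq (x - u)) mD.
  - by move=> y y0; apply: measurable_funM => //; exact: meas_qk.
  - apply: (@meas_right _ _ (fun y u => qk y (x - u) * (f u - f x))).
      by move=> y y0; apply: measurable_funM => //; exact: meas_qk.
    by move=> u _; apply: cvgM; [exact: qk_cvg|exact: cvg_cst].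
  - by apply: aeW => u _; apply: cvgM; [exact: qk_cvg|exact: cvg_cst].
  - exact: (L1Z _ mD (L1_isq x).1).
  - by move=> y u y0 _; exact: mq.
  apply: cvg_trans; apply: near_eq_cvg; near=> y.
  by rewrite (Q_holder hf Ix)//; near: y; exact: nbhs_right_gt.
exists C, g; split=> //.
  apply: (@meas_right _ _ (fun y => Q y f)) => //.
  by move=> y y0; exact: meas_Q.
move=> x Ix; apply: (cvgr_to_le (cvg_norm (Qg x Ix))).
by near=> y; apply: QC => //; near: y; exact: nbhs_right_gt.
Unshelve. all: by end_near. Qed.

End Holder.

(** * Products of Cauchy transforms *)

Section Cauchy.
Variable R : realType.
Local Notation leb := (@lebesgue_measure R).
Local Notation I := (@unit_itv R).
Implicit Types (D : set R) (f g h k : R -> R) (x y t u v a b c d r l L M C : R).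

Lemma cvg_right_ext (A B : R -> R) l : (forall y, 0 < y -> A y = B y) ->
  A y @[y --> 0^'+] --> l -> B y @[y --> 0^'+] --> l.
Proof.
move=> AB; apply: cvg_trans; apply: near_eq_cvg; near=> y.
by rewrite AB//; near: y; exact: nbhs_right_gt.
Unshelve. all: by end_near. Qed.

Lemma cvg_right_eq (A B : R -> R) l r : (forall y, 0 < y -> A y = B y) ->
  A y @[y --> 0^'+] --> l -> B y @[y --> 0^'+] --> r -> l = r.
Proof. by move=> AB cA cB; have := cvg_right_ext AB cA => cA'; exact: (cvg_unique _ cA' cB). Qed.

Lemma normM_le a b c d : `|a| <= c -> `|b| <= d -> `|a * b| <= c * d.
Proof. by move=> ac bd; rewrite normrM ler_pM. Qed.

(** Convergence at every point together with a bound uniform in y: the limit y -> 0 then passes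
    under the integral against any L^1 function. *)
Definition goodV f g := exists C, [/\ measurable_fun I g,
  (forall x, I x -> `|g x| <= C),
  (forall x y, I x -> 0 < y -> `|Q y f x| <= C) &
  (forall x, I x -> Q y f x @[y --> 0^'+] --> g x)].

Lemma holder_goodV L f : holder L f -> exists g, goodV f g.
Proof. by move=> /holder_Q[C [g H]]; exists g, C. Qed.

Lemma goodV_LM f g h : goodV f g -> L1 I h -> L1 I (fun x => h x * g x).
Proof. by move=> [C [mg gC _ _]] Ih; exact: (LI_bndM Ih mg gC). Qed.

Lemma cvg_int_Q f g h : L1 I f -> goodV f g -> L1 I h ->
  \int[leb]_(x in I) (h x * Q y f x) @[y --> 0^'+] --> \int[leb]_(x in I) (h x * g x).
Proof.
move=> If [C [mg gC QC Qg]] Ih; have meas_h := L1_meas Ih.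
have [||||//] := @dct_right R I (fun y x => h x * Q y f x) (fun x => h x * g x)
  (fun x => C * `|h x|) mI _ _ _ (LIZ C (L1_abs Ih)).
- by move=> y y0; apply: measurable_funM => //; exact: meas_Q.
- exact: measurable_funM.
- apply: aeW => x Ix; apply: cvgM; [exact: cvg_cst|exact: Qg].
- by move=> y x y0 Ix; rewrite normrM mulrC ler_wpM2r// QC.
Qed.

Lemma antisym_good f F h G : L1 I f -> L1 I h -> goodV f F -> goodV h G ->
  \int[leb]_(x in I) (f x * G x) = - \int[leb]_(x in I) (h x * F x).
Proof.
move=> If Ih fF hG.
have cL1 := cvg_int_Q Ih hG If.
have c2 : (fun y => - \int[leb]_(x in I) (h x * Q y f x)) @ 0^'+ --> - (\int[leb]_(x in I) (h x * F x)).
  by apply: cvgN; exact: cvg_int_Q.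
by apply: cvg_right_eq cL1 c2 => y y0; exact: Q_antisym.
Qed.

Lemma ae_neq u : {ae leb, forall v, v != u}.
Proof.
exists [set u]; split; [exact: measurable_set1|exact: lebesgue_measure_set1|].
by move=> v /= /negP; rewrite negbK => /eqP.
Qed.

(** Commutator of V with multiplication by k. Writing k(v) = k(u) - (u - v) m(u, v), the factor u -
    v cancels the singularity of the kernel and leaves an ordinary integral of the divided
    difference m. *)
Lemma V_mul L f g k (m : R -> R -> R) M : holder L f -> goodV f g -> 0 <= M ->
  (forall u, I u -> `|k u| <= M) -> (forall u v, I u -> I v -> `|m u v| <= M) ->
  (forall u, measurable_fun I (m u)) ->
  (forall u v, I u -> I v -> k u - k v = (u - v) * m u v) ->
  (exists L', holder L' (fun u => f u * k u)) /\
  goodV (fun u => f u * k u) (fun u => k u * g u - \int[leb]_(v in I) (f v * m u v)).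
Proof.
move=> hf fg M0 kM mM mm kE.
have [L' hL'] : exists L', holder L' (fun u => f u * k u).
  apply: (holderM hf M0 M0 kM) => a b Ia Ib.
  by rewrite kE// normrM mulrC ler_wpM2r// mM.
split; first by exists L'.
have If := holder_L1 hf; have Ifk := holder_L1 hL'.
have [g' gg'] := holder_goodV hL'.
suff E u : I u -> g' u = k u * g u - \int[leb]_(v in I) (f v * m u v).
  have [C [mg gC QC Qg]] := gg'; exists C; split => //.
  - by apply: eq_measurable_fun mg => u /set_mem; exact: E.
  - by move=> u Iu; rewrite -E// gC.
  - by move=> u Iu; rewrite -E//; exact: Qg.
move=> Iu; have [C [_ _ _ /(_ u Iu) cL1]] := gg'.
have [C' [_ _ _ /(_ u Iu) c2]] := fg.
have Ifm : L1 I (fun v => f v * m u v).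
  by apply: (LI_bndM If (mm u)) => v Iv; exact: mM.
have tq y t : 0 < y -> `|t * qk y t| <= 1.
  move=> y0; rewrite /qk mulrA -expr2 ger0_norm ?divr_ge0 ?sqr_ge0 ?(ltW (den_gt0 _ y0))//.
  by rewrite ler_pdivrMr ?den_gt0// mul1r lerDl sqr_ge0.
have mtq y : 0 < y -> measurable_fun I (fun v => (u - v) * qk y (u - v)).
  by move=> y0; apply: measurable_funM; [exact: meas_subr|exact: meas_qk].
have Ifmq y : 0 < y -> L1 I (fun v => (f v * m u v) * ((u - v) * qk y (u - v))).
  by move=> y0; apply: (LI_bndM Ifm (mtq y y0)) => v _; exact: tq.
(* The factor (u - v) [qk y (u - v)] stays between 0 and 1 and tends to 1 off the null set v = u. *)
have [|||||_ c3] := @dct_right R I (fun y v => (f v * m u v) * ((u - v) * qk y (u - v)))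
   (fun v => f v * m u v) (fun v => `|f v * m u v|) mI.
- by move=> y y0; exact: L1_meas (Ifmq y y0).
- exact: L1_meas Ifm.
- apply: ae_imply (ae_neq u) => v vu Iv; rewrite -[X in _ --> X]mulr1; apply: cvgM; first exact: cvg_cst.
  have uv : u - v != 0 by rewrite subr_eq0 eq_sym.
  rewrite -(mulfV uv); apply: cvgM; [exact: cvg_cst|exact: qk_cvg].
- exact: L1_abs.
- by move=> y v y0 _; rewrite normrM ler_piMr// tq.
have c4 : k u * Q y f u - \int[leb]_(v in I) ((f v * m u v) * ((u - v) * qk y (u - v)))
    @[y --> 0^'+] --> k u * g u - \int[leb]_(v in I) (f v * m u v).
  by apply: cvgB => //; apply: cvgM => //; exact: cvg_cst.
apply: cvg_right_eq cL1 c4 => y y0.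
rewrite /Q -iZ; last exact: L1_qk.
rewrite -iB; [|exact: LIZ (L1_qk _ y0 If)|exact: Ifmq].
apply: eq_int => v Iv.
have -> : k v = k u - (u - v) * m u v by rewrite -kE//; ring.
ring.
Qed.

Section Product.
Variables (L M : R) (f F g G : R -> R) (x y : R).
Hypotheses (hf : holder L f) (hg : holder M g) (fF : goodV f F) (gG : goodV g G) (y0 : 0 < y).

Let If := holder_L1 hf.
Let Ig := holder_L1 hg.
Let IfG := goodV_LM gG If.
Let IgF := goodV_LM fF Ig.

(* With Phi, Psi the Cauchy integrals of f, g at x + i y, [prodR] and [prodI]
   are the real and imaginary parts of the expansion of Phi Psi into partial
   fractions, up to signs. *)
Lemma prodR : Q y f x * Q y g x - P y f x * P y g x = Q y (fun u => f u * G u + g u * F u) x.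
Proof.
pose k u := qk y (x - u).
pose m u v := qk y (x - u) * qk y (x - v) - pk y (x - u) * pk y (x - v).
have yi : 0 <= y^-1 by rewrite invr_ge0 ltW.
have M1 : 0 <= y^-1 + (y^-1 * y^-1 + y^-1 * y^-1) by rewrite !addr_ge0// mulr_ge0.
have [||||[L' hL'] gk] := @V_mul M g G k m (y^-1 + (y^-1 * y^-1 + y^-1 * y^-1)) hg gG M1.
- by move=> u _; apply: (le_trans (qk_bnd _ y0)); rewrite lerDl addr_ge0// mulr_ge0.
- move=> u v _ _; apply: (le_trans (ler_normB _ _)); rewrite -[leLHS]add0r lerD// lerD// normM_le//; by [exact: qk_bnd|exact: pk_bnd].
- move=> u; apply: measurable_funB; apply: measurable_funM => //; by [exact: meas_qk|exact: meas_pk].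
- by move=> u v _ _; exact: qk_pk.
(* Antisymmetry of V for f and g k, where k is the kernel seen from x and m its divided difference
   from [qk_pk]. The left side expands to Q(f G) - (Q f Q g - P f P g), the right side is - Q(g
   F). *)
have := antisym_good If (holder_L1 hL') fF gk.
have -> : \int[leb]_(u in I) (f u * (k u * G u - \int[leb]_(v in I) (g v * m u v))) =
   Q y (fun u => f u * G u) x - (Q y g x * Q y f x - P y g x * P y f x).
  rewrite /Q /P -!iZ; try exact: L1_qk; try exact: L1_pk.
  rewrite -iB; [|by apply: LIZ; exact: L1_qk|by apply: LIZ; exact: L1_pk].
  rewrite -iB; [|exact: L1_qk|].
    apply: eq_int => u _.
    have -> : \int[leb]_(v in I) (g v * m u v) = qk y (x - u) * Q y g x - pk y (x - u) * P y g x.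
      rewrite /Q /P -!iZ; try exact: L1_qk; try exact: L1_pk.
      rewrite -iB; [|by apply: LIZ; exact: L1_qk|by apply: LIZ; exact: L1_pk].
      by apply: eq_int => v _; rewrite /m; ring.
    rewrite /k /Q /P; ring.
  by apply: LIB; apply: LIZ; by [exact: L1_qk|exact: L1_pk].
have -> : \int[leb]_(u in I) (g u * k u * F u) = Q y (fun u => g u * F u) x.
  by apply: eq_int => u _; rewrite /k; ring.
rewrite QD//; lra.
Qed.

Lemma prodI : Q y f x * P y g x + P y f x * Q y g x = P y (fun u => f u * G u + g u * F u) x.
Proof.
pose k u := pk y (x - u).
pose m u v := qk y (x - u) * pk y (x - v) + pk y (x - u) * qk y (x - v).
have yi : 0 <= y^-1 by rewrite invr_ge0 ltW.
have M1 : 0 <= y^-1 + (y^-1 * y^-1 + y^-1 * y^-1) by rewrite !addr_ge0// mulr_ge0.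
have [||||[L' hL'] gk] := @V_mul M g G k m (y^-1 + (y^-1 * y^-1 + y^-1 * y^-1)) hg gG M1.
- by move=> u _; apply: (le_trans (pk_bnd _ y0)); rewrite lerDl addr_ge0// mulr_ge0.
- move=> u v _ _; apply: (le_trans (ler_normD _ _)); rewrite -[leLHS]add0r lerD// lerD// normM_le//; by [exact: qk_bnd|exact: pk_bnd].
- move=> u; apply: measurable_funD; apply: measurable_funM => //; by [exact: meas_qk|exact: meas_pk].
- by move=> u v _ _; exact: pk_qk.
have := antisym_good If (holder_L1 hL') fF gk.
have -> : \int[leb]_(u in I) (f u * (k u * G u - \int[leb]_(v in I) (g v * m u v))) =
   P y (fun u => f u * G u) x - (P y g x * Q y f x + Q y g x * P y f x).
  rewrite /Q /P -!iZ; try exact: L1_qk; try exact: L1_pk.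
  rewrite -iD; [|by apply: LIZ; exact: L1_qk|by apply: LIZ; exact: L1_pk].
  rewrite -iB; [|exact: L1_pk|].
    apply: eq_int => u _.
    have -> : \int[leb]_(v in I) (g v * m u v) = qk y (x - u) * P y g x + pk y (x - u) * Q y g x.
      rewrite /Q /P -!iZ; try exact: L1_qk; try exact: L1_pk.
      rewrite -iD; [|by apply: LIZ; exact: L1_pk|by apply: LIZ; exact: L1_qk].
      by apply: eq_int => v _; rewrite /m; ring.
    rewrite /k /Q /P; ring.
  by apply: LID; apply: LIZ; by [exact: L1_qk|exact: L1_pk].
have -> : \int[leb]_(u in I) (g u * k u * F u) = P y (fun u => g u * F u) x.
  by apply: eq_int => u _; rewrite /k; ring.
have -> : P y (fun u => f u * G u + g u * F u) x = P y (fun u => f u * G u) x + P y (fun u => g u * F u) x.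
  rewrite /P -iD; [|exact: L1_pk|exact: L1_pk].
  by apply: eq_int => u _; rewrite mulrDr.
lra.
Qed.

End Product.

End Cauchy.

(** * The semicircle weight *)

Section Weight.
Variable R : realType.
Local Notation leb := (@lebesgue_measure R).
Local Notation I := (@unit_itv R).
Local Notation w := (@wt R).
Implicit Types (D : set R) (f g h k : R -> R) (x y t u v a b c d r l L M C s : R).

Lemma wt_ge0 x : 0 <= w x. Proof. exact: sqrtr_ge0. Qed.

Lemma wt_gt0 x : I x -> 0 < w x.
Proof. by move=> /in_I/andP[x1 x2]; rewrite sqrtr_gt0; nra. Qed.

Lemma wt_sqr x : -1 <= x <= 1 -> w x ^+ 2 = 1 - x ^+ 2.
Proof. by move=> /andP[x1 x2]; rewrite sqr_sqrtr//; nra. Qed.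

Lemma wt_sqrI x : I x -> w x ^+ 2 = 1 - x ^+ 2.
Proof. by move=> /in_I/andP[x1 x2]; rewrite wt_sqr// !ltW. Qed.

Lemma wt_out x : ~ I x -> w x = 0.
Proof.
move=> nIx; rewrite /w; apply: ler0_sqrtr.
have [x1|x1] := leP x (-1); first by nra.
have [x2|x2] := leP 1 x; first by nra.
by exfalso; apply: nIx; apply/in_I; rewrite x1.
Qed.

Lemma wt_le1 x : w x <= 1.
Proof. by apply: sqrt_le => //; rewrite expr1n; have := sqr_ge0 x; lra. Qed.

(** For two points of I, (w a - w b)^2 <= |w a^2 - w b^2| = |a - b| |a + b| <= 2 |a - b|, which
    gives the constant. *)
Lemma holder_wt : holder (Num.sqrt 2) w.
Proof.
split; first exact: wt_out.
move=> a b; rewrite -sqrtrM// -sqrtr_sqr ler_wsqrtr//.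
have W x : I x \/ w x = 0 by have [|/wt_out] := pselect (I x); [left|right].
have asym c d : I c -> w d = 0 -> (w c - w d) ^+ 2 <= 2 * `|c - d|.
  move=> Ic wd; rewrite wd subr0 wt_sqrI//.
  move/in_I : (Ic) => /andP[cL1 c2].
  have [d1|d1] := leP d (-1); first by rewrite ger0_norm; nra.
  have [d2|d2] := leP 1 d; first by rewrite ler0_norm; nra.
  have /wt_gt0 : I d by apply/in_I; rewrite d1.
  by rewrite wd ltxx.
have [Ia|wa] := W a; have [Ib|wb] := W b.
- have : (w a - w b) ^+ 2 <= `|w a ^+ 2 - w b ^+ 2|.
    have -> : w a ^+ 2 - w b ^+ 2 = (w a - w b) * (w a + w b) by ring.
    rewrite -(real_normK (num_real (w a - w b))) expr2 normrM ler_wpM2l//.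
    rewrite [leRHS]ger0_norm ?addr_ge0 ?wt_ge0//.
    by rewrite (le_trans (ler_normB _ _))// !ger0_norm ?wt_ge0.
  move/le_trans; apply; rewrite !wt_sqrI//.
  have -> : 1 - a ^+ 2 - (1 - b ^+ 2) = (a - b) * (- (a + b)) by ring.
  rewrite normrM mulrC ler_wpM2r// normrN.
  move/in_I : Ia => /andP[a1 a2]; move/in_I : Ib => /andP[b1 b2].
  by rewrite ler_norml; apply/andP; split; lra.
- exact: asym.
- by have := asym b a Ib wa; rewrite distrC -sqrrN opprB.
- by rewrite wa wb subrr expr0n mulr_ge0.
Qed.

Lemma dwt u : I u -> is_derive u 1 w (- u / w u).
Proof.
move=> Iu; have w0 := wt_gt0 Iu.
have d0 : 0 < 1 - u ^+ 2 by rewrite -wt_sqrI// exprn_gt0.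
have h : is_derive u 1 (fun z => 1 - z * z) _ := dB (dC 1 u) (dM (dX u) (dX u)).
have d0' : 0 < 1 - u * u by rewrite -expr2.
have h2 : is_derive u 1 (fun z => Num.sqrt (1 - z * z)) _ :=
  @dcomp _ (@Num.sqrt R) (fun z => 1 - z * z) u _ _ (dsqrt d0') h.
have -> : w = (fun z => Num.sqrt (1 - z * z)) by apply/funext => z; rewrite /wt expr2.
apply: (is_derive1_eq h2).
have : Num.sqrt (1 - u * u) != 0 by rewrite -expr2 lt0r_neq0.
by move=> ?; field.
Qed.

(** On [-1, 1] this is the arcsine in half-angle form; the denominator never vanishes, so the
    function is continuous on the whole line. *)
Definition arc u := 2 * atan (u / (1 + w u)).

Lemma w1_gt0 u : 0 < 1 + w u.
Proof. by rewrite ltr_pwDl// wt_ge0. Qed.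

Lemma darc u : I u -> is_derive u 1 arc (w u)^-1.
Proof.
move=> Iu; have w0 := wt_gt0 Iu; have w1 := lt0r_neq0 (w1_gt0 u).
have h : is_derive u 1 (fun z => z * (1 + w z)^-1) _ :=
  dM (dX u) (@dV _ (fun z => 1 + w z) u _ w1 (dD (dC 1 u) (dwt Iu))).
have h2 : is_derive u 1 (fun z => atan (z * (1 + w z)^-1)) _ :=
  @dcomp _ (@atan R) (fun z => z * (1 + w z)^-1) u _ _ (is_derive1_atan _) h.
apply: (is_derive1_eq (dM (dC 2 u) h2)).
have e : u ^+ 2 = 1 - w u ^+ 2 by rewrite wt_sqrI//; ring.
have -> : (u / (1 + w u)) ^+ 2 = (1 - w u ^+ 2) / (1 + w u) ^+ 2 by rewrite -e; field.
have wn0 := lt0r_neq0 w0.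
have -> : u * (- (1 + w u) ^- 2 * (0 + - u / w u)) + (1 + w u)^-1 * 1 =
   (1 - w u ^+ 2) / (w u * (1 + w u) ^+ 2) + (1 + w u)^-1.
  by rewrite -e; field; apply/andP.
field.
rewrite wn0 w1/=.
have -> : (1 + w u) ^+ 2 + (1 - w u ^+ 2) = 2 * (1 + w u) by ring.
by rewrite mulf_neq0.
Qed.

Lemma cont_wt : continuous w.
Proof. exact: holder_cont holder_wt. Qed.

Lemma cont_arc : continuous arc.
Proof.
move=> u; apply: cvgM; first exact: cvg_cst.
apply: (@cvg_comp _ _ _ (fun z => z / (1 + w z)) (@atan R)); last exact: continuous_atan.
apply: cvgM; first exact: cvg_id.
apply: cvgV; first by rewrite lt0r_neq0// w1_gt0.
by apply: cvgD; [exact: cvg_cst|exact: cont_wt].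
Qed.

Lemma wt_end1 : w 1 = 0. Proof. by apply: wt_out => /in_I; rewrite ltxx andbF. Qed.
Lemma wt_endN1 : w (-1) = 0. Proof. by apply: wt_out => /in_I; rewrite ltxx. Qed.

Lemma arc1 : arc 1 = pi / 2.
Proof. by rewrite /arc wt_end1 addr0 divr1 atan1; field. Qed.

Lemma arcN1 : arc (-1) = - (pi / 2).
Proof. by rewrite /arc wt_endN1 addr0 divr1 atanN atan1; field. Qed.

Lemma int_invw : L1 I (fun u => (w u)^-1) /\ \int[leb]_(u in I) (w u)^-1 = pi.
Proof.
have [|||||IL ->] := @ftc_improper R (-1) 1 (fun u => (w u)^-1) arc.
- lra.
- move=> u; rewrite in_itv/= => /in_I Iu; apply: cvgV; first exact/lt0r_neq0/wt_gt0.
  exact: cont_wt.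
- by move=> u _; rewrite invr_ge0 wt_ge0.
- by apply: continuous_subspaceT; exact: cont_arc.
- by move=> u /in_I; exact: darc.
by split=> //; rewrite arc1 arcN1; field.
Qed.

Lemma meas_wt D : measurable_fun D w.
Proof. exact: holder_meas holder_wt. Qed.

Lemma LI_wt : L1 I w.
Proof. exact: holder_L1 holder_wt. Qed.

(** * The Hilbert transform of the weight *)

Section Antiderivative.
Variables (s : R).
Hypothesis Is : I s.

Definition wt_den u := 1 - s * u + w s * w u.
(** Subtracting w(s) ln |s - u| from it gives an antiderivative of w(u) / (s - u). Leaving out this
    singular logarithm makes [wt_prim] continuous at u = s. With s = cos a and u = cos b, a and b in
    [0, pi], [wt_den u] is 1 - cos (a + b). *)
Definition wt_prim u := w s * ln (wt_den u) + s * arc u - w u.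

Lemma wt_den_gt0 u : -1 <= u <= 1 -> 0 < wt_den u.
Proof.
move=> /andP[u1 u2]; rewrite /wt_den ltr_wpDr ?mulr_ge0 ?wt_ge0//.
have /andP[s1 s2] := (in_I s).1 Is.
have h1 : 0 <= (1 - u) * (1 + s) by rewrite mulr_ge0//; lra.
have h2 : 0 <= (1 + u) * (1 - s) by rewrite mulr_ge0//; lra.
have [u0|u0] := leP 0 u.
  have h3 : 0 <= u * (1 - s) by rewrite mulr_ge0//; lra.
  by lra.
have h3 : 0 <= - u * (1 + s) by rewrite mulr_ge0//; lra.
by lra.
Qed.

Lemma d_wt_prim u : I u -> u != s -> is_derive u 1 wt_prim (w u / (s - u) - w s / (s - u)).
Proof.
move=> Iu us; have w0 := lt0r_neq0 (wt_gt0 Iu).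
have ws0 := lt0r_neq0 (wt_gt0 Is).
have d0 : 0 < wt_den u by apply: wt_den_gt0; move/in_I : Iu => /andP[? ?]; rewrite !ltW.
have h : is_derive u 1 wt_den _ := dD (dB (dC 1 u) (dM (dC s u) (dX u))) (dM (dC (w s) u) (dwt Iu)).
have h2 : is_derive u 1 (fun z => ln (wt_den z)) _ :=
  @dcomp _ (@ln R) wt_den u _ _ (is_derive1_ln d0) h.
apply: (is_derive1_eq (dB (dD (dM (dC (w s) u) h2) (dM (dC s u) (darc Iu))) (dwt Iu))).
have su : s - u != 0 by rewrite subr_eq0 eq_sym.
have dn0 := lt0r_neq0 d0.
apply/eqP; rewrite -subr_eq0; apply/eqP.
have E1 : s ^+ 2 = 1 - w s ^+ 2 by rewrite wt_sqrI//; ring.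
have E2 : u ^+ 2 = 1 - w u ^+ 2 by rewrite wt_sqrI//; ring.
transitivity ((w s * (- s * w u - w s * u) * (s - u) + s * wt_den u * (s - u) + u * wt_den u * (s - u)
   - w u ^+ 2 * wt_den u + w s * w u * wt_den u) / (wt_den u * w u * (s - u))).
  by field; rewrite dn0 w0 su.
suff -> : (w s * (- s * w u - w s * u) * (s - u) + s * wt_den u * (s - u) + u * wt_den u * (s - u)
   - w u ^+ 2 * wt_den u + w s * w u * wt_den u) = 0 by rewrite mul0r.
transitivity ((1 - u * s) * (w s ^+ 2 + s ^+ 2 - 1) +
  (w u ^+ 2 + u ^+ 2 - 1) * (w s ^+ 2 - 1 + s * u - w s * w u)); first by rewrite /wt_den; ring.
by rewrite E1 E2; ring.
Qed.

Lemma cont_wt_prim u : -1 <= u <= 1 -> {for u, continuous wt_prim}.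
Proof.
move=> u1; have d0 := wt_den_gt0 u1.
have cd : {for u, continuous wt_den}.
  apply: cvgD; first by apply: cvgB; [exact: cvg_cst|apply: cvgM; [exact: cvg_cst|exact: cvg_id]].
  by apply: cvgM; [exact: cvg_cst|exact: cont_wt].
apply: cvgB; last exact: cont_wt.
apply: cvgD; apply: cvgM; try exact: cvg_cst; last exact: cont_arc.
by apply: (@continuous_comp _ _ _ wt_den (@ln R)) => //; exact: continuous_ln.
Qed.

(** The terms w(s) ln e cancel between the two sides, and at the end points the logarithms of
    [wt_den] cancel ln (1 - s) and ln (1 + s). What remains of the end points is s times the total
    variation pi of the arcsine. *)
Lemma H_wt e : 0 < e -> -1 < s - e -> s + e < 1 ->
  H e w s = pi * s + (wt_prim (s - e) - wt_prim (s + e)).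
Proof.
have /andP[s1 s2] := (in_I s).1 Is.
move=> e0 h1 h2; rewrite (H_split e0 Is h1 h2 LI_wt).
have cI u : u != s -> {for u, continuous (fun z => w z / (s - z))}.
  move=> us; have su : s - u != 0 by rewrite subr_eq0 eq_sym.
  apply: cvgM; first exact: cont_wt.
  by apply: cvgV => //; apply: contF_cst_subr.
have dF1 u : -1 < u -> u < s -> is_derive u 1 (fun z => wt_prim z - w s * ln (s - z)) (w u / (s - u)).
  move=> u1 us; have su : 0 < s - u by lra.
  have Iu : I u by apply/in_I/andP; split=> //; lra.
  have h3 : is_derive u 1 (fun z => ln (s - z)) _ :=
    @dcomp _ (@ln R) (fun z => s - z) u _ _ (is_derive1_ln su) (dB (dC s u) (dX u)).
  have us' : u != s by apply/eqP; lra.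
  apply: (is_derive1_eq (dB (d_wt_prim Iu us') (dM (dC (w s) u) h3))).
  by field; exact: lt0r_neq0.
have dF2 u : s < u -> u < 1 -> is_derive u 1 (fun z => wt_prim z - w s * ln (z - s)) (w u / (s - u)).
  move=> su u1; have us : 0 < u - s by lra.
  have Iu : I u by apply/in_I/andP; split=> //; lra.
  have h3 : is_derive u 1 (fun z => ln (z - s)) _ :=
    @dcomp _ (@ln R) (fun z => z - s) u _ _ (is_derive1_ln us) (dB (dX u) (dC s u)).
  have us' : u != s by apply/eqP; lra.
  apply: (is_derive1_eq (dB (d_wt_prim Iu us') (dM (dC (w s) u) h3))).
  have : s - u != 0 by apply/eqP; lra.
  by have := lt0r_neq0 us => ? ?; field; apply/andP.
have [||||_ ->] := @ftc_oo _ (-1) (s - e) (fun u => w u / (s - u)) (fun z => wt_prim z - w s * ln (s - z)) => //.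
- apply: within_cont => u; rewrite inE/= in_itv/= => /andP[u1 u2]; apply: cI; apply/eqP; lra.
- apply: within_cont => u; rewrite inE/= in_itv/= => /andP[u1 u2].
  apply: cvgB; first by apply: cont_wt_prim; apply/andP; split => //; lra.
  apply: cvgM; first exact: cvg_cst.
  apply: (@continuous_comp _ _ _ (fun z => s - z) (@ln R)); first exact: contF_cst_subr.
  by apply: continuous_ln; lra.
- by move=> u /andP[u1 u2]; apply: dF1 => //; lra.
have [||||_ ->] := @ftc_oo _ (s + e) 1 (fun u => w u / (s - u)) (fun z => wt_prim z - w s * ln (z - s)) => //.
- apply: within_cont => u; rewrite inE/= in_itv/= => /andP[u1 u2]; apply: cI; apply/eqP; lra.
- apply: within_cont => u; rewrite inE/= in_itv/= => /andP[u1 u2].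
  apply: cvgB; first by apply: cont_wt_prim; apply/andP; split => //; lra.
  apply: cvgM; first exact: cvg_cst.
  apply: (@continuous_comp _ _ _ (fun z => z - s) (@ln R)).
    by apply: cvgB; [exact: cvg_id|exact: cvg_cst].
  by apply: continuous_ln; lra.
- by move=> u /andP[u1 u2]; apply: dF2 => //; lra.
have -> : wt_prim 1 = w s * ln (1 - s) + s * (pi / 2).
  by rewrite /wt_prim /wt_den wt_end1 arc1 !mulr0 mulr1 addr0 subr0.
have -> : wt_prim (-1) = w s * ln (1 + s) - s * (pi / 2).
  by rewrite /wt_prim /wt_den wt_endN1 arcN1 mulr0 addr0 subr0 mulrN1 opprK mulrN.
rewrite (_ : s - (s - e) = e); last by ring.
rewrite (_ : s + e - s = e); last by ring.
rewrite (_ : s - -1 = 1 + s); last by ring.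
by field.
Qed.

End Antiderivative.
Lemma H_wt_cvg s : I s -> H y w s @[y --> 0^'+] --> pi * s.
Proof.
move=> Is; have /andP[s1 s2] := (in_I s).1 Is.
have cG : {for s, continuous (wt_prim s)} by apply: cont_wt_prim => //; rewrite !ltW.
have h : pi * s + (wt_prim s (s - y) - wt_prim s (s + y)) @[y --> 0^'+] --> pi * s + (wt_prim s s - wt_prim s s).
  apply: cvgD; first exact: cvg_cst.
  apply: cvgB.
    apply: (@cvg_comp _ _ _ (fun y => s - y) (wt_prim s) _ (nbhs s)); last exact: cG.
    rewrite -{2}[s]subr0; apply: cvg_at_right_filter; exact: contF_cst_subr.
  apply: (@cvg_comp _ _ _ (fun y => s + y) (wt_prim s) _ (nbhs s)); last exact: cG.
  rewrite -{2}[s]addr0; apply: cvg_at_right_filter.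
  by apply: cvgD; [exact: cvg_cst|exact: cvg_id].
rewrite subrr addr0 in h; apply: cvg_trans h; apply: near_eq_cvg; near=> y.
rewrite H_wt//.
- have : y < s + 1 by near: y; apply: nbhs_right_lt; lra.
  lra.
- have : y < 1 - s by near: y; apply: nbhs_right_lt; lra.
  lra.
Unshelve. all: by end_near. Qed.

(** [holder_Q] provides a limit everywhere. It is identified through the truncated integrals, since
    every point of I is a Lebesgue point of the continuous function w. *)
Lemma V_wt : goodV w (fun s => pi * s).
Proof.
have [C [g [mg gC QC Qg]]] := holder_Q holder_wt.
have E s : I s -> g s = pi * s.
  move=> Is; have wI : w \_ I = w.
    apply/funext => u; rewrite patchE; case: ifPn => // /negP nIu.
    by rewrite wt_out// => Iu; apply: nIu; rewrite inE.
  have lw : lebp w s.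
    apply: lebpt_lebp => //; first exact: LI_wt.
    rewrite wI; apply: (@continuous_lebesgue_pt _ _ _ setT) => //.
    - by split => //; exact: openT.
    - exact: meas_wt.
    - exact: cont_wt.
  have := H_to_Q LI_wt Is lw (H_wt_cvg Is) => h.
  exact: (cvg_unique _ (Qg s Is) h).
exists C; split=> //.
- by apply: eq_measurable_fun mg => s /set_mem; exact: E.
- by move=> s Is; rewrite -E// gC.
- by move=> s Is; rewrite -E//; exact: Qg.
Qed.

(** * The norm bound in L^2(w) for Holder functions *)

Lemma V_mulX L f g : holder L f -> goodV f g ->
  (exists L', holder L' (fun u => f u * u)) /\
  goodV (fun u => f u * u) (fun u => u * g u - \int[leb]_(v in I) f v).
Proof.
move=> hf fg.
have [|||||h1 h2] := @V_mul R L f g (fun u => u) (fun _ _ => 1) 1 hf fg => //.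
- by move=> u /in_I/andP[u1 u2]; rewrite ler_norml; apply/andP; split; lra.
- by move=> u v _ _; rewrite normr1.
- by move=> u v _ _; rewrite mulr1.
split=> //; have E : \int[leb]_(v in I) (f v * 1) = \int[leb]_(v in I) f v.
  by apply: eq_int => v _; rewrite mulr1.
by rewrite E in h2.
Qed.

(** In the antisymmetry relation for f and x f the same integral occurs on both sides with opposite
    signs. What is left is the square of the integral of f, a quantity with a sign. *)
Lemma int_XV L f g : holder L f -> goodV f g ->
  \int[leb]_(x in I) (f x * x * g x) = (\int[leb]_(x in I) f x) ^+ 2 / 2.
Proof.
move=> hf fg; have [[L' h1] h2] := V_mulX hf fg.
have If := holder_L1 hf.
have := antisym_good If (holder_L1 h1) fg h2.
have Ixf := goodV_LM fg (holder_L1 h1).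
have -> : \int[leb]_(x in I) (f x * (x * g x - \int[leb]_(v in I) f v)) =
   \int[leb]_(x in I) (f x * x * g x) - (\int[leb]_(x in I) f x) ^+ 2.
  rewrite expr2 -[X in _ = _ - X]iZ// -iB//; last exact: LIZ.
  by apply: eq_int => x _; ring.
lra.
Qed.

Lemma P_bnd h M x y : L1 I h -> 0 <= M -> (forall x, I x -> `|h x| <= M) -> I x -> 0 < y ->
  `|P y h x| <= M * pi.
Proof.
move=> Ih M0 hM Ix y0.
have p1 : P y (fun=> 1) x <= pi.
  rewrite P_cst1// [leRHS](splitr pi).
  by apply: lerD; apply/ltW/atan_ltpi2.
apply: (@le_trans _ _ (M * P y (fun=> 1) x)); last by rewrite ler_wpM2l.
rewrite /P -iZ; last by apply: L1_pk => //; exact: L1_cst.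
apply: i_absle; [exact: L1_pk|by apply: LIZ; apply: L1_pk => //; exact: L1_cst|].
move=> u Iu; rewrite mulr1 normrM mulrC [X in _ * X]ger0_norm ?pk_ge0// ler_wpM2r ?pk_ge0//.
exact: hM.
Qed.

(* Multiply [prodR] for the pair (w, f) by f, integrate, and let y -> 0; the
   discarded term is a multiple of the square of the integral of f. *)
Lemma norm_wV L f g : holder L f -> goodV f g ->
  \int[leb]_(x in I) (w x * g x ^+ 2) <= pi ^+ 2 * \int[leb]_(x in I) (w x * f x ^+ 2).
Proof.
move=> hf fg; have If := holder_L1 hf.
have Iwg : L1 I (fun x => w x * g x) := goodV_LM fg LI_wt.
have Ifx : L1 I (fun x => f x * (pi * x)) := goodV_LM V_wt If.
have Iwg2 : L1 I (fun x => w x * g x * g x) := goodV_LM fg Iwg.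
have Ifxg : L1 I (fun x => f x * (pi * x) * g x) := goodV_LM fg Ifx.
have Ifw : L1 I (fun x => f x * w x * f x).
  apply: (@LI_bndM _ _ _ (L * 2)).
  - apply: (@LI_bndM _ _ _ 1) => //; first exact: meas_wt.
    by move=> x _; rewrite ger0_norm ?wt_ge0// wt_le1.
  - exact: holder_meas hf.
  - by move=> x _; exact: holder_bnd.
pose G := fun u => w u * g u + f u * (pi * u).
have IG : L1 I G by exact: LID.
have [C1 [_ _ Q1 cL1]] := V_wt; have [C2 [mg g2 Q2 c2]] := fg.
have f2 x : I x -> `|f x| <= L * 2 by move=> _; exact: holder_bnd.
have L2 : 0 <= L * 2 by rewrite mulr_ge0// (holder_ge0 hf).
have w1 x : I x -> `|w x| <= 1 by move=> _; rewrite ger0_norm ?wt_ge0// wt_le1.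
(* Both sides are limits of the integral of f against the two sides of [prodR]: the left one through
   [Q_antisym], the right one by dominated convergence at common Lebesgue points of w and f. *)
have key : - (\int[leb]_(x in I) (G x * g x)) =
   \int[leb]_(x in I) (f x * (pi * x * g x - pi * w x * (pi * f x))).
  have cR := cvg_int_Q If fg IG.
  have cRN : (fun y => - (\int[leb]_(x in I) (G x * Q y f x))) @ 0^'+ --> - (\int[leb]_(x in I) (G x * g x)).
    exact: cvgN.
  have [|||||_ cL] := @dct_right R I (fun y x => f x * (Q y w x * Q y f x - P y w x * P y f x))
    (fun x => f x * (pi * x * g x - pi * w x * (pi * f x)))
    (fun x => (C1 * C2 + (1 * pi) * (L * 2 * pi)) * `|f x|) mI.
  - move=> y y0; apply: measurable_funM; first exact: holder_meas hf.
    apply: measurable_funB.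
      by apply: measurable_funM; [exact: (meas_Q y0 LI_wt)|exact: (meas_Q y0 If)].
    by apply: measurable_funM; [exact: (meas_P y0 LI_wt)|exact: (meas_P y0 If)].
  - apply: measurable_funM; first exact: holder_meas hf.
    apply: measurable_funB.
      by apply: measurable_funM => //; exact: measurable_funM.
    by apply: measurable_funM; apply: measurable_funM => //; [exact: meas_wt|exact: holder_meas hf].
  - apply: ae_imply2 (lebp_ae LI_wt) (lebp_ae If) => x h1 h2 Ix.
    apply: cvgM; first exact: cvg_cst.
    apply: cvgB; apply: cvgM; [exact: cL1|exact: c2| |].
      exact: P_cvg LI_wt Ix (h1 Ix).
    exact: P_cvg If Ix (h2 Ix).
  - exact: LIZ (L1_abs If).
  - move=> y x y0 Ix; rewrite normrM mulrC ler_wpM2r//.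
    apply: (le_trans (ler_normB _ _)); apply: lerD; apply: normM_le.
    + exact: Q1.
    + exact: Q2.
    + by apply: P_bnd => //; exact: LI_wt.
    + exact: P_bnd.
  apply: cvg_right_eq cRN cL => y y0.
  rewrite -Q_antisym//; apply: eq_int => x Ix.
  by rewrite (prodR x holder_wt hf V_wt fg y0).
have X := int_XV hf fg.
have E1 : \int[leb]_(x in I) (G x * g x) =
    \int[leb]_(x in I) (w x * g x ^+ 2) + pi * \int[leb]_(x in I) (f x * x * g x).
  have Ifxg' : L1 I (fun x => f x * x * g x).
    by have [[L' h1] _] := V_mulX hf fg; exact: goodV_LM fg (holder_L1 h1).
  rewrite -iZ// -iD//; last exact: LIZ.
    by apply: eq_int => x _; rewrite /G; ring.
  by apply: LI_eq Iwg2 => x _; ring.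
have E2 : \int[leb]_(x in I) (f x * (pi * x * g x - pi * w x * (pi * f x))) =
   pi * \int[leb]_(x in I) (f x * x * g x) - pi ^+ 2 * \int[leb]_(x in I) (w x * f x ^+ 2).
  have Ifxg' : L1 I (fun x => f x * x * g x).
    by have [[L' h1] _] := V_mulX hf fg; exact: goodV_LM fg (holder_L1 h1).
  have Ifw' : L1 I (fun x => w x * f x ^+ 2) by apply: LI_eq Ifw => x _; ring.
  rewrite -!iZ// -iB//; [|exact: LIZ|exact: LIZ].
  by apply: eq_int => x _; ring.
move: key; rewrite E1 E2 X => key.
have aux (A B Z p : R) : - (A + p * (Z / 2)) = p * (Z / 2) - p ^+ 2 * B ->
    0 <= p * Z -> A <= p ^+ 2 * B by move=> h h'; lra.
by apply: aux key _; rewrite mulr_ge0 ?pi_ge0// sqr_ge0.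
Qed.

End Weight.

(** * Weighted spaces *)

Section WeightedL2.
Variable R : realType.
Local Notation leb := (@lebesgue_measure R).
Local Notation I := (@unit_itv R).
Local Notation w := (@wt R).
Implicit Types (D : set R) (f g h k r : R -> R) (x y t u v a b c d l L M C s e K : R).

Lemma int0 D : \int[leb]_(x in D) (0 : R) = 0.
Proof. by rewrite /Rintegral integral0. Qed.

(** The argument of Riesz and Fischer: the sum of the |h_(n+1) - h_n| has a finite integral, so it
    is finite almost everywhere and the telescoping series converges absolutely there. Fatou's lemma
    then bounds the L^1 distance to the limit. *)
Lemma L1_fast (h_ : (R -> R)^nat) K : (forall n, L1 I (h_ n)) ->
  (forall n, \int[leb]_(x in I) `|h_ n.+1 x - h_ n x| <= K / 2 ^+ n) ->
  exists h, [/\ L1 I h, {ae leb, forall x, I x -> h_ ^~ x @ \oo --> h x} &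
    (fun n => \int[leb]_(x in I) `|h x - h_ n x|) @ \oo --> 0].
Proof.
move=> Ih hK.
pose d n x := `|h_ n.+1 x - h_ n x|.
have Id n : L1 I (d n) by apply/L1_abs/LIB.
have d0 n x : 0 <= d n x by rewrite /d.
have K0 : 0 <= K.
  have := hK 0%N; rewrite expr0 divr1; apply: le_trans; exact: Rintegral_ge0.
have geo n : \sum_(0 <= i < n) K / 2 ^+ i <= 2 * K.
  suff -> : \sum_(0 <= i < n) K / 2 ^+ i = 2 * K - 2 * K / 2 ^+ n.
    by rewrite gerBl divr_ge0 ?mulr_ge0// exprn_ge0.
  elim: n => [|n IH]; first by rewrite big_geq// expr0 divr1 subrr.
  rewrite big_nat_recr//= IH exprS.
  have : (2 : R) ^+ n != 0 by rewrite expf_neq0.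
  by move=> ?; field.
have mE n : @measurable_fun _ _ (measurableTypeR R) _ I (EFin \o d n).
  exact: meas_EFin (L1_meas (Id n)).
have Isum : leb.-integrable I (fun x => (\sum_(0 <= k <oo) (d k x)%:E)%E).
  apply/integrableP; split.
    apply: (@ge0_emeasurable_sum _ (measurableTypeR R)) => //.
    - by move=> n x _ _; rewrite lee_fin.
    - by move=> n _; exact: mE.
  have -> : (\int[leb]_(x in I) `|\sum_(0 <= k <oo) (d k x)%:E|)%E =
    (\int[leb]_(x in I) (\sum_(0 <= k <oo) (d k x)%:E))%E.
    apply: eq_integral => x _; rewrite gee0_abs//.
    by apply: nneseries_ge0 => n _ _; rewrite lee_fin.
  rewrite (@integral_nneseries _ _ _ leb I mI); last 2 first.
  - by move=> n; exact: mE.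
  - by move=> n x _; rewrite lee_fin.
  apply: (@le_lt_trans _ _ (2 * K)%:E); last by rewrite ltry.
  apply: lime_le.
    by apply: is_cvg_nneseries => n _ _; apply: integral_ge0 => x _; rewrite lee_fin.
  apply: nearW => n.
  under eq_bigr do rewrite (int_EFin mI (Id _)).
  rewrite sumEFin lee_fin; apply: le_trans (geo n).
  by apply: ler_sum => i _; exact: hK.
have aefin := @integrable_ae _ _ _ leb I mI _ Isum.
(* An upper limit is measurable on all of I, including the points where the sequence does not
   converge. *)
pose h x := fine (limn_esup (fun n => (h_ n x)%:E)).
have ch : {ae leb, forall x, I x -> h_ ^~ x @ \oo --> h x}.
  apply: ae_imply aefin => x fx Ix.
  have cs : cvgn (series (telescope (h_ ^~ x))).
    apply: normed_cvg; apply: nondecreasing_is_cvgn.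
      have -> : [normed series (telescope (h_ ^~ x))] = series (d ^~ x) by [].
      apply/nondecreasing_seqP => n.
      by rewrite /series/= big_nat_recr//= lerDl.
    exists (fine (\sum_(0 <= k <oo) (d k x)%:E)%E) => _ [n _ <-].
    rewrite -lee_fin fineK; last exact: fx.
    rewrite /series/= -sumEFin.
    apply: nneseries_lim_ge => i _ _; by rewrite lee_fin.
  have cs2 : cvgn (h_ ^~ x).
    have -> : h_ ^~ x = (fun n => h_ 0%N x + series (telescope (h_ ^~ x)) n).
      by apply/funext => n; rewrite -eq_sum_telescope.
    by apply: is_cvgD => //; exact: is_cvg_cst.
  have [l cl] := (cvg_ex _).1 cs2.
  suff -> : h x = l by [].
  have reimE : (fun n => (h_ n x)%:E) @ \oo --> l%:E by apply: cvg_EFin cl; exact: nearW.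
  by rewrite /h (cvg_limn_einf_sup reimE).2.
have meas_h : measurable_fun I h.
  apply: (@measurableT_comp _ _ _ _ _ _ (@fine R)); first exact: fine_measurable.
  apply: measurable_fun_limn_esup => n; exact: meas_EFin (L1_meas (Ih n)).
have bnd n m : \int[leb]_(x in I) `|h_ (m + n)%N x - h_ n x| <= 2 * K / 2 ^+ n - 2 * K / 2 ^+ (m + n).
  elim: m => [|m IH].
    rewrite add0n subrr (@eq_int _ _ _ (fun=> 0)); last by move=> x _; rewrite subrr normr0.
    by rewrite Rintegral_cst// ?mul0r//; exact: mI.
  apply: (@le_trans _ _ (\int[leb]_(x in I) `|h_ (m + n)%N x - h_ n x| + K / 2 ^+ (m + n))).
    apply: (le_trans _ (lerD (lexx _) (hK (m + n)%N))).
    rewrite -iD; [|by apply/L1_abs/LIB|exact: Id].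
    apply: i_le; [by apply/L1_abs/LIB|by apply: LID => //; apply/L1_abs/LIB|].
    move=> x _; rewrite addSn; apply: (le_trans _ (ler_normD _ _)).
    rewrite le_eqVlt; apply/orP; left; apply/eqP; congr (`|_|); ring.
  apply: (le_trans (lerD IH (lexx _))).
  rewrite addSn exprS; have : (2 : R) ^+ (m + n) != 0 by rewrite expf_neq0.
  have : (2 : R) ^+ n != 0 by rewrite expf_neq0.
  by move=> ? ?; rewrite le_eqVlt; apply/orP; left; apply/eqP; field; apply/andP.
have fin n : L1 I (fun x => `|h x - h_ n x|) /\ \int[leb]_(x in I) `|h x - h_ n x| <= 2 * K / 2 ^+ n.
  apply: (@fatou_R _ _ (fun m x => `|h_ (m + n)%N x - h_ n x|) (fun x => `|h x - h_ n x|) (2 * K / 2 ^+ n) mI) => //.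
  - by move=> m; apply/L1_abs/LIB.
  - by apply: measurableT_comp => //; apply: measurable_funB => //; exact: L1_meas.
  - apply: ae_imply ch => x cx Ix; apply: cvg_norm; apply: cvgB; last exact: cvg_cst.
    by have := cx Ix; rewrite -(cvg_shiftn n).
  - move=> m; apply: (le_trans (bnd n m)); rewrite gerBl divr_ge0 ?mulr_ge0// exprn_ge0//.
have IL : L1 I h.
  apply: (LI_eq (f := fun x => (h x - h_ 0%N x) + h_ 0%N x)); first by move=> x _; rewrite subrK.
  apply: LID => //; apply: (LI_le (g := fun x => `|h x - h_ 0%N x|)) => //.
    by apply: measurable_funB => //; exact: L1_meas.
  exact: (fin 0%N).1.
exists h; split=> //.
apply: (@squeeze_cvgr _ _ _ _ (fun=> 0) (fun n => 2 * K / 2 ^+ n)).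
- by apply: nearW => n; rewrite (fin n).2 andbT; exact: Rintegral_ge0.
- exact: cvg_cst.
- rewrite -(mulr0 (2 * K)); apply: cvgM; first exact: cvg_cst.
  under eq_fun do rewrite -exprVn.
  by apply: cvg_expr; rewrite ger0_norm// ?invr_ge0// invf_lt1// ltr1n.
Qed.

Section Weight.
Variable r : R -> R.
Hypotheses (r0 : forall x, I x -> 0 < r x) (Ir : L1 I r).

Definition Lr f := measurable_fun I f /\ L1 I (fun x => r x * f x ^+ 2).
(** The square of the norm. The triangle inequality is used in the form (a - b)^2 <= 2 a^2 + 2 b^2,
    which is where the factors 2 in later bounds come from. *)
Definition Nr f := \int[leb]_(x in I) (r x * f x ^+ 2).

Lemma Nr_ge0 f : 0 <= Nr f.
Proof. by apply: Rintegral_ge0 => x Ix; rewrite mulr_ge0 ?sqr_ge0// ltW// r0. Qed.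

Lemma Lr_bnd f C : measurable_fun I f -> (forall x, I x -> `|f x| <= C) -> Lr f.
Proof.
move=> mf fC; split=> //; apply: (@LI_bndM _ _ _ (C ^+ 2)) => //.
  by apply: measurable_funX.
move=> x Ix; rewrite normrX; apply: lerXn2r; rewrite ?nnegrE//; last exact: fC.
exact: le_trans (fC x Ix).
Qed.

Lemma LrB f g : Lr f -> Lr g -> Lr (fun x => f x - g x) /\
  Nr (fun x => f x - g x) <= 2 * Nr f + 2 * Nr g.
Proof.
move=> [mf If] [mg Ig].
have mfg : measurable_fun I (fun x => f x - g x) by exact: measurable_funB.
have I2 : L1 I (fun x => 2 * (r x * f x ^+ 2) + 2 * (r x * g x ^+ 2)) by apply: LID; exact: LIZ.
have pw x : I x -> r x * (f x - g x) ^+ 2 <= 2 * (r x * f x ^+ 2) + 2 * (r x * g x ^+ 2).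
  move=> Ix; have := mulr_ge0 (ltW (r0 Ix)) (sqr_ge0 (f x + g x)); lra.
have IB : L1 I (fun x => r x * (f x - g x) ^+ 2).
  apply: (LI_le _ _ I2).
    by apply: measurable_funM; [exact: L1_meas|apply: measurable_funX].
  by move=> x Ix; rewrite ger0_norm ?pw// mulr_ge0 ?sqr_ge0// ltW// r0.
split=> //; rewrite /Nr -!iZ// -iD; [|exact: LIZ|exact: LIZ].
exact: i_le.
Qed.

Lemma LrZ a f : Lr f -> Lr (fun x => a * f x) /\ Nr (fun x => a * f x) = a ^+ 2 * Nr f.
Proof.
move=> [mf If]; have e x : a ^+ 2 * (r x * f x ^+ 2) = r x * (a * f x) ^+ 2 by ring.
split; first split.
- exact: measurable_funM.
- by apply: LI_eq (LIZ (a ^+ 2) If) => x _; rewrite e.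
- by rewrite /Nr -iZ//; apply: eq_int => x _; rewrite e.
Qed.

Lemma Lr_ae f g : measurable_fun I g -> {ae leb, forall x, I x -> f x = g x} -> Lr f ->
  Lr g /\ Nr g = Nr f.
Proof.
move=> mg fg [mf If].
have mr := L1_meas Ir.
have m1 : measurable_fun I (fun x => r x * g x ^+ 2).
  by apply: measurable_funM => //; exact: measurable_funX.
have E : {ae leb, forall x, I x -> r x * f x ^+ 2 = r x * g x ^+ 2}.
  by apply: ae_imply fg => x h Ix; rewrite h.
split; last first.
  by apply/esym/int_ae_eq => //; [exact: mI|exact: L1_meas].
split=> //.
(* Dominated convergence for a constant sequence transfers integrability along almost everywhere
   equality. *)
have [] := @dct R I (fun _ x => r x * f x ^+ 2) (fun x => r x * g x ^+ 2) (fun x => `|r x * f x ^+ 2|) mI => //.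
- by move=> _; exact: L1_meas.
- by apply: ae_imply E => x e Ix; rewrite e//; exact: cvg_cst.
- exact: L1_abs.
Qed.

(* The approximants are w P_y(h_k) / pi, where h_k is f / w truncated at k. *)
Lemma density f e : Lr f -> 0 < e -> exists p, [/\ exists L, holder L p,
  Lr (fun x => f x - p x) & Nr (fun x => f x - p x) < e].
Proof.
move=> [mf If] e0; have mr := L1_meas Ir.
have mw := @meas_wt R I.
pose h x := f x / w x.
have meas_h : measurable_fun I h.
  by apply: measurable_funM => //; exact: L1_meas (int_invw R).1.
(* Large values are replaced by 0 and not by n, so that f - w T(h) is at each point either 0 or f
   and is dominated by f. *)
pose T n (t : R) := if `|t| < n%:R then t else 0.
have mT n : measurable_fun setT (T n).
  apply: measurable_fun_ifT => //.
  by apply: measurable_fun_ltr => //; exact: measurableT_comp.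
have Tb n t : `|T n t| <= n%:R.
  by rewrite /T; case: ifPn => [/ltW//|_]; rewrite normr0 ler0n.
have mhk n : measurable_fun I (fun x => T n (h x)) by exact: measurableT_comp.
have fE x : I x -> f x = w x * h x.
  by move=> Ix; rewrite /h mulrCA divff ?mulr1// gt_eqF// wt_gt0.
have Lk n : Lr (fun x => w x * T n (h x)).
  apply: (@Lr_bnd _ n%:R); first exact: measurable_funM.
  move=> x Ix; rewrite normrM -(mul1r n%:R); apply: ler_pM => //.
  by rewrite ger0_norm ?wt_ge0 ?wt_le1.
have LA n := LrB (conj mf If) (Lk n).
(* Each of the two approximations gets e / 4 because [LrB] doubles both errors. *)
have [n Hn] : exists n, Nr (fun x => f x - w x * T n (h x)) < e / 4.
  have [||_] := @dct R I (fun n x => r x * (f x - w x * T n (h x)) ^+ 2) (fun=> 0) (fun x => r x * f x ^+ 2) mI (fun n => L1_meas (LA n).1.2) (measurable_cst _) _ If _.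
  - apply: nearW => x Ix; apply: cvg_near_cst.
    near=> m; rewrite {1}fE// /T ifT ?subrr ?expr0n ?mulr0//.
    by near: m; exact: nbhs_infty_gtr.
  - move=> m x Ix; rewrite ger0_norm; last by rewrite mulr_ge0 ?sqr_ge0// (ltW (r0 Ix)).
    apply: ler_wpM2l; first exact: ltW (r0 Ix).
    rewrite {1 2}fE// /T; case: ifPn => _; last by rewrite mulr0 subr0.
    by rewrite subrr expr0n sqr_ge0.
  move=> + ; rewrite int0 => c.
  have : \forall n \near \oo, Nr (fun x => f x - w x * T n (h x)) < e / 4.
    by apply: (cvgr_lt _ c); rewrite divr_gt0.
  by case => N _ /(_ N (leqnn N)) ?; exists N.
pose hn x := T n (h x); pose M : R := n%:R.
have M0 : 0 <= M by exact: ler0n.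
have Ih : L1 I hn by apply: (LI_bnd (C := M)); [exact: mhk|move=> x _; exact: Tb].
pose p y x := w x * (pi^-1 * P y hn x).
have pi0 := pi_gt0 R.
have mp y : 0 < y -> measurable_fun I (p y).
  by move=> y0; apply: measurable_funM => //; apply: measurable_funM => //; exact: meas_P.
have pb y x : 0 < y -> I x -> `|pi^-1 * P y hn x| <= M.
  move=> y0 Ix; rewrite normrM (gtr0_norm (_ : 0 < pi^-1)) ?invr_gt0//.
  rewrite ler_pdivrMl// mulrC; apply: P_bnd => // z _; exact: Tb.
have wb x : `|w x| <= 1 by rewrite ger0_norm ?wt_ge0 ?wt_le1.
have pb2 y x : 0 < y -> I x -> `|p y x| <= M.
  by move=> y0 Ix; rewrite normrM -(mul1r M); apply: ler_pM => //; exact: pb.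
have Lp y : 0 < y -> Lr (p y) by move=> y0; apply: (@Lr_bnd _ M); [exact: mp|move=> x; exact: pb2].
have LB y (y0 : 0 < y) := LrB (Lp y y0) (Lk n).
have [y [y0 Hy]] : exists y, 0 < y /\ Nr (fun x => p y x - w x * hn x) < e / 4.
  have [|||_] := @dct_right R I (fun y x => r x * (p y x - w x * hn x) ^+ 2) (fun=> 0) (fun x => r x * (2 * M) ^+ 2) mI (fun y (y0 : 0 < y) => L1_meas (LB _ y0).1.2) (measurable_cst _) _ _ _.
  - apply: ae_imply (lebp_ae Ih) => x lx Ix; have c := P_cvg Ih Ix (lx Ix).
    have cL1 : p y x - w x * hn x @[y --> 0^'+] --> w x * (pi^-1 * (pi * hn x)) - w x * hn x.
      apply: cvgB; last exact: cvg_cst.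
      by apply: cvgM; [exact: cvg_cst|apply: cvgM => //; exact: cvg_cst].
    rewrite mulKf ?gt_eqF// subrr in cL1.
    have c2 : r x * ((p y x - w x * hn x) * (p y x - w x * hn x)) @[y --> 0^'+] --> r x * (0 * 0).
      by apply: cvgM; [exact: cvg_cst|exact: cvgM].
    by move: c2; rewrite mulr0 mulr0; apply: cvg_right_ext => y _; rewrite expr2.
  - by apply: LI_eq (LIZ ((2 * M) ^+ 2) Ir) => x _; rewrite mulrC.
  - move=> y x y0 Ix; rewrite normrM (gtr0_norm (r0 Ix)); apply: ler_wpM2l; first exact: ltW (r0 Ix).
    rewrite normrX; apply: lerXn2r; rewrite ?nnegrE ?mulr_ge0//.
    rewrite (_ : 2 * M = M + M); last by rewrite mulrDl mul1r.
    apply: (le_trans (ler_normB _ _)); apply: lerD; first exact: pb2.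
    by rewrite normrM -(mul1r M); apply: ler_pM => //; exact: Tb.
  move=> + ; rewrite int0 => c.
  have c2 : \forall y \near 0^'+, Nr (fun x => p y x - w x * hn x) < e / 4.
    by apply: (cvgr_lt _ c); rewrite divr_gt0.
  near (0:R)^'+ => y; exists y; split; first by [].
  by near: y.
have [LC NC] := LrB (LA n).1 (LB _ y0).1.
have E x : f x - w x * T n (h x) - (p y x - w x * T n (h x)) = f x - p y x by ring.
exists (p y); split.
(* At a fixed height the Poisson integral is Lipschitz: the factor 2 / y^2 bounds the products of
   kernels on the right side of [pk_qk]. *)
- apply: (@holderM _ (Num.sqrt 2) M (y ^- 2 * 2 * \int[leb]_(u in I) `|hn u| * pi^-1)) => //.
  + exact: holder_wt.
  + by rewrite !mulr_ge0 ?invr_ge0 ?exprn_ge0 ?(ltW y0) ?(ltW pi0)//; exact: Rintegral_ge0.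
  + by move=> a Ia; exact: pb.
  + move=> a b Ia Ib; rewrite -mulrBr normrM (gtr0_norm (_ : 0 < pi^-1)) ?invr_gt0//.
    rewrite [leRHS]mulrAC [leRHS]mulrC ler_pM2l ?invr_gt0//.
    rewrite /P -iB ?L1_pk// -mulrAC -iZ; last exact: L1_abs.
    apply: i_absle.
      by apply: LIB; exact: L1_pk.
      by apply: LIZ; exact: L1_abs.
    move=> u _; rewrite -mulrBl normrM; apply: ler_wpM2r => //.
    have pkN z : pk y (- z) = pk y z by rewrite /pk sqrrN.
    rewrite -(pkN (a - u)) -(pkN (b - u)) !opprB pk_qk// normrM [leRHS]mulrC.
    apply: ler_wpM2l => //.
    rewrite (_ : y ^- 2 * 2 = y ^-1 * y^-1 + y^-1 * y^-1); last by rewrite -expr2 exprVn; ring.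
    by apply: (le_trans (ler_normD _ _)); apply: lerD; apply: normM_le; rewrite ?qk_bnd ?pk_bnd.
- by have -> : (fun x => f x - p y x) = (fun x => f x - w x * T n (h x) - (p y x - w x * T n (h x))) by apply/funext => x; rewrite E.
- have -> : (fun x => f x - p y x) = (fun x => f x - w x * T n (h x) - (p y x - w x * T n (h x))) by apply/funext => x; rewrite E.
  apply: (le_lt_trans NC); move: Hn Hy; rewrite /hn; lra.
Unshelve. all: by end_near. Qed.

End Weight.
End WeightedL2.

(** * The Hilbert transform on the weighted spaces *)

Section Extension.
Variable R : realType.
Local Notation leb := (@lebesgue_measure R).
Local Notation I := (@unit_itv R).
Local Notation w := (@wt R).
Local Notation wi := (fun x : R => (@wt R x)^-1).
Local Notation Lm := (Lr (@wt R)).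
Local Notation Nm := (Nr (@wt R)).
Local Notation Ld := (Lr (fun x : R => (@wt R x)^-1)).
Local Notation Nd := (Nr (fun x : R => (@wt R x)^-1)).
Implicit Types (D : set R) (f g h k F G : R -> R) (x y t u v a b c d l L M C e K : R).

Lemma wi_gt0 x : I x -> 0 < (w x)^-1.
Proof. by move=> Ix; rewrite invr_gt0 wt_gt0. Qed.

Lemma LI_wi : L1 I wi. Proof. exact: (int_invw R).1. Qed.

Lemma ae_and (S T : set R) : {ae leb, forall x, S x} -> {ae leb, forall x, T x} ->
  {ae leb, forall x, S x /\ T x}.
Proof. by move=> A B; apply: ae_imply2 A B. Qed.

Lemma Nm_ge0 f : 0 <= Nm f. Proof. by apply: Nr_ge0 => x; exact: wt_gt0. Qed.

Lemma Nd_ge0 f : 0 <= Nd f. Proof. by apply: Nr_ge0 => x; exact: wi_gt0. Qed.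

Lemma sqr_geo_le a K n : 0 <= a -> 0 <= K -> a ^+ 2 <= K / 4 ^+ n -> a <= Num.sqrt K / 2 ^+ n.
Proof.
move=> a0 K0 h; rewrite -(@ler_pXn2r _ 2)// ?nnegrE ?divr_ge0 ?sqrtr_ge0 ?exprn_ge0//.
by rewrite expr_div_n sqr_sqrtr// -exprM mulnC exprM -natrX.
Qed.

Lemma geo_cvg0 K : (fun n => K / 2 ^+ n) @ \oo --> 0.
Proof.
rewrite -(mulr0 K); apply: cvgM; first exact: cvg_cst.
under eq_fun do rewrite -exprVn.
by apply: cvg_expr; rewrite ger0_norm// ?invr_ge0// invf_lt1// ltr1n.
Qed.

Lemma squeeze_0 (a b : R^nat) : (forall n, 0 <= a n) -> (forall n, a n <= b n) ->
  b @ \oo --> 0 -> a @ \oo --> 0.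
Proof.
move=> a0 ab; apply: squeeze_cvgr (cvg_cst 0).
by apply: nearW => n; rewrite ab a0.
Qed.

Lemma cvg_seq_eq (a b : R^nat) l M : (forall n, a n = b n) ->
  a @ \oo --> l -> b @ \oo --> M -> l = M.
Proof. by move=> /funext -> A B; exact: (cvg_unique _ A B). Qed.

Lemma squeeze0 (a : R^nat) K : (forall n, 0 <= a n) -> (forall n, a n <= K / 2 ^+ n) ->
  a @ \oo --> 0.
Proof.
by move=> a0 aK; apply: squeeze_0 (geo_cvg0 K).
Qed.

Lemma le_lim0 (a : R^nat) c : (forall n, c <= a n) -> a @ \oo --> 0 -> c <= 0.
Proof. by move=> ca a0; apply: (cvgr_to_ge a0); exact: nearW. Qed.

Lemma cvg_dist (A a : R^nat) l : (forall n, `|A n - l| <= a n) -> a @ \oo --> 0 -> A @ \oo --> l.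
Proof.
move=> h c; rewrite -[A](subrK (fun=> l)) -[X in _ --> X](add0r l).
apply: cvgD; last exact: cvg_cst.
by apply/norm_cvg0P; apply: squeeze_0 c => n; [exact: normr_ge0|exact: h].
Qed.

(** Geometric convergence in L^1 makes the increments summable, so [L1_fast] yields an almost
    everywhere limit, which has L^1 distance 0 from h. *)
Lemma L1_geo_ae (h_ : (R -> R)^nat) h K : (forall n, L1 I (h_ n)) -> L1 I h ->
  (forall n, \int[leb]_(x in I) `|h_ n x - h x| <= K / 2 ^+ n) ->
  {ae leb, forall x, I x -> h_ ^~ x @ \oo --> h x}.
Proof.
move=> Ih_ Ih hK.
have [] := @L1_fast R h_ (K * 2) Ih_.
  move=> n; apply: (@le_trans _ _ (K / 2 ^+ n.+1 + K / 2 ^+ n)).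
    apply: (le_trans _ (lerD (hK _) (hK _))).
    rewrite -iD; [|by apply/L1_abs/LIB|by apply/L1_abs/LIB].
    apply: i_le; [by apply/L1_abs/LIB|by apply: LID; apply/L1_abs/LIB|].
    move=> x _; rewrite (distrC (h_ n x)); apply: (le_trans _ (ler_normD _ _)).
    by rewrite le_eqVlt; apply/orP; left; apply/eqP; congr (`|_|); ring.
  have K0 : 0 <= K by have := hK 0%N; rewrite expr0 divr1; apply: le_trans; exact: Rintegral_ge0.
  rewrite exprS invfM.
  have : 0 <= K * (2 ^+ n)^-1 by rewrite mulr_ge0 ?invr_ge0 ?exprn_ge0.
  by move: (_^-1) => z; lra.
move=> g [Ig cg Lg].
suff E : {ae leb, forall x, I x -> `|h x - g x| = 0}.
  apply: ae_imply2 E cg => x E cg Ix; have /eqP := E Ix.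
  by rewrite normr_eq0 subr_eq0 => /eqP ->; exact: cg.
apply: int_le0_ae => //; [exact: mI|by apply/L1_abs/LIB|].
have c : (fun n => K / 2 ^+ n + \int[leb]_(x in I) `|g x - h_ n x|) @ \oo --> (0 : R).
  by rewrite -(addr0 0); apply: cvgD => //; exact: geo_cvg0.
apply: (le_lim0 _ c) => n.
apply: (le_trans _ (lerD (hK n) (lexx _))).
rewrite -iD; [|by apply/L1_abs/LIB|by apply/L1_abs/LIB].
apply: i_le; [by apply/L1_abs/LIB|by apply: LID; apply/L1_abs/LIB|].
move=> x _; rewrite (distrC (h_ n x)) (distrC (g x)); apply: (le_trans _ (ler_normD _ _)).
by rewrite le_eqVlt; apply/orP; left; apply/eqP; congr (`|_|); ring.
Qed.

(** Squared distances of order 4^(-n) turn, after Cauchy-Schwarz, into L^1 distances of order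
    2^(-n), as [L1_fast] and [L1_geo_ae] require. *)
Lemma fastapp r f e : (forall x, I x -> 0 < r x) -> L1 I r -> Lr r f -> 0 < e ->
  exists p : (R -> R)^nat, [/\ forall n, exists L, holder L (p n),
    forall n, Lr r (fun x => f x - p n x) & forall n, Nr r (fun x => f x - p n x) <= e / 4 ^+ n].
Proof.
move=> r0 Ir Lf e0.
have h n : exists p, (exists L, holder L p) /\ Lr r (fun x => f x - p x) /\
    Nr r (fun x => f x - p x) <= e / 4 ^+ n.
  have [|p [hp Lp Np]] := density r0 Ir Lf (_ : 0 < e / 4 ^+ n); first by rewrite divr_gt0// exprn_gt0.
  by exists p; split=> //; split=> //; exact: ltW.
have [p hp] := choice h.
by exists p; split=> n; have [? []] := hp n.
Qed.

Lemma CS f g : Lm f -> Ld g -> L1 I (fun x => f x * g x) /\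
  (\int[leb]_(x in I) `|f x * g x|) ^+ 2 <= Nm f * Nd g.
Proof.
move=> [mf If] [mg Ig].
have Ig' : L1 I (fun x => g x ^+ 2 / w x) by apply: LI_eq Ig => x _; rewrite mulrC.
have [A B] := cauchy_schwarz mI (@wt_gt0 R) mf mg If Ig'.
split=> //; rewrite /Nr in B *.
by rewrite [X in _ <= _ * X](@eq_int _ _ _ (fun x => g x ^+ 2 / w x))// => x _; rewrite mulrC.
Qed.

Lemma holderMeas r f L : (forall x, I x -> 0 < r x) -> L1 I r -> holder L f -> Lr r f.
Proof.
move=> r0 Ir hf; apply: (@Lr_bnd _ _ Ir _ (L * 2)); first exact: holder_meas hf.
by move=> x _; exact: holder_bnd hf.
Qed.

Lemma Lm1 f : Lm f -> L1 I f /\ (\int[leb]_(x in I) `|f x|) ^+ 2 <= Nm f * pi.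
Proof.
move=> Lf.
have L1 : Ld (fun=> 1) by apply: (@Lr_bnd _ _ LI_wi _ 1) => // x _; rewrite normr1.
have [A B] := CS Lf L1; split; first by apply: LI_eq A => x _; rewrite mulr1.
rewrite (_ : pi = Nd (fun=> 1)).
  by rewrite (@eq_int _ _ _ (fun x => `|f x * 1|))// => x _; rewrite mulr1.
by rewrite -(int_invw R).2; apply: eq_int => x _; rewrite expr1n mulr1.
Qed.

Lemma Ld_Lm f : Ld f -> Lm f /\ Nm f <= Nd f.
Proof.
move=> [mf If].
have pw x : I x -> w x * f x ^+ 2 <= (w x)^-1 * f x ^+ 2.
  move=> Ix; apply: ler_wpM2r; first exact: sqr_ge0.
  have w0 := wt_gt0 Ix; apply: (@le_trans _ _ 1); first exact: wt_le1.
  by rewrite invf_ge1//; exact: wt_le1.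
have mm : measurable_fun I (fun x => w x * f x ^+ 2).
  by apply: measurable_funM; [exact: meas_wt|exact: measurable_funX].
have L : L1 I (fun x => w x * f x ^+ 2).
  by apply: LI_le If => // x Ix; rewrite ger0_norm ?pw// mulr_ge0 ?wt_ge0 ?sqr_ge0.
by split=> //; exact: i_le.
Qed.

(** The transform is taken as the limit of [Q y f] and not as a principal value, because the
    identities available at height y then pass to the limit directly. [Q_to_H] converts to principal
    values at Lebesgue points. *)
Definition isV f g := measurable_fun I g /\
  {ae leb, forall x, I x -> Q y f x @[y --> 0^'+] --> g x}.

Lemma isV_uniq f g h : isV f g -> isV f h -> {ae leb, forall x, I x -> g x = h x}.
Proof.
move=> [_ A] [_ B]; apply: ae_imply2 A B => x A B Ix.
exact: (cvg_unique _ (A Ix) (B Ix)).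
Qed.

Lemma goodV_isV f g : goodV f g -> isV f g.
Proof. by move=> [C [mg _ _ c]]; split=> //; apply: nearW => x; exact: c. Qed.

Lemma isVB f g F G : L1 I f -> L1 I g -> isV f F -> isV g G ->
  isV (fun x => f x - g x) (fun x => F x - G x).
Proof.
move=> If Ig [mF cF] [mG cG]; split; first exact: measurable_funB.
apply: ae_imply2 cF cG => x A B Ix.
apply: (cvg_right_ext _ (cvgB (A Ix) (B Ix))) => y y0 /=.
by rewrite QB.
Qed.

Lemma isVD f g F G : L1 I f -> L1 I g -> isV f F -> isV g G ->
  isV (fun x => f x + g x) (fun x => F x + G x).
Proof.
move=> If Ig [mF cF] [mG cG]; split; first exact: measurable_funD.
apply: ae_imply2 cF cG => x A B Ix.
apply: (cvg_right_ext _ (cvgD (A Ix) (B Ix))) => y y0 /=.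
by rewrite QD.
Qed.

Lemma isVZ c f F : L1 I f -> isV f F -> isV (fun x => c * f x) (fun x => c * F x).
Proof.
move=> If [mF cF]; split; first exact: measurable_funM.
apply: ae_imply cF => x A Ix.
apply: (cvg_right_ext _ (cvgM (cvg_cst c) (A Ix))) => y y0 /=.
by rewrite QZ.
Qed.

Lemma holderB L M f g : holder L f -> holder M g -> holder (L + M) (fun x => f x - g x).
Proof.
move=> [f0 fL] [g0 gL]; split=> [x nx|a b]; first by rewrite f0// g0// subrr.
rewrite (_ : f a - g a - (f b - g b) = (f a - f b) - (g a - g b)); last by ring.
by rewrite mulrDl; apply: (le_trans (ler_normB _ _)); apply: lerD.
Qed.

Lemma goodVB f g F G : L1 I f -> L1 I g -> goodV f F -> goodV g G ->
  goodV (fun x => f x - g x) (fun x => F x - G x).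
Proof.
move=> If Ig [C [mF bF bQ cF]] [M [mG bG bQ' cG]]; exists (C + M); split.
- exact: measurable_funB.
- by move=> x Ix; apply: (le_trans (ler_normB _ _)); apply: lerD; [exact: bF|exact: bG].
- move=> x y Ix y0; rewrite QB//; apply: (le_trans (ler_normB _ _)).
  by apply: lerD; [exact: bQ|exact: bQ'].
- move=> x Ix; apply: (cvg_right_ext _ (cvgB (cF x Ix) (cG x Ix))) => y y0 /=.
  by rewrite QB.
Qed.

Lemma Q_L1_cvg (f_ : (R -> R)^nat) f x y : 0 < y -> (forall n, L1 I (f_ n)) -> L1 I f ->
  (fun n => \int[leb]_(x in I) `|f_ n x - f x|) @ \oo --> 0 ->
  (fun n => Q y (f_ n) x) @ \oo --> Q y f x /\ (fun n => P y (f_ n) x) @ \oo --> P y f x.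
Proof.
move=> y0 Ifn If c.
have c2 : (fun n => y^-1 * \int[leb]_(x in I) `|f_ n x - f x|) @ \oo --> 0.
  by rewrite -(mulr0 y^-1); apply: cvgM => //; exact: cvg_cst.
split; apply: (cvg_dist _ c2) => n.
- by rewrite -QB//; apply: Q_le => //; exact: LIB.
- by rewrite -PB//; apply: P_le => //; exact: LIB.
Qed.

Lemma Nr_triangle r f g : (forall x, I x -> 0 < r x) -> L1 I r -> Lr r f ->
  Lr r (fun x => f x - g x) -> Lr r g /\ Nr r g <= 2 * Nr r f + 2 * Nr r (fun x => f x - g x).
Proof.
move=> r0 Ir Lf Lfg; have [] := LrB r0 Ir Lf Lfg.
have -> : (fun x => f x - (f x - g x)) = g by apply/funext => x; rewrite subKr.
by [].
Qed.

Lemma exp4_gt0 n : 0 < (4 : R) ^+ n. Proof. by rewrite exprn_gt0. Qed.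

Lemma weight_quotientE x a b c d : a != 0 -> d != 0 ->
  b / d = (a * (b + a * (x * c)) - a * x * (a * c)) / (a * d).
Proof. by move=> a0 d0; field; apply/andP. Qed.

(* Along a fast sequence psi_n -> f the functions w V psi_n converge in L^1 and
   almost everywhere; passing to the limit in [prodI] for (w, psi_n) and then
   letting y -> 0 isolates V f, since P y w -> pi w > 0. *)
Lemma V_Lm_eps f e : Lm f -> 0 < e -> exists g, [/\ isV f g, Lm g &
  Nm g <= pi ^+ 2 * (2 * Nm f + 2 * e)].
Proof.
move=> Lf e0; have Iw := LI_wt R; have w0 := @wt_gt0 R.
have [psi [hpsi Lpsi Npsi]] := fastapp w0 Iw Lf e0.
have hG n : exists G, goodV (psi n) G.
  by have [L hL] := hpsi n; exact: holder_goodV hL.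
have [G gG] := choice hG.
have Ipsi n : L1 I (psi n) by have [L hL] := hpsi n; exact: holder_L1 hL.
have If := (Lm1 Lf).1.
have Lp n : Lm (psi n) by have [L hL] := hpsi n; exact: holderMeas hL.
have mG n : measurable_fun I (G n) by have [C []] := gG n.
have IwG n : L1 I (fun x => w x * G n x) by exact: goodV_LM (gG n) Iw.
have LGB n m : Lm (fun x => G n x - G m x).
  have [C [m1 b1 _ _]] := goodVB (Ipsi n) (Ipsi m) (gG n) (gG m).
  by apply: (@Lr_bnd _ _ Iw _ C).
have NGB n : Nm (fun x => G n.+1 x - G n x) <= pi ^+ 2 * (4 * e) / 4 ^+ n.
  have [L hL] := hpsi n; have [L' hL'] := hpsi n.+1.
  apply: (le_trans (norm_wV (holderB hL' hL) (goodVB (Ipsi _) (Ipsi _) (gG _) (gG _)))).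
  rewrite -mulrA; apply: ler_wpM2l; first exact: sqr_ge0.
  have [_] := LrB w0 Iw (Lpsi n) (Lpsi n.+1).
  have -> : (fun x => f x - psi n x - (f x - psi n.+1 x)) = (fun x => psi n.+1 x - psi n x).
    by apply/funext => x; ring.
  move/le_trans; apply.
  have := Npsi n; have := Npsi n.+1; rewrite exprS invfM.
  have : 0 <= e / 4 ^+ n by rewrite divr_ge0 ?(ltW e0) ?(ltW (exp4_gt0 _)).
  by rewrite -(mulrA 4 e) (mulrCA e); move: (e / _) => z; lra.
have Lwd : Ld w by apply: (@Lr_bnd _ _ LI_wi _ 1); [exact: meas_wt|move=> x _; rewrite ger0_norm ?wt_ge0 ?wt_le1].
pose K := pi ^+ 2 * (4 * e) * Nd w.
have K0 : 0 <= K by apply: mulr_ge0 (Nd_ge0 _); apply: mulr_ge0; [exact: sqr_ge0|apply: mulr_ge0 => //; exact: ltW].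
have [h [Ih ch Lh]] : exists h, [/\ L1 I h, {ae leb, forall x, I x -> (fun n => w x * G n x) @ \oo --> h x} &
    (fun n => \int[leb]_(x in I) `|h x - w x * G n x|) @ \oo --> 0].
  apply: (@L1_fast _ _ (Num.sqrt K)) => // n; apply: sqr_geo_le => //.
    exact: Rintegral_ge0.
  have [_ B] := CS (LGB n.+1 n) Lwd.
  rewrite (@eq_int _ _ _ (fun x => `|(G n.+1 x - G n x) * w x|)); last first.
    by move=> x _; rewrite mulrBl ![_ * w x]mulrC.
  apply: (le_trans B); rewrite /K mulrAC; apply: ler_wpM2r => //.
  exact: Nd_ge0.
pose g x := h x / w x.
have mg : measurable_fun I g by apply: measurable_funM; [exact: L1_meas|exact: L1_meas LI_wi].
have cG : {ae leb, forall x, I x -> G ^~ x @ \oo --> g x}.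
  apply: ae_imply ch => x c Ix; have := wt_gt0 Ix => wx.
  have -> : G ^~ x = (fun n => w x * G n x * (w x)^-1).
    by apply/funext => n; rewrite mulrAC divff ?mul1r// gt_eqF.
  by apply: cvgM; [exact: c|exact: cvg_cst].
have cpsi : (fun n => \int[leb]_(x in I) `|psi n x - f x|) @ \oo --> 0.
  apply: (@squeeze0 _ (Num.sqrt (e * pi))) => n; first exact: Rintegral_ge0.
  apply: sqr_geo_le; [exact: Rintegral_ge0|by rewrite mulr_ge0 ?(ltW e0) ?pi_ge0|].
  under eq_Rintegral do rewrite distrC.
  apply: (le_trans (Lm1 (Lpsi n)).2); rewrite mulrAC; apply: ler_wpM2r; first exact: pi_ge0.
  exact: Npsi.
(* The argument of P on the right side of [prodI] for the pair w, f, with h in the place of w V f,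
   which is not yet known to exist. *)
pose k x := h x + pi * (x * f x).
have mX : measurable_fun I (fun x : R => x) by [].
have IX q : L1 I q -> L1 I (fun x => x * q x).
  move=> Iq; apply: (LI_eq (f := fun x => q x * x)); first by move=> x _; rewrite mulrC.
  by apply: (LI_bndM (C := 1)) => // x /in_I /andP[a b]; rewrite ler_norml (ltW a) (ltW b).
have Ik : L1 I k by apply: LID => //; apply/LIZ/IX.
have Ikn n : L1 I (fun x => w x * G n x + psi n x * (pi * x)).
  apply: LID => //; apply: (LI_eq (f := fun x => pi * (x * psi n x))); first by move=> x _; ring.
  exact/LIZ/IX.
have ckn : (fun n => \int[leb]_(x in I) `|w x * G n x + psi n x * (pi * x) - k x|) @ \oo --> 0.
  have c3 : (fun n => \int[leb]_(x in I) `|h x - w x * G n x| + pi * \int[leb]_(x in I) `|psi n x - f x|) @ \oo --> 0.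
    rewrite -(addr0 0) -[X in _ + X](mulr0 pi); apply: cvgD => //.
    by apply: cvgM => //; exact: cvg_cst.
  apply: squeeze_0 c3 => n; first exact: Rintegral_ge0.
  rewrite -iZ; last by apply/L1_abs/LIB.
  rewrite -iD; [|by apply/L1_abs/LIB|by apply/LIZ/L1_abs/LIB].
  apply: i_le; [by apply/L1_abs/LIB|by apply: LID; [|apply: LIZ]; apply/L1_abs/LIB|].
  move=> x /in_I /andP[a b].
  rewrite (_ : _ - k x = - (h x - w x * G n x) + pi * x * (psi n x - f x)); last by rewrite /k; ring.
  apply: (le_trans (ler_normD _ _)); rewrite normrN; apply: lerD => //.
  rewrite normrM; apply: ler_wpM2r => //.
  rewrite normrM (ger0_norm (pi_ge0 R)) -{2}(mulr1 pi); apply: ler_wpM2l; first exact: pi_ge0.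
  by rewrite ler_norml (ltW a) (ltW b).
have EI x y : 0 < y -> Q y w x * P y f x + P y w x * Q y f x = P y k x.
  move=> y0; have [cQ cP] := Q_L1_cvg x y0 Ipsi If cpsi.
  have [_ ck] := Q_L1_cvg x y0 Ikn Ik ckn.
  have cL : (fun n => Q y w x * P y (psi n) x + P y w x * Q y (psi n) x) @ \oo --> Q y w x * P y f x + P y w x * Q y f x.
    by apply: cvgD; apply: cvgM => //; exact: cvg_cst.
  apply: (cvg_seq_eq _ cL ck) => n; have [L hL] := hpsi n.
  by rewrite -(prodI x (holder_wt R) hL (V_wt R) (gG n) y0).
have [LNg Ng] : Lm g /\ Nm g <= pi ^+ 2 * (2 * Nm f + 2 * e).
  have [] := @fatou_R R I (fun n x => w x * G n x ^+ 2) (fun x => w x * g x ^+ 2) (pi ^+ 2 * (2 * Nm f + 2 * e)) mI.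
  - by move=> n; have [C [m1 b1 _ _]] := gG n; have [] := @Lr_bnd _ _ Iw (G n) C m1 b1.
  - by apply: measurable_funM; [exact: meas_wt|exact: measurable_funX].
  - by move=> n x Ix; rewrite mulr_ge0 ?wt_ge0 ?sqr_ge0.
  - apply: ae_imply cG => x c Ix; have := cvgM (c Ix) (c Ix) => c2.
    have c3 : (fun n => w x * (G n x * G n x)) @ \oo --> w x * (g x * g x).
      by apply: cvgM; [exact: cvg_cst|exact: c2].
    by move: c3; under eq_fun do rewrite -expr2; rewrite -expr2.
  - move=> n; have [L hL] := hpsi n; apply: (le_trans (norm_wV hL (gG n))).
    apply: ler_wpM2l; first exact: sqr_ge0.
    apply: (le_trans (Nr_triangle w0 Iw Lf (Lpsi n)).2); apply: lerD => //.
    apply: ler_wpM2l => //; apply: (le_trans (Npsi n)).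
    by rewrite ler_pdivrMr ?exp4_gt0// ler_peMr ?(ltW e0)// exprn_ege1// ler1n.
  - by move=> A B; split.
exists g; split=> //; split=> //; have [_ [_ _ _ cw]] := V_wt R.
  have ae2 := ae_and (lebp_ae Iw) (lebp_ae If).
  apply: ae_imply2 ae2 (lebp_ae Ik) => x [lw lf] lk Ix; have wx := wt_gt0 Ix.
  have cPw := P_cvg Iw Ix (lw Ix); have pi0 := pi_gt0 R.
  have n0 : pi * w x != 0 by rewrite mulf_neq0// gt_eqF.
  have c : (P y k x - Q y w x * P y f x) * (P y w x)^-1 @[y --> 0^'+] -->
      (pi * k x - pi * x * (pi * f x)) * (pi * w x)^-1.
    apply: cvgM; last exact: cvgV.
    apply: cvgB; first exact: P_cvg (lk Ix).
    by apply: cvgM; [exact: cw|exact: P_cvg (lf Ix)].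
  have -> : g x = (pi * k x - pi * x * (pi * f x)) * (pi * w x)^-1.
    by apply: weight_quotientE; rewrite gt_eqF.
  apply: cvg_trans c; apply: near_eq_cvg; near=> y.
  have Py0 : P y w x != 0 by near: y; exact: (cvgr_neq0 _ cPw).
  have y0 : 0 < y by [].
  by rewrite -(EI x y y0) addrAC subrr add0r mulrAC divff ?mul1r.
Unshelve. all: by end_near. Qed.

Lemma Nr_ae r f g : (forall x, I x -> 0 < r x) -> L1 I r -> Lr r f -> Lr r g ->
  {ae leb, forall x, I x -> f x = g x} -> Nr r f = Nr r g.
Proof. by move=> r0 Ir Lf [mg _] fg; have [_ ->] := Lr_ae Ir mg fg Lf. Qed.

Lemma le_eps a b c : 0 <= c -> (forall e, 0 < e -> a <= b + c * e) -> a <= b.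
Proof.
move=> c0 h; apply/ler_addgt0Pr => e e0.
have cL1 : 0 < c + 1 by rewrite ltr_wpDl.
apply: (le_trans (h (e / (c + 1)) _)); first by rewrite divr_gt0.
rewrite lerD2l mulrA ler_pdivrMr// mulrC; apply: ler_wpM2l; first exact: ltW.
by rewrite lerDl.
Qed.

(** The factor pi^2 is that of [norm_wV]; approximation by Holder functions in the squared norm
    costs a factor 2, which 4 covers. *)
Definition cV : R := 4 * pi ^+ 2.

Lemma cV_gt0 : 0 < cV. Proof. by rewrite mulr_gt0// exprn_gt0// pi_gt0. Qed.

(** The transform produced by [V_Lm_eps] depends on e only up to a null set, so one g satisfies the
    bound for every e, and e is sent to 0. *)
Lemma V_Lm f : Lm f -> exists g, [/\ isV f g, Lm g & Nm g <= cV * Nm f].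
Proof.
move=> Lf; have [g [Vg Lg _]] := V_Lm_eps Lf ltr01.
exists g; split=> //; apply: (@le_trans _ _ (pi ^+ 2 * (2 * Nm f))); last first.
  rewrite /cV; have := mulr_ge0 (sqr_ge0 pi) (Nm_ge0 f); lra.
apply: (@le_eps _ _ (2 * pi ^+ 2)); first by rewrite mulr_ge0 ?sqr_ge0.
move=> e e0; have [h [Vh Lh Nh]] := V_Lm_eps Lf e0.
rewrite (Nr_ae (@wt_gt0 R) (LI_wt R) Lg Lh (isV_uniq Vg Vh)).
by apply: (le_trans Nh); lra.
Qed.

End Extension.

(** * Tricomi's formula *)

Section Tricomi.
Variable R : realType.
Local Notation leb := (@lebesgue_measure R).
Local Notation I := (@unit_itv R).
Local Notation w := (@wt R).
Local Notation Lm := (Lr (@wt R)).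
Local Notation Nm := (Nr (@wt R)).
Local Notation Ld := (Lr (fun x : R => (@wt R x)^-1)).
Local Notation Nd := (Nr (fun x : R => (@wt R x)^-1)).
Local Notation cV := (cV R).
Implicit Types (D : set R) (f g h k F G : R -> R) (x y t u v a b c d l L M C e K : R).

Lemma int_dist f g h : L1 I f -> L1 I g -> L1 I h ->
  (forall x, I x -> `|f x - g x| <= h x) ->
  `|\int[leb]_(x in I) f x - \int[leb]_(x in I) g x| <= \int[leb]_(x in I) h x.
Proof. by move=> If Ig Ih fg; rewrite -iB//; apply: i_absle => //; exact: LIB. Qed.

Lemma bnd_Ld f C : measurable_fun I f -> (forall x, I x -> `|f x| <= C) -> Ld f.
Proof. by move=> mf b; apply: (@Lr_bnd _ _ (LI_wi R) _ C). Qed.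

Lemma bnd_Lm f C : measurable_fun I f -> (forall x, I x -> `|f x| <= C) -> Lm f.
Proof. by move=> mf b; apply: (@Lr_bnd _ _ (LI_wt R) _ C). Qed.

Lemma LmB f g : Lm f -> Lm g -> Lm (fun x => f x - g x).
Proof. by move=> A B; have [] := LrB (@wt_gt0 R) (LI_wt R) A B. Qed.

Lemma LdB f g : Ld f -> Ld g -> Ld (fun x => f x - g x).
Proof. by move=> A B; have [] := LrB (@wi_gt0 R) (LI_wi R) A B. Qed.

Lemma V_Lm_B f g F G : Lm f -> Lm g -> isV f F -> isV g G -> Lm F -> Lm G ->
  Nm (fun x => F x - G x) <= cV * Nm (fun x => f x - g x).
Proof.
move=> Lf Lg fF gG LF LG; have [h [Vh Lh Nh]] := V_Lm (LmB Lf Lg).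
have E := isV_uniq (isVB (Lm1 Lf).1 (Lm1 Lg).1 fF gG) Vh.
by rewrite (Nr_ae (@wt_gt0 R) (LI_wt R) (LmB LF LG) Lh E).
Qed.

Lemma isV_Lm f F : Lm f -> isV f F -> Lm F /\ Nm F <= cV * Nm f.
Proof.
move=> Lf fF; have [h [Vh Lh Nh]] := V_Lm Lf.
have [] := Lr_ae (LI_wt R) fF.1 (isV_uniq Vh fF) Lh.
by move=> LF ->.
Qed.

Lemma goodV_bnd f g : goodV f g -> exists2 C, measurable_fun I g & forall x, I x -> `|g x| <= C.
Proof. by move=> [C [mg b _ _]]; exists C. Qed.

(** Both sides are continuous in f for the norm of L^2(w): the left one because H is bounded and so
    lies in L^2(1/w), the right one by the bound of V. *)
Lemma antisym_h L f F h H : Lm f -> isV f F -> holder L h -> goodV h H ->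
  \int[leb]_(x in I) (f x * H x) = - (\int[leb]_(x in I) (h x * F x)).
Proof.
move=> Lf fF hh hH; have w0 := @wt_gt0 R; have Iw := LI_wt R.
have [C mH bH] := goodV_bnd hH.
have LdH := bnd_Ld mH bH; have Ldh : Ld h by exact: holderMeas (@wi_gt0 R) (LI_wi R) hh.
have [p [hp Lp Np]] := fastapp w0 Iw Lf ltr01.
have hG n : exists G, goodV (p n) G by have [M hM] := hp n; exact: holder_goodV hM.
have [G gG] := choice hG.
have Ip n : L1 I (p n) by have [M hM] := hp n; exact: holder_L1 hM.
have Lmp n : Lm (p n) by have [M hM] := hp n; exact: holderMeas hM.
have LG n : Lm (G n) by have [B mG bG] := goodV_bnd (gG n); exact: bnd_Lm bG.
have LF := (isV_Lm Lf fF).1.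
have cL1 : (fun n => \int[leb]_(x in I) (p n x * H x)) @ \oo --> \int[leb]_(x in I) (f x * H x).
  apply: (@cvg_dist _ _ (fun n => Num.sqrt (1 * Nd H) / 2 ^+ n)); last exact: geo_cvg0.
  move=> n; have [A B] := CS (Lp n) LdH.
  apply: (@le_trans _ _ (\int[leb]_(x in I) `|(f x - p n x) * H x|)).
    apply: int_dist; [exact: (CS (Lmp n) LdH).1|exact: (CS Lf LdH).1|exact: L1_abs|].
    by move=> x _; rewrite distrC -mulrBl.
  apply: sqr_geo_le; [exact: Rintegral_ge0|by rewrite mul1r Nd_ge0|].
  by apply: (le_trans B); rewrite mulrAC; apply: ler_wpM2r; [exact: Nd_ge0|exact: Np].
have c2 : (fun n => \int[leb]_(x in I) (h x * G n x)) @ \oo --> \int[leb]_(x in I) (h x * F x).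
  apply: (@cvg_dist _ _ (fun n => Num.sqrt (cV * Nd h) / 2 ^+ n)); last exact: geo_cvg0.
  move=> n; have [A B] := CS (LmB LF (LG n)) Ldh.
  have cm q : Lm q -> L1 I (fun x => h x * q x).
    by move=> Lq; apply: LI_eq (CS Lq Ldh).1 => x _; rewrite mulrC.
  apply: (@le_trans _ _ (\int[leb]_(x in I) `|(F x - G n x) * h x|)).
    apply: int_dist; [exact: cm|exact: cm|exact: L1_abs|].
    by move=> x _; rewrite distrC -mulrBr mulrC.
  apply: sqr_geo_le; [exact: Rintegral_ge0|by rewrite mulr_ge0 ?Nd_ge0// ltW// cV_gt0|].
  apply: (le_trans B); rewrite mulrAC; apply: ler_wpM2r; first exact: Nd_ge0.
  apply: (le_trans (V_Lm_B Lf (Lmp n) fF (goodV_isV (gG n)) LF (LG n))).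
  by apply: ler_wpM2l; [exact: ltW (cV_gt0 R)|rewrite -(mul1r _^-1); exact: Np].
apply: (cvg_seq_eq _ cL1 (cvgN c2)) => n.
exact: (antisym_good (Ip n) (holder_L1 hh) (gG n) hH).
Qed.

Lemma mul_sqr_inv a b : a != 0 -> a * (a^-1 * b) ^+ 2 = a^-1 * b ^+ 2.
Proof. by move=> a0; field. Qed.

(* Duality: test the antisymmetry of V against H / w. *)
Lemma norm_d_h L h H : holder L h -> goodV h H -> Nd H <= cV * Nd h.
Proof.
move=> hh hH; have [C mH bH] := goodV_bnd hH.
have LdH := bnd_Ld mH bH; have Ldh : Ld h by exact: holderMeas (@wi_gt0 R) (LI_wi R) hh.
pose f x := (w x)^-1 * H x.
have mf : measurable_fun I f by apply: measurable_funM => //; exact: L1_meas (LI_wi R).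
have ef x : I x -> w x * f x ^+ 2 = (w x)^-1 * H x ^+ 2.
  by move=> Ix; apply: mul_sqr_inv; rewrite gt_eqF// wt_gt0.
have Lf : Lm f by split=> //; apply: LI_eq LdH.2 => x Ix; rewrite ef.
have Nf : Nm f = Nd H by apply: eq_int => x Ix; rewrite ef.
have [F [fF LF NF]] := V_Lm Lf.
have E := antisym_h Lf fF hh hH.
have E2 : Nd H = \int[leb]_(x in I) (f x * H x).
  by apply: eq_int => x Ix; rewrite /f expr2 mulrA.
have [A B] := CS LF Ldh.
have N0 := Nd_ge0 H.
have le1 : Nd H <= \int[leb]_(x in I) `|F x * h x|.
  rewrite {1}E2 E (@eq_int _ _ _ (fun x => F x * h x)); last by move=> x _; rewrite mulrC.
  by apply: (le_trans (ler_norm _)); rewrite normrN; apply: int_absle => //; [exact: mI|exact: L1_abs].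
(* The test function has the same norm in L^2(w) as H has in L^2(1/w), so one factor [Nd H] can be
   cancelled afterwards. *)
have le2 : Nd H ^+ 2 <= cV * Nd h * Nd H.
  apply: (@le_trans _ _ ((\int[leb]_(x in I) `|F x * h x|) ^+ 2)).
    by apply: lerXn2r => //; rewrite nnegrE (le_trans N0).
  apply: (le_trans B); rewrite mulrAC; apply: ler_wpM2r; first exact: Nd_ge0.
  by rewrite -Nf.
have [->|/eqP n0] := eqVneq (Nd H) 0.
  by rewrite mulr_ge0 ?Nd_ge0// ltW// cV_gt0.
by rewrite -(@ler_pM2r _ (Nd H)) -?expr2// lt_neqAle eq_sym N0 andbT; apply/eqP.
Qed.

(** Convergence in L^2(1/w) implies convergence in L^2(w), where V is already bounded; so the
    transforms of fast Holder approximants tend to F almost everywhere, and Fatou's lemma carries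
    over the bound of [norm_d_h]. *)
Lemma isV_Ld f F : Ld f -> isV f F -> Ld F /\ Nd F <= 4 * cV * Nd f.
Proof.
move=> Ldf fF; have [Lf Nf] := Ld_Lm Ldf; have [LF NF] := isV_Lm Lf fF.
have w0 := @wi_gt0 R; have Iw := LI_wi R; have cV0 := cV_gt0 R.
suff key e : 0 < e -> Ld F /\ Nd F <= cV * (2 * Nd f + 2 * e).
  split; first exact: (key 1 ltr01).1.
  apply: (@le_trans _ _ (2 * cV * Nd f)); last first.
    have := mulr_ge0 (ltW cV0) (Nd_ge0 f); lra.
  apply: (@le_eps _ _ _ (2 * cV)); first by rewrite mulr_ge0 ?(ltW cV0).
  by move=> e /key[_]/le_trans; apply; lra.
move=> e0; have [p [hp Lp Np]] := fastapp w0 Iw Ldf e0.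
have hG n : exists G, goodV (p n) G by have [M hM] := hp n; exact: holder_goodV hM.
have [G gG] := choice hG.
have Lmp n : Lm (p n) by have [M hM] := hp n; exact: holderMeas (@wt_gt0 R) (LI_wt R) hM.
have LG n : Lm (G n) by have [B mG bG] := goodV_bnd (gG n); exact: bnd_Lm bG.
have LdG n : Ld (G n) by have [B mG bG] := goodV_bnd (gG n); exact: bnd_Ld bG.
have cG : {ae leb, forall x, I x -> G ^~ x @ \oo --> F x}.
  have := @L1_geo_ae _ G F (Num.sqrt (cV * e * pi)); apply => [n||n].
  - exact: (Lm1 (LG n)).1.
  - exact: (Lm1 LF).1.
  apply: sqr_geo_le; [exact: Rintegral_ge0|by rewrite !mulr_ge0 ?pi_ge0 ?(ltW cV0) ?(ltW e0)|].
  under eq_Rintegral do rewrite distrC.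
  apply: (le_trans (Lm1 (LmB LF (LG n))).2); rewrite mulrAC; apply: ler_wpM2r; first exact: pi_ge0.
  apply: (le_trans (V_Lm_B Lf (Lmp n) fF (goodV_isV (gG n)) LF (LG n))).
  rewrite -[leRHS]mulrA; apply: ler_wpM2l; first exact: ltW.
  by apply: (le_trans _ (Np n)); exact: (Ld_Lm (Lp n)).2.
have [] := @fatou_R R I (fun n x => (w x)^-1 * G n x ^+ 2) (fun x => (w x)^-1 * F x ^+ 2) (cV * (2 * Nd f + 2 * e)) mI.
- by move=> n; exact: (LdG n).2.
- by apply: measurable_funM; [exact: L1_meas Iw|apply: measurable_funX; exact: fF.1].
- by move=> n x Ix; rewrite mulr_ge0 ?sqr_ge0// ltW// w0.
- apply: ae_imply cG => x c Ix; have := cvgM (c Ix) (c Ix) => c2.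
  have c3 : (fun n => (w x)^-1 * (G n x * G n x)) @ \oo --> (w x)^-1 * (F x * F x).
    by apply: cvgM; [exact: cvg_cst|exact: c2].
  by move: c3; under eq_fun do rewrite -expr2; rewrite -expr2.
- move=> n; have [L hL] := hp n; apply: (le_trans (norm_d_h hL (gG n))).
  apply: ler_wpM2l; first exact: ltW.
  apply: (le_trans (Nr_triangle w0 Iw Ldf (Lp n)).2); apply: lerD => //.
  apply: ler_wpM2l => //; apply: (le_trans (Np n)).
  by rewrite ler_pdivrMr ?exp4_gt0// ler_peMr ?(ltW e0)// exprn_ege1// ler1n.
- by move=> A B; split=> //; split=> //; exact: fF.1.
Qed.

Lemma geo_mul_le a b e d n : 0 <= a -> 0 <= b -> a <= e / 4 ^+ n -> b <= d / 4 ^+ n ->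
  a * b <= e * d / 4 ^+ n.
Proof.
move=> a0 b0 ae bd; have p4 := exp4_gt0 R n.
apply: (le_trans (ler_pM a0 b0 ae bd)).
rewrite mulrACA -mulrA; have d0 : 0 <= d / 4 ^+ n by exact: le_trans bd.
have e0 : 0 <= e / 4 ^+ n by exact: le_trans ae.
have {}e0 : 0 <= e by move: e0; rewrite pmulr_lge0 ?invr_gt0.
have {}d0 : 0 <= d by move: d0; rewrite pmulr_lge0 ?invr_gt0.
rewrite -[leRHS]mulrA; apply: ler_wpM2l => //; apply: ler_wpM2l => //.
by rewrite ler_piMr ?invr_ge0 ?(ltW p4)// invf_le1// exprn_ege1// ler1n.
Qed.

Lemma pair_cvg (a_ b_ : (R -> R)^nat) f g A B : Lm f -> Ld g ->
  (forall n, Lm (a_ n)) -> (forall n, Ld (b_ n)) ->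
  (forall n, Nm (fun x => f x - a_ n x) <= A / 4 ^+ n) ->
  (forall n, Nd (fun x => g x - b_ n x) <= B / 4 ^+ n) ->
  (fun n => \int[leb]_(x in I) `|a_ n x * b_ n x - f x * g x|) @ \oo --> 0.
Proof.
move=> Lf Lg La Lb NA NB.
have A0 : 0 <= A by have := le_trans (Nm_ge0 _) (NA 0%N); rewrite expr0 divr1.
have B0 : 0 <= B by have := le_trans (Nd_ge0 _) (NB 0%N); rewrite expr0 divr1.
have LA n := LmB Lf (La n); have LB n := LdB Lg (Lb n).
have c n := CS (LA n) (LB n); have cL1 n := CS (LA n) Lg; have c2 n := CS Lf (LB n).
have i0 h : 0 <= \int[leb]_(x in I) `|h x| by exact: Rintegral_ge0.
have l n : \int[leb]_(x in I) `|(f x - a_ n x) * (g x - b_ n x)| <= Num.sqrt (A * B) / 2 ^+ n.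
  apply: sqr_geo_le; [exact: i0|exact: mulr_ge0|].
  apply: (le_trans (c n).2); apply: geo_mul_le => //; [exact: Nm_ge0|exact: Nd_ge0].
have l1 n : \int[leb]_(x in I) `|(f x - a_ n x) * g x| <= Num.sqrt (A * Nd g) / 2 ^+ n.
  apply: sqr_geo_le; [exact: i0|by rewrite mulr_ge0 ?Nd_ge0|].
  by apply: (le_trans (cL1 n).2); rewrite mulrAC; apply: ler_wpM2r => //; exact: Nd_ge0.
have l2 n : \int[leb]_(x in I) `|f x * (g x - b_ n x)| <= Num.sqrt (Nm f * B) / 2 ^+ n.
  apply: sqr_geo_le; [exact: i0|by rewrite mulr_ge0 ?Nm_ge0|].
  by apply: (le_trans (c2 n).2); rewrite -[leRHS]mulrA; apply: ler_wpM2l => //; exact: Nm_ge0.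
apply: (@squeeze0 _ _ (Num.sqrt (A * B) + Num.sqrt (A * Nd g) + Num.sqrt (Nm f * B))) => n; first exact: i0.
rewrite !mulrDl; apply: (le_trans _ (lerD (lerD (l n) (l1 n)) (l2 n))).
have I1 := L1_abs (c n).1; have I2 := L1_abs (cL1 n).1; have I3 := L1_abs (c2 n).1.
rewrite -iD// -iD//; last exact: LID.
apply: i_le; [|by apply: LID => //; exact: LID|].
  by apply/L1_abs/LIB; [exact: (CS (La n) (Lb n)).1|exact: (CS Lf Lg).1].
move=> x _.
rewrite (_ : _ - _ = (f x - a_ n x) * (g x - b_ n x) - (f x - a_ n x) * g x - f x * (g x - b_ n x)); last by ring.
by apply: (le_trans (ler_normB _ _)); apply: lerD => //; exact: ler_normB.
Qed.

Section Limit.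
Variables (f F g G : R -> R).
Hypotheses (Lf : Lm f) (fF : isV f F) (Lg : Ld g) (gG : isV g G).

(** Each product pairs a factor converging in L^2(w) with one converging in L^2(1/w); the two bounds
    of V are what makes the transforms converge in the right space. *)
Lemma holder_limits : exists p P0 q Q0, [/\ forall n, (exists L, holder L (p n)) /\ (exists L, holder L (q n)),
  forall n, goodV (p n) (P0 n) /\ goodV (q n) (Q0 n),
  forall x y, 0 < y -> ((fun n => Q y (p n) x) @ \oo --> Q y f x /\ (fun n => P y (p n) x) @ \oo --> P y f x) /\
    ((fun n => Q y (q n) x) @ \oo --> Q y g x /\ (fun n => P y (q n) x) @ \oo --> P y g x),
  (fun n => \int[leb]_(x in I) `|p n x * Q0 n x - f x * G x|) @ \oo --> 0 &
  (fun n => \int[leb]_(x in I) `|P0 n x * q n x - F x * g x|) @ \oo --> 0].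
Proof.
have [p [hp Lp Np]] := fastapp (@wt_gt0 R) (LI_wt R) Lf ltr01.
have [q [hq Lq Nq]] := fastapp (@wi_gt0 R) (LI_wi R) Lg ltr01.
have hP n : exists G, goodV (p n) G by have [M hM] := hp n; exact: holder_goodV hM.
have hQ n : exists G, goodV (q n) G by have [M hM] := hq n; exact: holder_goodV hM.
have [P0 gP] := choice hP; have [Q0 gQ] := choice hQ.
have Lmp n : Lm (p n) by have [M hM] := hp n; exact: holderMeas (@wt_gt0 R) (LI_wt R) hM.
have Ldq n : Ld (q n) by have [M hM] := hq n; exact: holderMeas (@wi_gt0 R) (LI_wi R) hM.
have LP n := (isV_Lm (Lmp n) (goodV_isV (gP n))).1.
have LQ n := (isV_Ld (Ldq n) (goodV_isV (gQ n))).1.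
have LF := (isV_Lm Lf fF).1; have LG := (isV_Ld Lg gG).1.
have cV0 := cV_gt0 R.
exists p, P0, q, Q0; split=> //.
- move=> x y y0; have c (h_ : (R -> R)^nat) h : Lm h -> (forall n, Lm (h_ n)) ->
    (forall n, Nm (fun x => h x - h_ n x) <= 1 / 4 ^+ n) ->
    (fun n => Q y (h_ n) x) @ \oo --> Q y h x /\ (fun n => P y (h_ n) x) @ \oo --> P y h x.
    move=> Lh Lhn N; apply: Q_L1_cvg => //; [move=> n; exact: (Lm1 (Lhn n)).1|exact: (Lm1 Lh).1|].
    apply: (@squeeze0 _ _ (Num.sqrt (1 * pi))) => n; first exact: Rintegral_ge0.
    apply: sqr_geo_le; [exact: Rintegral_ge0|by rewrite mul1r pi_ge0|].
    under eq_Rintegral do rewrite distrC.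
    apply: (le_trans (Lm1 (LmB Lh (Lhn n))).2); rewrite mulrAC; apply: ler_wpM2r => //; exact: pi_ge0.
  split; apply: c => //; first exact: (Ld_Lm Lg).1.
    by move=> n; exact: (Ld_Lm (Ldq n)).1.
  by move=> n; apply: (le_trans _ (Nq n)); exact: (Ld_Lm (Lq n)).2.
- apply: (@pair_cvg p Q0 f G 1 (4 * cV)) => // n.
  have := isVB (Lm1 (Ld_Lm Lg).1).1 (Lm1 (Ld_Lm (Ldq n)).1).1 gG (goodV_isV (gQ n)).
  move=> /(isV_Ld (Lq n))[_]/le_trans; apply; rewrite -(mulr1 (4 * cV)) -[leRHS]mulrA mulr1.
  by apply: ler_wpM2l; [rewrite mulr_ge0 ?(ltW cV0)|exact: Nq].
- apply: (@pair_cvg P0 q F g cV 1) => // n.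
  apply: (le_trans (V_Lm_B Lf (Lmp n) fF (goodV_isV (gP n)) LF (LP n))).
  by apply: ler_wpM2l; [exact: ltW|rewrite -(mul1r _^-1); exact: Np].
Qed.

Lemma L1_FG : L1 I (fun x => f x * G x) /\ L1 I (fun x => F x * g x).
Proof.
have LF := (isV_Lm Lf fF).1; have LG := (isV_Ld Lg gG).1.
by split; [exact: (CS Lf LG).1|exact: (CS LF Lg).1].
Qed.

(** The order of the limits matters: the approximation is removed at a fixed height, where Q and P
    are continuous for the L^1 norm, and only then does y tend to 0, at common Lebesgue points of f
    and g. *)
Lemma tricomi : isV (fun x => f x * G x + F x * g x) (fun x => F x * G x - pi ^+ 2 * (f x * g x)).
Proof.
have [p [P0 [q [Q0 [h12 gV cQP cL1 c2]]]]] := holder_limits; have [I1 I2] := L1_FG.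
have Ip n : L1 I (p n) by have [[L hL] _] := h12 n; exact: holder_L1 hL.
have Iq n : L1 I (q n) by have [_ [L hL]] := h12 n; exact: holder_L1 hL.
have IpQ n : L1 I (fun x => p n x * Q0 n x) by exact: goodV_LM (gV n).2 (Ip n).
have IPq n : L1 I (fun x => P0 n x * q n x).
  by apply: LI_eq (goodV_LM (gV n).1 (Iq n)) => x _; rewrite mulrC.
pose k x := f x * G x + F x * g x.
have Ik : L1 I k by exact: LID.
have ck : (fun n => \int[leb]_(x in I) `|p n x * Q0 n x + P0 n x * q n x - k x|) @ \oo --> 0.
  have c12 : (fun n => \int[leb]_(x in I) `|p n x * Q0 n x - f x * G x| +
      \int[leb]_(x in I) `|P0 n x * q n x - F x * g x|) @ \oo --> (0 : R).
    by rewrite -(addr0 0); exact: cvgD.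
  apply: squeeze_0 c12 => n; first exact: Rintegral_ge0.
  have A1 : L1 I (fun x => `|p n x * Q0 n x - f x * G x|) by apply/L1_abs/LIB.
  have A2 : L1 I (fun x => `|P0 n x * q n x - F x * g x|) by apply/L1_abs/LIB.
  rewrite -iD//; apply: i_le; [by apply/L1_abs/LIB => //; exact: LID|exact: LID|].
  move=> x _; rewrite /k opprD addrACA; exact: ler_normD.
have ER x y : 0 < y -> Q y f x * Q y g x - P y f x * P y g x = Q y k x.
  move=> y0; have [[cQf cPf] [cQg cPg]] := cQP x y y0.
  have [cR _] := Q_L1_cvg x y0 (fun n => LID (IpQ n) (IPq n)) Ik ck.
  apply: (cvg_seq_eq _ (cvgB (cvgM cQf cQg) (cvgM cPf cPg)) cR) => n.
  have [[L hL] [M hM]] := h12 n.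
  rewrite /= !fctE (prodR x hL hM (gV n).1 (gV n).2 y0).
  by congr (Q y _ x); apply/funext => z; rewrite [X in _ + X]mulrC.
have If := (Lm1 Lf).1; have Ig := (Lm1 (Ld_Lm Lg).1).1.
split.
  apply: measurable_funB; first by apply: measurable_funM; [exact: fF.1|exact: gG.1].
  by apply: measurable_funM => //; apply: measurable_funM; [exact: Lf.1|exact: Lg.1].
have ae2 := ae_and (lebp_ae If) (lebp_ae Ig).
apply: ae_imply2 ae2 (ae_and fF.2 gG.2) => x [lf lg] [cF cG] Ix.
have -> : F x * G x - pi ^+ 2 * (f x * g x) = F x * G x - pi * f x * (pi * g x) by ring.
apply: (cvg_right_ext _ (cvgB (cvgM (cF Ix) (cG Ix)) (cvgM (P_cvg If Ix (lf Ix)) (P_cvg Ig Ix (lg Ix))))).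
by move=> y y0; rewrite -ER.
Qed.

End Limit.
End Tricomi.

Local Open Scope complex_scope.

(** * Complex-valued functions *)

Section ComplexV.
Variable R : realType.
Local Notation leb := (@lebesgue_measure R).
Local Notation I := (@unit_itv R).
Local Notation w := (@wt R).
Local Notation Lm := (Lr (@wt R)).
Local Notation Nm := (Nr (@wt R)).
Local Notation Ld := (Lr (fun x : R => (@wt R x)^-1)).
Local Notation Nd := (Nr (fun x : R => (@wt R x)^-1)).
Local Notation cV_ := (cV R).
Local Notation re := (@complex.Re R).
Local Notation im := (@complex.Im R).

(** V f exists as some h in L^2(w). By the bound of V, both h and g are within a multiple of d n of
    [g_ n] in norm, so they agree almost everywhere. *)
Lemma isV_unif (f g : R -> R) (f_ g_ : (R -> R)^nat) (M : R) (d : R^nat) :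
  (forall n, measurable_fun I (f_ n)) -> measurable_fun I f -> measurable_fun I g ->
  (forall x, I x -> `|f x| <= M) -> (forall x, I x -> `|g x| <= M) ->
  (forall n, isV (f_ n) (g_ n)) ->
  (forall n x, I x -> `|f_ n x - f x| <= d n) -> (forall n x, I x -> `|g_ n x - g x| <= d n) ->
  d @ \oo --> 0 -> isV f g.
Proof.
move=> mf_ mf mg fM gM Vn fd gd d0.
have Lf := bnd_Lm mf fM; have Lg := bnd_Lm mg gM.
have bn n x : I x -> `|f_ n x| <= M + d n.
  move=> Ix; rewrite -[f_ n x](subrK (f x)) addrC; apply: (le_trans (ler_normD _ _)).
  by apply: lerD; [exact: fM|exact: fd].
have Ln n := bnd_Lm (mf_ n) (bn n); have Lgn n := (isV_Lm (Ln n) (Vn n)).1.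
have [h [Vh Lh Nh]] := V_Lm Lf.
have w0 := @wt_gt0 R; have Iw := LI_wt R.
pose W := \int[leb]_(x in I) w x.
have W0 : 0 <= W by apply: Rintegral_ge0 => x _; exact: wt_ge0.
have Nbnd (q : R -> R) (c : R) : Lm q -> (forall x, I x -> `|q x| <= c) -> Nm q <= c ^+ 2 * W.
  move=> Lq qc; rewrite /W -iZ//; apply: i_le; [exact: Lq.2|exact: LIZ|].
  move=> x Ix; rewrite mulrC; apply: ler_wpM2r; first exact: wt_ge0.
  rewrite -[leLHS]real_normK ?num_real//; apply: lerXn2r; rewrite ?nnegrE ?qc//.
  exact: le_trans (qc x Ix).
have key n : Nm (fun x => h x - g x) <= (2 * cV_ + 2) * W * (d n * d n).
  have [_] := LrB w0 Iw (LmB Lh (Lgn n)) (LmB Lg (Lgn n)).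
  have -> : (fun x => h x - g_ n x - (g x - g_ n x)) = (fun x => h x - g x).
    by apply/funext => x; ring.
  move/le_trans; apply.
  have a1 := V_Lm_B Lf (Ln n) Vh (Vn n) Lh (Lgn n).
  have a2 : Nm (fun x => f x - f_ n x) <= d n ^+ 2 * W.
    by apply: Nbnd; [exact: LmB|move=> x Ix; rewrite distrC; exact: fd].
  have a3 : Nm (fun x => g x - g_ n x) <= d n ^+ 2 * W.
    by apply: Nbnd; [exact: LmB|move=> x Ix; rewrite distrC; exact: gd].
  have a4 := ler_wpM2l (ltW (cV_gt0 R)) a2.
  have {a1 a4}a5 := le_trans a1 a4.
  rewrite expr2 in a3 a5; lra.
have N0 : Nm (fun x => h x - g x) <= 0.
  apply: le_lim0 key _; rewrite -(mulr0 ((2 * cV_ + 2) * W)).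
  by apply: cvgM; [exact: cvg_cst|rewrite -(mulr0 0); exact: cvgM].
have := int_le0_ae mI (LmB Lh Lg).2 _ N0; move=> E.
have {}E : {ae leb, forall x, I x -> h x = g x}.
  apply: ae_imply (E _) => [x + Ix|x Ix]; last by rewrite mulr_ge0 ?wt_ge0 ?sqr_ge0.
  move=> /(_ Ix)/eqP; rewrite mulf_eq0 gt_eqF ?w0//= expf_eq0/= subr_eq0.
  by move/eqP.
split=> //; apply: ae_imply2 E Vh.2 => x E V Ix; rewrite -(E Ix); exact: V.
Qed.

Lemma isV_ae f g h : measurable_fun I h -> {ae leb, forall x, I x -> g x = h x} ->
  isV f g -> isV f h.
Proof.
move=> meas_h E [mg V]; split=> //.
by apply: ae_imply2 E V => x E V Ix; rewrite -(E Ix); exact: V.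
Qed.

Lemma isV_eq (f g f' g' : R -> R) : (forall x, I x -> f x = f' x) -> (forall x, I x -> g x = g' x) ->
  isV f g -> isV f' g'.
Proof.
move=> ff gg [mg V]; split.
  by apply: eq_measurable_fun mg => x /set_mem; exact: gg.
apply: ae_imply V => x V Ix; rewrite -gg//.
apply: cvg_right_ext (V Ix) => y _; apply: eq_int => u Iu; by rewrite ff.
Qed.

Implicit Types (f g h a b c d F G : R -> R[i]) (x y t u : R) (k : R[i]).

Definition cre f : R -> R := fun x => re (f x).
Definition cim f : R -> R := fun x => im (f x).

Lemma reM (z1 z2 : R[i]) : re (z1 * z2) = re z1 * re z2 - im z1 * im z2.
Proof. by case: z1 z2 => [? ?] [? ?]. Qed.
Lemma imM (z1 z2 : R[i]) : im (z1 * z2) = re z1 * im z2 + im z1 * re z2.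
Proof. by case: z1 z2 => [? ?] [? ?]. Qed.
Lemma reD (z1 z2 : R[i]) : re (z1 + z2) = re z1 + re z2.
Proof. by case: z1 z2 => [? ?] [? ?]. Qed.
Lemma imD (z1 z2 : R[i]) : im (z1 + z2) = im z1 + im z2.
Proof. by case: z1 z2 => [? ?] [? ?]. Qed.
Lemma reN (z : R[i]) : re (- z) = - re z. Proof. by case: z. Qed.
Lemma imN (z : R[i]) : im (- z) = - im z. Proof. by case: z. Qed.
Definition reimE := (reM, imM, reD, imD, reN, imN).

Definition cL1 f := L1 I (cre f) /\ L1 I (cim f).
Definition cLm f := Lm (cre f) /\ Lm (cim f).
Definition cLd f := Ld (cre f) /\ Ld (cim f).
Definition isVc f g := isV (cre f) (cre g) /\ isV (cim f) (cim g).
Definition cB f := [/\ measurable_fun I (cre f), measurable_fun I (cim f) &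
  exists M, forall x, I x -> `|cre f x| <= M /\ `|cim f x| <= M].

Lemma creM f g : cre (fun x => f x * g x) = (fun x => cre f x * cre g x - cim f x * cim g x).
Proof. by apply/funext => x; rewrite /cre /cim reM. Qed.
Lemma cimM f g : cim (fun x => f x * g x) = (fun x => cre f x * cim g x + cim f x * cre g x).
Proof. by apply/funext => x; rewrite /cre /cim imM. Qed.
Lemma creD f g : cre (fun x => f x + g x) = (fun x => cre f x + cre g x).
Proof. by apply/funext => x; rewrite /cre /cim reD. Qed.
Lemma cimD f g : cim (fun x => f x + g x) = (fun x => cim f x + cim g x).
Proof. by apply/funext => x; rewrite /cre /cim imD. Qed.
Lemma creB f g : cre (fun x => f x - g x) = (fun x => cre f x - cre g x).
Proof. by apply/funext => x; rewrite /cre /cim reD reN. Qed.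
Lemma cimB f g : cim (fun x => f x - g x) = (fun x => cim f x - cim g x).
Proof. by apply/funext => x; rewrite /cre /cim imD imN. Qed.
Lemma creZ k f : cre (fun x => k * f x) = (fun x => re k * cre f x - im k * cim f x).
Proof. exact: creM. Qed.
Lemma cimZ k f : cim (fun x => k * f x) = (fun x => re k * cim f x + im k * cre f x).
Proof. exact: cimM. Qed.

Lemma cL1D f g : cL1 f -> cL1 g -> cL1 (fun x => f x + g x).
Proof. by move=> [A B] [C D]; rewrite /cL1 creD cimD; split; exact: LID. Qed.
Lemma cL1B f g : cL1 f -> cL1 g -> cL1 (fun x => f x - g x).
Proof. by move=> [A B] [C D]; rewrite /cL1 creB cimB; split; exact: LIB. Qed.
Lemma cL1Z k f : cL1 f -> cL1 (fun x => k * f x).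
Proof. by move=> [A B]; rewrite /cL1 creZ cimZ; split; [apply: LIB|apply: LID]; exact: LIZ. Qed.
Lemma cL1M f g : cL1 f -> cB g -> cL1 (fun x => f x * g x).
Proof.
move=> [A B] [m1 m2 [M hM]]; rewrite /cL1 creM cimM.
have b (h : R -> R) : L1 I h -> L1 I (fun x => h x * cre g x) /\ L1 I (fun x => h x * cim g x).
  by move=> Ih; split; apply: (LI_bndM (C := M)) => // x Ix; have [] := hM x Ix.
by split; [apply: LIB|apply: LID]; first [exact: (b _ A).1|exact: (b _ A).2|exact: (b _ B).1|exact: (b _ B).2].
Qed.

Lemma cBD f g : cB f -> cB g -> cB (fun x => f x + g x).
Proof.
move=> [a1 a2 [M hM]] [b1 b2 [N hN]]; rewrite /cB creD cimD; split.
- exact: measurable_funD.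
- exact: measurable_funD.
- exists (M + N) => x Ix; have [A B] := hM x Ix; have [C D] := hN x Ix.
  by split; apply: (le_trans (ler_normD _ _)); exact: lerD.
Qed.

Lemma cB_cst k : cB (fun=> k).
Proof.
split; [exact: measurable_cst|exact: measurable_cst|].
by exists (`|re k| + `|im k|) => x _; split; rewrite ?lerDl ?lerDr.
Qed.

Lemma cBM f g : cB f -> cB g -> cB (fun x => f x * g x).
Proof.
move=> [a1 a2 [M hM]] [b1 b2 [N hN]]; rewrite /cB creM cimM; split.
- by apply: measurable_funB; exact: measurable_funM.
- by apply: measurable_funD; exact: measurable_funM.
- exists (M * N + M * N) => x Ix; have [A B] := hM x Ix; have [C D] := hN x Ix.
  by split; [apply: (le_trans (ler_normB _ _))|apply: (le_trans (ler_normD _ _))]; apply: lerD; exact: normM_le.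
Qed.

Lemma cBN f : cB f -> cB (fun x => - f x).
Proof.
by move=> Bf; have := cBM (cB_cst (-1)) Bf; congr cB; apply/funext => x; rewrite mulN1r.
Qed.

Lemma cBB f g : cB f -> cB g -> cB (fun x => f x - g x).
Proof. by move=> A B; apply: cBD => //; exact: cBN. Qed.

Lemma cB_Ld f : cB f -> cLd f.
Proof. by move=> [a1 a2 [M hM]]; split; apply: (bnd_Ld (C := M)) => // x /hM[]. Qed.

Lemma cLd_Lm f : cLd f -> cLm f.
Proof. by move=> [A B]; split; [exact: (Ld_Lm A).1|exact: (Ld_Lm B).1]. Qed.

Lemma cLm_1 f : cLm f -> cL1 f.
Proof. by move=> [A B]; split; [exact: (Lm1 A).1|exact: (Lm1 B).1]. Qed.

Lemma Lr_bndM (r f g : R -> R) (M : R) : (forall x, I x -> 0 < r x) -> L1 I r -> Lr r f ->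
  measurable_fun I g -> (forall x, I x -> `|g x| <= M) -> Lr r (fun x => f x * g x).
Proof.
move=> r0 Ir [mf If] mg gM; split; first exact: measurable_funM.
apply: (LI_eq (f := fun x => (r x * f x ^+ 2) * g x ^+ 2)); first by move=> x _; ring.
apply: (LI_bndM (C := M ^+ 2)) => //; first exact: measurable_funX.
move=> x Ix; rewrite normrX; apply: lerXn2r; rewrite ?nnegrE ?gM//.
exact: le_trans (gM x Ix).
Qed.

Lemma LrD (r f g : R -> R) : (forall x, I x -> 0 < r x) -> L1 I r -> Lr r f -> Lr r g ->
  Lr r (fun x => f x + g x).
Proof.
move=> r0 Ir Lf Lg; have Lg' := (LrZ (-1) Lg).1.
have [] := LrB r0 Ir Lf Lg'.
have -> : (fun x => f x - -1 * g x) = (fun x => f x + g x) by apply/funext => x; rewrite mulN1r opprK.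
by [].
Qed.

Lemma cLmM f g : cLm f -> cB g -> cLm (fun x => f x * g x).
Proof.
move=> [A B] [m1 m2 [M hM]]; rewrite /cLm creM cimM; have w0 := @wt_gt0 R; have Iw := LI_wt R.
have b (h : R -> R) : Lm h -> Lm (fun x => h x * cre g x) /\ Lm (fun x => h x * cim g x).
  by move=> Lh; split; apply: (Lr_bndM (M := M)) => // x /hM[].
by split; [apply: LmB|apply: LrD => //]; first [exact: (b _ A).1|exact: (b _ A).2|exact: (b _ B).1|exact: (b _ B).2].
Qed.

Lemma cLdM f g : cLd f -> cB g -> cLd (fun x => f x * g x).
Proof.
move=> [A B] [m1 m2 [M hM]]; rewrite /cLd creM cimM; have w0 := @wi_gt0 R; have Iw := LI_wi R.
have b (h : R -> R) : Ld h -> Ld (fun x => h x * cre g x) /\ Ld (fun x => h x * cim g x).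
  by move=> Lh; split; apply: (Lr_bndM (M := M)) => // x /hM[].
by split; [apply: LdB|apply: LrD => //]; first [exact: (b _ A).1|exact: (b _ A).2|exact: (b _ B).1|exact: (b _ B).2].
Qed.

Lemma isVcD f g F G : cL1 f -> cL1 g -> isVc f F -> isVc g G ->
  isVc (fun x => f x + g x) (fun x => F x + G x).
Proof.
move=> [f1 f2] [g1 g2] [A B] [C D]; rewrite /isVc !creD !cimD.
by split; exact: isVD.
Qed.

Lemma isVcZ k f F : cL1 f -> isVc f F -> isVc (fun x => k * f x) (fun x => k * F x).
Proof.
move=> [f1 f2] [A B]; rewrite /isVc !creZ !cimZ; split.
  by apply: isVB; [exact: LIZ|exact: LIZ|exact: isVZ|exact: isVZ].
by apply: isVD; [exact: LIZ|exact: LIZ|exact: isVZ|exact: isVZ].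
Qed.

Lemma isVcB f g F G : cL1 f -> cL1 g -> isVc f F -> isVc g G ->
  isVc (fun x => f x - g x) (fun x => F x - G x).
Proof.
move=> [f1 f2] [g1 g2] [A B] [C D]; rewrite /isVc !creB !cimB.
by split; exact: isVB.
Qed.

Lemma isVc_eq f g f' g' : (forall x, I x -> f x = f' x) -> (forall x, I x -> g x = g' x) ->
  isVc f g -> isVc f' g'.
Proof.
move=> ff gg [A B]; split; [apply: isV_eq A|apply: isV_eq B] => x Ix;
  by rewrite /cre /cim ?ff ?gg.
Qed.

Lemma Vc_ex f : cLm f -> exists g, isVc f g.
Proof.
move=> [A B]; have [g1 [V1 _ _]] := V_Lm A; have [g2 [V2 _ _]] := V_Lm B.
by exists (fun x => g1 x +i* g2 x).
Qed.

Lemma isVc_Lm f F : cLm f -> isVc f F -> cLm F.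
Proof. by move=> [A B] [C D]; split; [exact: (isV_Lm A C).1|exact: (isV_Lm B D).1]. Qed.

Lemma isVc_Ld f F : cLd f -> isVc f F -> cLd F.
Proof. by move=> [A B] [C D]; split; [exact: (isV_Ld A C).1|exact: (isV_Ld B D).1]. Qed.

Lemma cCS f g : cLm f -> cLd g -> cL1 (fun x => f x * g x).
Proof.
move=> [A B] [C D]; rewrite /cL1 creM cimM.
by split; [apply: LIB|apply: LID]; apply: (CS _ _).1.
Qed.

Lemma L1_FGc f F g G : cLm f -> isVc f F -> cLd g -> isVc g G ->
  cL1 (fun x => f x * G x) /\ cL1 (fun x => F x * g x).
Proof. by move=> A B C D; split; apply: cCS => //; [exact: isVc_Ld D|exact: isVc_Lm B]. Qed.

(** Both sides are bilinear: the pairs of like components make up the real part, the mixed pairs the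
    imaginary part. *)
Lemma tricomic f F g G : cLm f -> isVc f F -> cLd g -> isVc g G ->
  isVc (fun x => f x * G x + F x * g x) (fun x => F x * G x - (pi ^+ 2)%:C * (f x * g x)).
Proof.
move=> [f1 f2] [F1 F2] [g1 g2] [G1 G2].
have [a1 a2] := L1_FG f1 F1 g1 G1; have [b1 b2] := L1_FG f2 F2 g2 G2.
have [cL1 c2] := L1_FG f1 F1 g2 G2; have [d1 d2] := L1_FG f2 F2 g1 G1.
split.
- apply: isV_eq (isVB (LID a1 a2) (LID b1 b2) (tricomi f1 F1 g1 G1) (tricomi f2 F2 g2 G2));
    by move=> x _; rewrite /cre /cim !reimE /=; ring.
- apply: isV_eq (isVD (LID cL1 c2) (LID d1 d2) (tricomi f1 F1 g2 G2) (tricomi f2 F2 g1 G1));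
    by move=> x _; rewrite /cre /cim !reimE /=; ring.
Qed.

End ComplexV.

(** * The complex exponential *)

Section ComplexExp.
Variable R : realType.
Local Notation re := (@complex.Re R).
Local Notation im := (@complex.Im R).
Implicit Types (x y t u a b A B : R) (z k q m : R[i]).

Lemma cplx_eq z k : re z = re k -> im z = im k -> z = k.
Proof. by case: z k => [? ?] [? ?] /= -> ->. Qed.

Lemma cexpD z k : cexp (z + k) = cexp z * cexp k.
Proof.
apply: cplx_eq; rewrite /cexp /= !reimE /= expRD ?cosD ?sinD; ring.
Qed.

Lemma cexp0 : cexp 0 = 1 :> R[i].
Proof. by apply: cplx_eq; rewrite /cexp /= expR0 ?cos0 ?sin0 ?mulr1 ?mulr0. Qed.

Lemma cexpNK z : cexp (- z) * cexp z = 1.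
Proof. by rewrite -cexpD addNr cexp0. Qed.

Lemma cosin2 z : ccos z * ccos z + csin z * csin z = 1.
Proof.
have i2 : 'i%C * 'i%C = -1 :> R[i] by apply: cplx_eq; rewrite !reimE /=; ring.
have := cexpNK ('i%C * z); rewrite /ccos /csin.
move: (cexp (- ('i%C * z))) (cexp ('i%C * z)) => p q pq.
have i0 : 'i%C != 0 :> R[i].
  by apply/eqP => i0; move: i2; rewrite i0 mul0r => /eqP; rewrite eq_sym oppr_eq0 oner_eq0.
move: ('i%C : R[i]) i2 i0 => j i2 i0.
have -> : (q + p) / 2 * ((q + p) / 2) + (q - p) / (2 * j) * ((q - p) / (2 * j)) =
  ((q + p) * (q + p) + (q - p) * (q - p) / (j * j)) / 4 by field.
rewrite i2 invrN1 mulrN1; transitivity (p * q) => //; by field.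
Qed.

(** Used in place of the modulus: it is real-valued, submultiplicative and bounds both
    components. *)
Definition norm1 z : R := `|re z| + `|im z|.

Lemma norm1_ge0 z : 0 <= norm1 z. Proof. by rewrite addr_ge0. Qed.

Lemma re_norm1 z : `|re z| <= norm1 z. Proof. by rewrite lerDl. Qed.

Lemma norm1M z k : norm1 (z * k) <= norm1 z * norm1 k.
Proof.
rewrite /norm1 reM imM; apply: (le_trans (lerD (ler_normB _ _) (ler_normD _ _))).
rewrite !normrM le_eqVlt; apply/orP; left; apply/eqP; ring.
Qed.

Lemma norm1X z (n : nat) : norm1 (z ^+ n) <= norm1 z ^+ n.
Proof.
elim: n => [|n IH]; first by rewrite !expr0 /norm1 /= normr1 normr0 addr0.
by rewrite !exprS; apply: (le_trans (norm1M _ _)); apply: ler_wpM2l => //; exact: norm1_ge0.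
Qed.

Lemma norm1_cexp z : norm1 (cexp z) <= 2 * expR `|re z|.
Proof.
rewrite /norm1 /cexp /= !normrM (ger0_norm (expR_ge0 _)) -mulrDr mulrC.
apply: ler_pM; rewrite ?addr_ge0 ?expR_ge0//.
  by rewrite -[2]/(1 + 1); apply: lerD; rewrite ler_norml ?cos_geN1 ?cos_le1 ?sin_geN1 ?sin_le1.
by rewrite ler_expR ler_norm.
Qed.

(** Induction on N for all n at once. The Taylor sum T and the bound h differentiate to those for n
    + 1 with one term less, so h - (f n - T) and h + (f n - T) vanish at 0 and have nonnegative
    derivatives. *)
Lemma taylor (f : nat -> R -> R) A B : (forall n x, is_derive x 1 (f n) (f n.+1 x)) ->
  (forall n t, 0 <= t <= 1 -> `|f n t| <= A * B ^+ n) ->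
  forall N n t, 0 <= t <= 1 ->
  `|f n t - \sum_(k < N) f (n + k)%N 0 * t ^+ k / k`!%:R| <= A * B ^+ (n + N) * t ^+ N / N`!%:R.
Proof.
move=> df bf; elim=> [|N IH] n t t01.
  by rewrite big_ord0 subr0 addn0 expr0 mulr1 fact0 divr1; exact: bf.
pose T x := \sum_(k < N.+1) f (n + k)%N 0 * x ^+ k / k`!%:R.
pose T' x := \sum_(k < N) f (n.+1 + k)%N 0 * x ^+ k / k`!%:R.
pose K := A * B ^+ (n + N.+1).
pose h x := K * x ^+ N.+1 / N.+1`!%:R.
pose h' x := K * x ^+ N / N`!%:R.
have dX' j x : is_derive x 1 (fun x : R => x ^+ j.+1) (j.+1%:R * x ^+ j).
  elim: j => [|j IHj].
    by apply: is_derive1_eq (dX x) _; rewrite expr0 mulr1.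
  have -> : (fun x : R => x ^+ j.+2) = (fun x : R => x * x ^+ j.+1) by apply/funext => y; rewrite exprS.
  by apply: is_derive1_eq (dM (dX x) IHj) _; rewrite exprS -[j.+2]addn1 -[j.+1]addn1 !natrD; ring.
have dpow c j x : is_derive x 1 (fun x => c * x ^+ j.+1 / j.+1`!%:R) (c * x ^+ j / j`!%:R).
  apply: is_derive1_eq (dM (dM (dC c x) (dX' j x)) (dC (j.+1`!%:R)^-1 x)) _.
  rewrite factS natrM; have : (j`!%:R : R) != 0 by rewrite pnatr_eq0 -lt0n fact_gt0.
  have : (j.+1%:R : R) != 0 by rewrite pnatr_eq0.
  move: (j`!%:R : R) (j.+1%:R : R) => p q ? ?; field; exact/andP.
have dT x : is_derive x 1 T (T' x).
  have dsum M : is_derive x 1 (fun x => \sum_(k < M) f (n.+1 + k)%N 0 * x ^+ k.+1 / k.+1`!%:R)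
      (\sum_(k < M) f (n.+1 + k)%N 0 * x ^+ k / k`!%:R).
    elim: M => [|M IHM].
      rewrite big_ord0; have -> : (fun x => \sum_(k < 0) f (n.+1 + k)%N 0 * x ^+ k.+1 / k.+1`!%:R) = (fun=> 0).
        by apply/funext => y; rewrite big_ord0.
      exact: dC.
    rewrite big_ord_recr; have -> : (fun x => \sum_(k < M.+1) f (n.+1 + k)%N 0 * x ^+ k.+1 / k.+1`!%:R) =
      (fun x => \sum_(k < M) f (n.+1 + k)%N 0 * x ^+ k.+1 / k.+1`!%:R + f (n.+1 + M)%N 0 * x ^+ M.+1 / M.+1`!%:R).
      by apply/funext => y; rewrite big_ord_recr.
    by apply: dD.
  have -> : T = (fun x => f n 0 + \sum_(k < N) f (n.+1 + k)%N 0 * x ^+ k.+1 / k.+1`!%:R).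
    apply/funext => y; rewrite /T big_ord_recl /= addn0 expr0 mulr1 fact0 divr1; congr (_ + _); apply: eq_bigr => i _.
    by have -> : bump 0 i = i.+1 by []; rewrite addnS addSn.
  by apply: (is_derive1_eq (dD (dC (f n 0) x) (dsum N))); rewrite add0r.
have dh x : is_derive x 1 h (h' x) by exact: dpow.
have [t0 t1] := andP t01.
have g0 : f n 0 - T 0 = 0.
  rewrite /T big_ord_recl /= addn0 expr0 mulr1 fact0 divr1 big1 ?addr0 ?subrr// => i _.
  by rewrite expr0n /= mulr0 mul0r.
have h0 : h 0 = 0 by rewrite /h expr0n /= mulr0 mul0r.
have [->|tn0] := eqVneq t 0.
  by rewrite -/(T 0) g0 normr0 -/(h 0) h0.
have tp : 0 < t by rewrite lt_neqAle eq_sym tn0.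
have mono (g g' : R -> R) : (forall x, is_derive x 1 g (g' x)) -> g 0 = 0 ->
    (forall x, 0 <= x <= 1 -> 0 <= g' x) -> 0 <= g t.
  move=> dg gz gp; have [|c ct E] := MVT tp (fun x _ => dg x).
    by apply: within_cont => x _; exact: dcont (dg x).
  move: E; rewrite gz !subr0 => ->; rewrite mulr_ge0 ?(ltW tp)// gp//.
  by move: ct; rewrite in_itv /= => /andP[/ltW -> /ltW/le_trans ->].
have bb x : 0 <= x <= 1 -> `|f n.+1 x - T' x| <= h' x.
  by move=> x01; apply: (le_trans (IH n.+1 x x01)); rewrite /h' /K addnS addSn.
have p1 : 0 <= h t - (f n t - T t).
  apply: (mono _ _ (fun x => dB (dh x) (dB (df n x) (dT x)))).
  - by rewrite h0 g0 subrr.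
  - by move=> x /bb; rewrite ler_norml subr_ge0 => /andP[].
have p2 : 0 <= h t + (f n t - T t).
  apply: (mono _ _ (fun x => dD (dh x) (dB (df n x) (dT x)))).
  - by rewrite h0 g0 addr0.
  - by move=> x /bb; rewrite ler_norml -lerNl -subr_ge0 opprK addrC => /andP[].
rewrite ler_norml; apply/andP; split; first by rewrite -subr_ge0 opprK addrC.
by rewrite -subr_ge0.
Qed.

Definition exp_sum N z : R[i] := \sum_(k < N) z ^+ k * (k`!%:R^-1)%:C.

Lemma re_sum N (F : 'I_N -> R[i]) : re (\sum_(k < N) F k) = \sum_(k < N) re (F k).
Proof. by apply: (big_morph re) => //; exact: reD. Qed.

Definition exp_tail N B : R := 2 * expR B * B ^+ N / N`!%:R.

(** [taylor] is applied to the real part of q z^n e^{t z} as a function of t. The factor q reaches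
    the real part with q = 1 and the imaginary part with q = -i. *)
Lemma cexp_qT q z N : norm1 q <= 1 -> `|re (q * (cexp z - exp_sum N z))| <= exp_tail N (norm1 z).
Proof.
move=> q1.
pose f n t := re (q * z ^+ n * cexp (t%:C * z)).
have df n x : is_derive x 1 (f n) (f n.+1 x).
  pose a := re z; pose b := im z; pose p := q * z ^+ n.
  have E1 y : re (y%:C * z) = y * a by rewrite reM /= mul0r subr0.
  have E2 y : im (y%:C * z) = y * b by rewrite imM /= mul0r addr0.
  have d1 c : is_derive x 1 (fun y => y * c) c.
    by apply: is_derive1_eq (dM (dX x) (dC c x)) _; rewrite mulr0 mulr1 add0r.
  have de := @dcomp _ (@expR R) (fun y => y * a) x _ _ (is_derive_expR _) (d1 a).
  have dc := @dcomp _ (@cos R) (fun y => y * b) x _ _ (is_derive_cos _) (d1 b).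
  have ds := @dcomp _ (@sin R) (fun y => y * b) x _ _ (is_derive_sin _) (d1 b).
  have -> : f n = (fun y => re p * (expR (y * a) * cos (y * b)) - im p * (expR (y * a) * sin (y * b))).
    by apply/funext => y; rewrite /f reM /cexp /= E1 E2.
  apply: is_derive1_eq (dB (dM (dC _ x) (dM de dc)) (dM (dC _ x) (dM de ds))) _.
  rewrite /f (_ : q * z ^+ n.+1 = p * z); last by rewrite exprSr mulrA.
  by rewrite reM /cexp /= E1 E2 reM imM -/a -/b; ring.
have bf n t' : 0 <= t' <= 1 -> `|f n t'| <= 2 * expR (norm1 z) * norm1 z ^+ n.
  move=> /andP[a0 a1]; apply: (le_trans (re_norm1 _)); apply: (le_trans (norm1M _ _)).
  rewrite mulrC; apply: ler_pM; rewrite ?norm1_ge0//.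
    apply: (le_trans (norm1_cexp _)); apply: ler_wpM2l => //; rewrite ler_expR reM /= mul0r subr0 normrM.
    by apply: (le_trans _ (re_norm1 z)); rewrite ler_piMl// ger0_norm.
  apply: (le_trans (norm1M _ _)); apply: (@le_trans _ _ (1 * norm1 z ^+ n)); last by rewrite mul1r.
  by apply: ler_pM; rewrite ?norm1_ge0 ?norm1X.
have := taylor df bf N 0%N (_ : 0 <= 1 <= 1); rewrite ler01 lexx => /(_ isT).
rewrite add0n expr1n mulr1.
have -> : f 0%N 1 - \sum_(k < N) f (0 + k)%N 0 * 1 ^+ k / k`!%:R = re (q * (cexp z - exp_sum N z)).
  rewrite mulrBr reD reN /exp_sum mulr_sumr re_sum /f expr0 mulr1 mul1r; congr (_ - _).
  apply: eq_bigr => i _; rewrite add0n mul0r cexp0 mulr1 expr1n mulr1.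
  by rewrite mulrA [in RHS]reM /= mulr0 subr0.
by [].
Qed.

Lemma cexp_T z N : `|re (cexp z - exp_sum N z)| <= exp_tail N (norm1 z) /\ `|im (cexp z - exp_sum N z)| <= exp_tail N (norm1 z).
Proof.
split.
  have := @cexp_qT 1 z N; rewrite mul1r; apply.
  by rewrite /norm1 /= normr1 normr0 addr0.
have := @cexp_qT (- 'i%C) z N; rewrite reM /= !oppr0 mul0r sub0r mulN1r opprK; apply.
by rewrite /norm1 /= oppr0 normrN normr1 normr0 add0r.
Qed.

Lemma exp_tail_mono N A B : 0 <= A -> A <= B -> exp_tail N A <= exp_tail N B.
Proof.
move=> A0 AB; have B0 := le_trans A0 AB; rewrite /exp_tail; apply: ler_wpM2r; first by rewrite invr_ge0 ler0n.
apply: ler_pM; rewrite ?mulr_ge0 ?expR_ge0 ?exprn_ge0//.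
  by apply: ler_wpM2l => //; rewrite ler_expR.
by apply: lerXn2r; rewrite ?nnegrE.
Qed.

Lemma exp_tail_cvg B : (fun N => exp_tail N B) @ \oo --> 0.
Proof.
rewrite /exp_tail; under eq_fun do rewrite -mulrA.
rewrite -(mulr0 (2 * expR B)); apply: cvgM; first exact: cvg_cst.
exact: (cvg_series_cvg_0 (is_cvg_series_exp_coeff B)).
Qed.

End ComplexExp.

(** * Explicit Hilbert transforms *)

Section Explicit.
Variable R : realType.
Local Notation leb := (@lebesgue_measure R).
Local Notation I := (@unit_itv R).
Local Notation w := (@wt R).
Local Notation re := (@complex.Re R).
Local Notation im := (@complex.Im R).
Implicit Types (f g h a b c d F G : R -> R[i]) (x y t u : R) (k m z q : R[i]).

Lemma cB_real (f : R -> R) (M : R) : measurable_fun I f -> (forall x, I x -> `|f x| <= M) ->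
  cB (fun x => (f x)%:C).
Proof.
move=> mf fM; split => //; first exact: measurable_cst.
exists M => x Ix; split; first exact: fM.
by rewrite /cim /= normr0 (le_trans _ (fM x Ix)).
Qed.

Lemma cB_x : cB (fun x => x%:C).
Proof.
by apply: (@cB_real _ 1) => // x /in_I /andP[p q]; rewrite ler_norml (ltW p) (ltW q).
Qed.

Lemma cB_w : cB (fun x => (w x)%:C).
Proof. by apply: (@cB_real _ 1); [exact: meas_wt|move=> x _; rewrite ger0_norm ?wt_ge0 ?wt_le1]. Qed.

Lemma cB_cexp f : cB f -> cB (fun x => cexp (f x)).
Proof.
move=> [m1 m2 [M hM]]; split.
- apply: measurable_funM; apply: measurableT_comp => //.
  by apply: continuous_measurable_fun; exact: continuous_cos.
- apply: measurable_funM; apply: measurableT_comp => //.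
  by apply: continuous_measurable_fun; exact: continuous_sin.
- exists (expR M * 1) => x Ix; have [A _] := hM x Ix.
  have eM : `|expR (cre f x)| <= expR M.
    by rewrite ger0_norm ?expR_ge0// ler_expR (le_trans _ A)// ler_norm.
  by split; apply: normM_le => //; rewrite ler_norml ?cos_geN1 ?cos_le1 ?sin_geN1 ?sin_le1.
Qed.

Lemma cB_eq f g : (forall x, f x = g x) -> cB f -> cB g.
Proof. by move=> /funext ->. Qed.

(* b + i a is then the boundary value of an analytic function vanishing at
   infinity, which is why such pairs multiply like complex numbers. *)
Definition cpair a b := [/\ cB a, cB b & isVc a (fun x => pi%:C * b x)].

Lemma cBZ k f : cB f -> cB (fun x => k * f x).
Proof. by move=> Bf; apply: cBM => //; exact: cB_cst. Qed.

Lemma cB_1 f : cB f -> cL1 f.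
Proof. by move=> Bf; apply/cLm_1/cLd_Lm/cB_Ld. Qed.

Lemma cpair_w : cpair (fun x => (w x)%:C) (fun x => x%:C).
Proof.
split; [exact: cB_w|exact: cB_x|split].
  apply: isV_eq (goodV_isV (V_wt R)) => x _ //; by rewrite /cre reM /= mul0r subr0.
apply: (isV_eq (f := fun=> 0) (g := fun=> 0)) => [x _|x _|]; rewrite /cim ?imM /= ?mulr0 ?mul0r ?addr0//.
split; first exact: measurable_cst.
apply: nearW => x Ix; apply: cvg_near_cst; apply: nearW => y.
by rewrite /Q (@eq_int _ _ _ (fun=> 0)) ?int0// => u _; rewrite mulr0.
Qed.

Lemma cpair_mul a b c d : cpair a b -> cpair c d ->
  cpair (fun x => a x * d x + b x * c x) (fun x => b x * d x - a x * c x).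
Proof.
move=> [Ba Bb Vab] [Bc Bd Vcd]; split.
- by apply: cBD; exact: cBM.
- by apply: cBB; exact: cBM.
have pi0 : (pi : R) != 0 by rewrite gt_eqF// pi_gt0.
have T := tricomic (cLd_Lm (cB_Ld Ba)) Vab (cB_Ld Bc) Vcd.
have B1 : cL1 (fun x => a x * (pi%:C * d x) + pi%:C * b x * c x).
  by apply: cB_1; apply: cBD; apply: cBM => //; exact: cBZ.
have := isVcZ (pi^-1)%:C B1 T.
have e : (pi^-1)%:C * pi%:C = 1 :> R[i].
  by apply: cplx_eq; rewrite ?reM ?imM /= ?mulr0 ?mul0r ?subr0 ?addr0 ?mulVf.
have e2 : (pi^+2)%:C = pi%:C * pi%:C :> R[i].
  by apply: cplx_eq; rewrite ?reM ?imM /= ?mulr0 ?mul0r ?subr0 ?addr0 ?expr2.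
apply: isVc_eq => x _; first by rewrite -[RHS]mul1r -e; ring.
by rewrite e2 -[RHS]mul1r -e; ring.
Qed.

(** For x = cos t with t in [0, pi] this is e^{i t}, so the real and imaginary parts of its powers
    are cos (n t) and sin (n t); [Zb] is the conjugate. *)
Definition Z x : R[i] := x +i* w x.
Definition Zb x : R[i] := x -i* w x.

Lemma norm1_Z x : I x -> norm1 (Z x) <= 2 /\ norm1 (Zb x) <= 2.
Proof.
move=> /in_I /andP[p q]; have : `|x| <= 1 by rewrite ler_norml (ltW p) (ltW q).
have : `|w x| <= 1 by rewrite ger0_norm ?wt_ge0 ?wt_le1.
by rewrite /norm1 /= normrN; split; lra.
Qed.

Lemma ZbX x n : re (Zb x ^+ n) = re (Z x ^+ n) /\ im (Zb x ^+ n) = - im (Z x ^+ n).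
Proof.
elim: n => [|n [A B]]; first by rewrite !expr0 /= oppr0.
by rewrite !exprS !reM !imM A B /=; split; ring.
Qed.

(** In the variable x = cos t, V maps sin (n t) to pi cos (n t), the Chebyshev polynomial. The
    powers start at 1: the power 0 would give the pair 0, 1, whereas V 0 = 0. *)
Lemma cpairX n : cpair (fun x => (im (Z x ^+ n.+1))%:C) (fun x => (re (Z x ^+ n.+1))%:C).
Proof.
elim: n => [|n IH].
  have -> : (fun x => (im (Z x ^+ 1))%:C) = (fun x => (w x)%:C) by apply/funext.
  have -> : (fun x => (re (Z x ^+ 1))%:C) = (fun x => x%:C) by apply/funext.
  exact: cpair_w.
have := cpair_mul IH cpair_w; congr cpair; apply/funext => x; rewrite [in RHS]exprSr.
  by apply: cplx_eq; rewrite !(reM, imM, reD, imD) /=; ring.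
by apply: cplx_eq; rewrite !(reM, imM, reD, imD, reN, imN) /=; ring.
Qed.

(* e^{m z} = Cf + i Sf for z = x + i w x; Sf and Cf are its imaginary and real
   parts only when m is real. *)
Definition Sf m x := csin (m * (w x)%:C) * cexp (m * x%:C).
Definition Cf m x := ccos (m * (w x)%:C) * cexp (m * x%:C).

Lemma i_i : 'i%C * 'i%C = -1 :> R[i].
Proof. by apply: cplx_eq; rewrite !(reM, imM, reN, imN) /=; ring. Qed.

Lemma i_neq0 : 'i%C != 0 :> R[i].
Proof.
apply/eqP => i0; have := i_i; rewrite i0 mul0r => /eqP.
by rewrite eq_sym oppr_eq0 oner_eq0.
Qed.

Lemma SCf m x : Sf m x = (cexp (m * Z x) - cexp (m * Zb x)) / (2 * 'i%C) /\
  Cf m x = (cexp (m * Z x) + cexp (m * Zb x)) / 2.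
Proof.
have -> : m * Z x = 'i%C * (m * (w x)%:C) + m * x%:C.
  by apply: cplx_eq; rewrite /Z !(reM, imM, reD, imD) /=; ring.
have -> : m * Zb x = - ('i%C * (m * (w x)%:C)) + m * x%:C.
  by apply: cplx_eq; rewrite /Zb !(reM, imM, reD, imD, reN, imN) /=; ring.
rewrite !cexpD /Sf /Cf /csin /ccos; split; ring.
Qed.

Lemma cB_SC m : cB (Sf m) /\ cB (Cf m).
Proof.
have BX f : cB f -> cB (fun x => cexp (m * f x)) by move=> Bf; apply/cB_cexp/cBZ.
have BZ : cB Z.
  apply: (cB_eq (f := fun x => x%:C + 'i%C * (w x)%:C)) => [x|].
    by apply: cplx_eq; rewrite !(reM, imM, reD, imD) /=; ring.
  by apply: cBD; [exact: cB_x|apply: cBZ; exact: cB_w].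
have BZb : cB Zb.
  apply: (cB_eq (f := fun x => x%:C - 'i%C * (w x)%:C)) => [x|].
    by apply: cplx_eq; rewrite !(reM, imM, reD, imD, reN, imN) /=; ring.
  by apply: cBB; [exact: cB_x|apply: cBZ; exact: cB_w].
split.
  apply: (cB_eq (f := fun x => (cexp (m * Z x) - cexp (m * Zb x)) * (2 * 'i%C)^-1)).
    by move=> x; rewrite (SCf m x).1.
  by apply: cBM; [apply: cBB; exact: BX|exact: cB_cst].
apply: (cB_eq (f := fun x => (cexp (m * Z x) + cexp (m * Zb x)) * 2^-1)).
  by move=> x; rewrite (SCf m x).2.
by apply: cBM; [apply: cBD; exact: BX|exact: cB_cst].
Qed.

Definition exp_term m n : R[i] := m ^+ n * (n`!%:R^-1)%:C.
Definition Sn m N x := \sum_(n < N) exp_term m n * (im (Z x ^+ n))%:C.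
Definition Cn m N x := \sum_(n < N) exp_term m n * (re (Z x ^+ n))%:C.

(** The term of order 0 contributes 1 to [Cn] and nothing to [Sn], hence the subtraction of 1. *)
Lemma V_Sn m N : [/\ cB (Sn m N.+1), cB (Cn m N.+1) & isVc (Sn m N.+1) (fun x => pi%:C * (Cn m N.+1 x - 1))].
Proof.
elim: N => [|N [B1 B2 V]].
  have -> : Sn m 1 = (fun=> 0) by apply/funext => x; rewrite /Sn big_ord_recr big_ord0 /= add0r mulr0.
  have -> : Cn m 1 = (fun=> 1).
    apply/funext => x; rewrite /Cn big_ord_recr big_ord0 /= add0r mulr1 /exp_term expr0 mul1r fact0 invr1.
    by apply: cplx_eq.
  split; [exact: cB_cst|exact: cB_cst|].
  have [_ _ V] := cpair_w; have := isVcZ 0 (cB_1 cB_w) V.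
  by apply: isVc_eq => x _; rewrite ?mul0r ?subrr ?mulr0.
have [A B VX] := cpairX N.
have -> : Sn m N.+2 = (fun x => Sn m N.+1 x + exp_term m N.+1 * (im (Z x ^+ N.+1))%:C).
  by apply/funext => x; rewrite /Sn big_ord_recr.
have -> : Cn m N.+2 = (fun x => Cn m N.+1 x + exp_term m N.+1 * (re (Z x ^+ N.+1))%:C).
  by apply/funext => x; rewrite /Cn big_ord_recr.
split; [by apply: cBD => //; exact: cBZ|by apply: cBD => //; exact: cBZ|].
have := isVcD (cB_1 B1) (cB_1 (cBZ (exp_term m N.+1) A)) V (isVcZ (exp_term m N.+1) (cB_1 A) VX).
by apply: isVc_eq => x _ //; ring.
Qed.

Lemma exp_sum_Z m N x : exp_sum N (m * Z x) - exp_sum N (m * Zb x) = 2 * 'i%C * Sn m N x /\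
  exp_sum N (m * Z x) + exp_sum N (m * Zb x) = 2 * Cn m N x.
Proof.
rewrite /exp_sum /Sn /Cn -sumrB -big_split /= !mulr_sumr; split; apply: eq_bigr => n _.
  rewrite !exprMn /exp_term -mulrBl -mulrBr.
  have -> : Z x ^+ n - Zb x ^+ n = 2 * 'i%C * (im (Z x ^+ n))%:C.
    move: (ZbX x n); move: (Z x ^+ n) (Zb x ^+ n) => p q [A B]; apply: cplx_eq; rewrite !(reM, imM, reD, imD, reN, imN) ?A ?B /=; ring.
  ring.
rewrite !exprMn /exp_term -mulrDl -mulrDr.
have -> : Z x ^+ n + Zb x ^+ n = 2 * (re (Z x ^+ n))%:C.
  move: (ZbX x n); move: (Z x ^+ n) (Zb x ^+ n) => p q [A B]; apply: cplx_eq; rewrite !(reM, imM, reD, imD, reN, imN) ?A ?B /=; ring.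
ring.
Qed.

Lemma abs_half_le (x y t a : R) : `|x| <= a -> `|y| <= a -> (t = (x + y) / 2 \/ t = (x - y) / 2) ->
  `|t| <= a /\ `|- t| <= a.
Proof.
rewrite normrN !ler_norml => /andP[? ?] /andP[? ?] [] ->; split; apply/andP; split; lra.
Qed.

Lemma re_im_half_le z q (a : R) : `|re z| <= a -> `|im z| <= a -> `|re q| <= a -> `|im q| <= a ->
  [/\ `|re ((-1/2)%:C * (- 'i%C) * (z - q))| <= a, `|im ((-1/2)%:C * (- 'i%C) * (z - q))| <= a,
  `|re ((-1/2)%:C * (z + q))| <= a & `|im ((-1/2)%:C * (z + q))| <= a].
Proof.
move=> h1 h2 h3 h4; split.
- have [_] := abs_half_le h2 h4 (or_intror erefl); congr (`|_| <= _).
  by rewrite !(reM, imM, reD, imD, reN, imN) /=; field.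
- have [+ _] := abs_half_le h1 h3 (or_intror erefl); congr (`|_| <= _).
  by rewrite !(reM, imM, reD, imD, reN, imN) /=; field.
- have [_] := abs_half_le h1 h3 (or_introl erefl); congr (`|_| <= _).
  by rewrite !(reM, imM, reD, imD, reN, imN) /=; field.
- have [_] := abs_half_le h2 h4 (or_introl erefl); congr (`|_| <= _).
  by rewrite !(reM, imM, reD, imD, reN, imN) /=; field.
Qed.

(** The errors are half the sum and half the difference, up to a factor of modulus 1, of the
    exponential remainders at m Z and m Zb. On I both points have [norm1] at most 2, which makes the
    bound uniform. *)
Lemma SC_unif m N x : I x -> let r := exp_tail N (norm1 m * 2) in
  [/\ `|re (Sn m N x - Sf m x)| <= r, `|im (Sn m N x - Sf m x)| <= r,
  `|re (Cn m N x - Cf m x)| <= r & `|im (Cn m N x - Cf m x)| <= r].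
Proof.
move=> Ix r; have [z1 z2] := norm1_Z Ix.
have M z : norm1 z <= 2 -> `|re (cexp (m * z) - exp_sum N (m * z))| <= r /\ `|im (cexp (m * z) - exp_sum N (m * z))| <= r.
  move=> z2'; have [A B] := cexp_T (m * z) N.
  have le : exp_tail N (norm1 (m * z)) <= r.
    apply: exp_tail_mono; first exact: norm1_ge0.
    by apply: (le_trans (norm1M _ _)); apply: ler_wpM2l => //; exact: norm1_ge0.
  by split; [exact: le_trans A le|exact: le_trans B le].
have [a1 a2] := M _ z1; have [b1 b2] := M _ z2.
set r1 := cexp (m * Z x) - exp_sum N (m * Z x) in a1 a2.
set r2 := cexp (m * Zb x) - exp_sum N (m * Zb x) in b1 b2.
have [T1 T2] := exp_sum_Z m N x.
have ES : Sn m N x - Sf m x = (-1/2) * (- 'i%C) * (r1 - r2).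
  rewrite (SCf m x).1; have i0 := i_neq0; have i2 := i_i.
  have -> : Sn m N x = (exp_sum N (m * Z x) - exp_sum N (m * Zb x)) / (2 * 'i%C).
    by rewrite T1; field.
  have -> : (2 * 'i%C)^-1 = (1/2) * (- 'i%C) :> R[i].
    rewrite invfM; congr (_ * _); first by rewrite mul1r.
    by apply: (mulfI i0); rewrite divff// mulrN i2 opprK.
  by rewrite /r1 /r2; ring.
have EC : Cn m N x - Cf m x = (-1/2) * (r1 + r2).
  rewrite (SCf m x).2.
  have -> : Cn m N x = (exp_sum N (m * Z x) + exp_sum N (m * Zb x)) / 2 by rewrite T2; field.
  by rewrite /r1 /r2; field.
have h2 : (-1/2 : R[i]) = (-1/2)%:C.
  by apply: (mulfI (_ : (2 : R[i]) != 0)) => //; apply: cplx_eq; rewrite !(reM, imM, reN, imN) /=; field.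
by rewrite ES EC h2; apply: re_im_half_le.
Qed.

Lemma V_S m : isVc (Sf m) (fun x => pi%:C * (Cf m x - 1)).
Proof.
have [[m1 m2 [M hM]] BC] := cB_SC m.
have [g1 g2 [M' hM']] := cBZ pi%:C (cBB BC (cB_cst 1)).
(* One sequence for both approximations: the second term covers the error of [Sn], the first that of
   pi times [Cn]. *)
pose d N := pi * exp_tail N.+1 (norm1 m * 2) + exp_tail N.+1 (norm1 m * 2).
have dc : d @ \oo --> 0.
  have c := exp_tail_cvg (norm1 m * 2); have {}c : (fun N => exp_tail N.+1 (norm1 m * 2)) @ \oo --> 0.
    by move: c; rewrite -(cvg_shiftS (fun N => exp_tail N (norm1 m * 2))).
  rewrite -(addr0 0) -[X in X + _](mulr0 pi); apply: cvgD => //.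
  by apply: cvgM => //; exact: cvg_cst.
have r0 N : 0 <= exp_tail N (norm1 m * 2).
  have B0 : 0 <= norm1 m * 2 by rewrite mulr_ge0 ?norm1_ge0.
  by rewrite /exp_tail mulr_ge0 ?invr_ge0 ?ler0n// mulr_ge0 ?exprn_ge0// mulr_ge0 ?expR_ge0.
have bS N x : I x -> `|cre (Sn m N.+1) x - cre (Sf m) x| <= d N /\ `|cim (Sn m N.+1) x - cim (Sf m) x| <= d N.
  move=> Ix; have [A B _ _] := SC_unif m N.+1 Ix; rewrite /cre /cim.
  have rd : exp_tail N.+1 (norm1 m * 2) <= d N by rewrite /d lerDr mulr_ge0 ?pi_ge0.
  by rewrite -reN -reD -imN -imD; split; [exact: le_trans A rd|exact: le_trans B rd].
have bC N x : I x -> `|cre (fun x => pi%:C * (Cn m N.+1 x - 1)) x - cre (fun x => pi%:C * (Cf m x - 1)) x| <= d N /\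
    `|cim (fun x => pi%:C * (Cn m N.+1 x - 1)) x - cim (fun x => pi%:C * (Cf m x - 1)) x| <= d N.
  move=> Ix; have [_ _ A B] := SC_unif m N.+1 Ix; rewrite /cre /cim.
  rewrite -reN -reD -imN -imD.
  have -> : pi%:C * (Cn m N.+1 x - 1) - pi%:C * (Cf m x - 1) = pi%:C * (Cn m N.+1 x - Cf m x) by ring.
  have rd : pi * exp_tail N.+1 (norm1 m * 2) <= d N by rewrite /d lerDl.
  rewrite reM imM /= !mul0r subr0 addr0 !normrM (ger0_norm (pi_ge0 R)).
  by split; apply: le_trans rd; apply: ler_wpM2l => //; exact: pi_ge0.
have SM x : I x -> `|cre (Sf m) x| <= M + M' /\ `|cim (Sf m) x| <= M + M'.
  move=> Ix; have [A B] := hM x Ix; have [C D] := hM' x Ix; split.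
    by rewrite -(addr0 `|_|) lerD// (le_trans _ C).
  by rewrite -(addr0 `|_|) lerD// (le_trans _ C).
have CM x : I x -> `|cre (fun x => pi%:C * (Cf m x - 1)) x| <= M + M' /\ `|cim (fun x => pi%:C * (Cf m x - 1)) x| <= M + M'.
  move=> Ix; have [A B] := hM x Ix; have [C D] := hM' x Ix; split.
    by rewrite -(add0r `|_|) lerD// (le_trans _ A).
  by rewrite -(add0r `|_|) lerD// (le_trans _ A).
split.
- apply: (isV_unif (f_ := fun N => cre (Sn m N.+1)) (g_ := fun N => cre (fun x => pi%:C * (Cn m N.+1 x - 1))) (M := M + M') (d := d)) => //.
  + by move=> n; have [[]] := V_Sn m n.
  + by move=> x /SM[].
  + by move=> x /CM[].
  + by move=> n; have [_ _ []] := V_Sn m n.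
  + by move=> n x /(bS n)[].
  + by move=> n x /(bC n)[].
- apply: (isV_unif (f_ := fun N => cim (Sn m N.+1)) (g_ := fun N => cim (fun x => pi%:C * (Cn m N.+1 x - 1))) (M := M + M') (d := d)) => //.
  + by move=> n; have [[]] := V_Sn m n.
  + by move=> x /SM[].
  + by move=> x /CM[].
  + by move=> n; have [_ _ []] := V_Sn m n.
  + by move=> n x /(bS n)[].
  + by move=> n x /(bC n)[].
Qed.

(** * Transforms of the weighted exponential kernels *)

Lemma V_X (f F : R -> R) : L1 I f -> isV f F ->
  isV (fun x => x * f x) (fun x => x * F x - \int[leb]_(u in I) f u).
Proof.
move=> If [mF V]; split.
  by apply: measurable_funB; [exact: measurable_funM|exact: measurable_cst].
apply: ae_imply V => x V Ix.
pose D y u := (x - u) * qk y (x - u) * f u.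
have Db y u : 0 < y -> `|(x - u) * qk y (x - u)| <= 1.
  move=> y0; rewrite /qk mulrA -expr2 normrM normfV (ger0_norm (sqr_ge0 _)) gtr0_norm ?den_gt0//.
  by rewrite ler_pdivrMr ?den_gt0// mul1r lerDl sqr_ge0.
have mD y : 0 < y -> measurable_fun I (fun u => (x - u) * qk y (x - u)).
  by move=> y0; apply: measurable_funM; [exact: meas_subr|exact: meas_qk].
have ID y : 0 < y -> L1 I (D y).
  move=> y0; apply: (LI_eq (f := fun u => f u * ((x - u) * qk y (x - u)))) => [u _|].
    by rewrite mulrC.
  by apply: (LI_bndM (C := 1)) => // [|u _]; [exact: mD|exact: Db].
have [_ cD] : L1 I f /\ (\int[leb]_(u in I) D y u) @[y --> 0^'+] --> \int[leb]_(u in I) f u.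
  apply: (@dct_right _ _ _ _ (fun u => `|f u|) mI).
  - by move=> y y0; exact: L1_meas (ID y y0).
  - exact: L1_meas.
  - apply: ae_imply (ae_neq x) => u ux Iu.
    have xu : x - u != 0 by rewrite subr_eq0 eq_sym.
    have : (x - u) * qk y (x - u) * f u @[y --> 0^'+] --> (x - u) * (x - u)^-1 * f u.
      apply: cvgM; last exact: cvg_cst.
      by apply: cvgM; [exact: cvg_cst|exact: qk_cvg].
    by rewrite divff// mul1r.
  - exact: L1_abs.
  - by move=> y u y0 _; rewrite normrM -[leRHS]mul1r; apply: ler_wpM2r => //; exact: Db.
apply: (cvg_right_ext _ (cvgB (cvgM (cvg_cst x) (V Ix)) cD)) => y y0 /=.
rewrite !fctE /Q -iZ; last exact: L1_qk.
rewrite -iB; [|by apply/LIZ/L1_qk|exact: ID].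
by apply: eq_int => u _; rewrite /D; ring.
Qed.

(** Since u = x - (x - u), commuting V with multiplication by the variable costs the integral of f:
    the factor x - u cancels the kernel in the limit. Unlike [V_mulX], this form asks only for
    integrability. *)
Lemma V_Xc f F : cL1 f -> isVc f F ->
  isVc (fun x => x%:C * f x) (fun x => x%:C * F x - cintegral I f).
Proof.
move=> [A B] [V1 V2]; split.
  apply: isV_eq (V_X A V1) => x _; first by rewrite /cre reM /= mul0r subr0.
  by rewrite /cre !(reD, reN, reM) /= mul0r subr0.
apply: isV_eq (V_X B V2) => x _; first by rewrite /cim imM /= mul0r addr0.
by rewrite /cim !(imD, imN, imM) /= mul0r addr0.
Qed.

(** [ftc_improper] is stated for nonnegative integrands, so (1 + u) / w is integrated and the
    integral of 1 / w subtracted. *)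
Lemma int_xinvw : L1 I (fun u : R => u / w u) /\ \int[leb]_(u in I) (u / w u) = 0.
Proof.
have I1 : L1 I (fun u : R => u / w u).
  apply: (LI_eq (f := fun u => (w u)^-1 * u)); first by move=> u _; rewrite mulrC.
  apply: (LI_bndM (C := 1)) => //; first exact: LI_wi.
  by move=> x /in_I /andP[p q]; rewrite ler_norml (ltW p) (ltW q).
split=> //.
have lt : -1 < 1 :> R by lra.
pose F (u : R) := arc u - w u.
have dF x : -1 < x < 1 -> is_derive x 1 F ((w x)^-1 - - x / w x).
  by move=> /in_I Ix; apply: dB; [exact: darc|exact: dwt].
have dF' x : -1 < x < 1 -> is_derive x 1 F ((1 + x) / w x).
  by move=> /dF h; apply: (is_derive1_eq h); rewrite mulNr opprK mulrDl mul1r.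
have := @ftc_improper R (-1) 1 (fun u => (1 + u) / w u) F lt.
have h1 : {in `](-1), 1[, continuous (fun u : R => (1 + u) / w u)}.
  move=> x; rewrite in_itv /= => /in_I Ix.
  apply: cvgM; first by apply: cvgD; [exact: cvg_cst|exact: cvg_id].
  by apply: cvgV; [rewrite gt_eqF// wt_gt0|exact: cont_wt].
have h2 x : -1 < x < 1 -> 0 <= (1 + x) / w x.
  by move=> /andP[a _]; rewrite divr_ge0 ?wt_ge0//; lra.
have h3 : {within `[(-1), 1], continuous F}.
  by apply: within_cont => x _; apply: cvgB; [exact: cont_arc|exact: cont_wt].
case/(_ h1 h2 h3 dF') => J1 E.
have E2 : \int[leb]_(u in I) ((1 + u) / w u) = pi.
  rewrite -[LHS]/(\int[leb]_(u in `](-1), 1[) ((1 + u) / w u)) E /F wt_end1 wt_endN1 arc1 arcN1; lra.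
have [Iw Ew] := int_invw R.
have -> : \int[leb]_(u in I) (u / w u) = \int[leb]_(u in I) ((1 + u) / w u - (w u)^-1).
  by apply: eq_int => u _; ring.
by rewrite iB// E2 Ew subrr.
Qed.

(* V (1/w) exists by [V_Lm]; since w = (1 - u^2) / w, it is determined by V w. *)
Lemma V_invw : isV (fun x => (w x)^-1) (fun=> 0).
Proof.
have Lw : Lr w (fun x => (w x)^-1).
  split; first exact: L1_meas (LI_wi R).
  apply: LI_eq (LI_wi R) => x Ix; have := wt_gt0 Ix => wx.
  by rewrite expr2 mulrA divff ?mul1r// gt_eqF.
have [G [VG _ _]] := V_Lm Lw.
have [I1 E1] := int_invw R; have [I2 E2] := int_xinvw.
have V1 := V_X I1 VG; have V2 := V_X I2 V1.
have I3 : L1 I (fun x => x * (x / w x)).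
  apply: (LI_eq (f := fun u => u / w u * u)); first by move=> u _; rewrite mulrC.
  apply: (LI_bndM (C := 1)) => //.
  by move=> x /in_I /andP[p q]; rewrite ler_norml (ltW p) (ltW q).
have Vw := isVB I1 I3 VG V2.
have {}Vw : isV w (fun x => G x - (x * (x * G x - pi) - 0)).
  apply: isV_eq Vw => x Ix; last by rewrite E1 E2.
  have wx := wt_gt0 Ix; have w2 := wt_sqrI Ix.
  rewrite mulrA -expr2 -{1}(mul1r (w x)^-1) -mulrBl -w2 expr2 -mulrA divff ?mulr1// gt_eqF//.
have E := isV_uniq Vw (goodV_isV (V_wt R)).
apply: isV_ae VG; first exact: measurable_cst.
apply: ae_imply E => x E Ix; have {}E := E Ix.
have w2 : 0 < 1 - x ^+ 2 by rewrite -wt_sqrI// exprn_gt0// wt_gt0.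
(* The value pi x of V w cancels against the term pi x that the integral of 1 / w contributes
   through [V_X]. *)
have : (1 - x ^+ 2) * G x = 0 by move: E; rewrite expr2; lra.
by move/eqP; rewrite mulf_eq0 gt_eqF//= => /eqP.
Qed.

Lemma isVc_real (f F : R -> R) : isV f F -> isVc (fun x => (f x)%:C) (fun x => (F x)%:C).
Proof.
move=> V; split; first exact: V.
split; first exact: measurable_cst.
apply: nearW => x Ix; apply: cvg_near_cst; apply: nearW => y.
by rewrite /Q (@eq_int _ _ _ (fun=> 0)) ?int0// => u _; rewrite mulr0.
Qed.

Lemma cLm_invw : cLm (fun x => ((w x)^-1)%:C).
Proof.
split; split; [exact: L1_meas (LI_wi R)| |exact: measurable_cst|].
  apply: LI_eq (LI_wi R) => x Ix; have := wt_gt0 Ix => wx.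
  by rewrite expr2 mulrA divff ?mul1r// gt_eqF.
by apply: (LI_eq (f := fun=> 0)) => [x _|]; [rewrite expr0n mulr0|exact: L1_cst].
Qed.

Lemma piV : (pi^-1)%:C * pi%:C = 1 :> R[i].
Proof.
have pi0 : (pi : R) != 0 by rewrite gt_eqF// pi_gt0.
by apply: cplx_eq; rewrite ?reM ?imM /= ?mulr0 ?mul0r ?subr0 ?addr0 ?mulVf.
Qed.

Lemma pi2 : (pi ^+ 2)%:C = pi%:C * pi%:C :> R[i].
Proof. by apply: cplx_eq; rewrite ?reM ?imM /= ?mulr0 ?mul0r ?subr0 ?addr0 ?expr2. Qed.

(** Tricomi's formula for 1 / w, whose transform vanishes, and [Sf] gives the transform of (Cf - 1)
    / w; adding V (1/w) = 0 removes the 1. *)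
Lemma V_Cinvw m : cLm (fun x => Cf m x * ((w x)^-1)%:C) /\
  isVc (fun x => Cf m x * ((w x)^-1)%:C) (fun x => - pi%:C * Sf m x * ((w x)^-1)%:C).
Proof.
have [BS BC] := cB_SC m; have Lw := cLm_invw; have Vw := isVc_real V_invw.
have LC : cLm (fun x => Cf m x * ((w x)^-1)%:C).
  have -> : (fun x => Cf m x * ((w x)^-1)%:C) = (fun x => ((w x)^-1)%:C * Cf m x) by apply/funext => x; rewrite mulrC.
  exact: cLmM.
split=> //; have [J1 J2] := L1_FGc Lw Vw (cB_Ld BS) (V_S m).
have T := tricomic Lw Vw (cB_Ld BS) (V_S m).
have := isVcD (cL1Z (pi^-1)%:C (cL1D J1 J2)) (cLm_1 Lw) (isVcZ (pi^-1)%:C (cL1D J1 J2) T) Vw.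
have e := piV; have e2 := pi2.
apply: isVc_eq => x _.
  rewrite mul0r addr0; transitivity (((pi^-1)%:C * pi%:C) * (((w x)^-1)%:C * (Cf m x - 1)) + ((w x)^-1)%:C); first ring.
  by rewrite e; ring.
rewrite e2 mul0r; transitivity (((pi^-1)%:C * pi%:C) * (- pi%:C * Sf m x * ((w x)^-1)%:C)); first ring.
by rewrite e mul1r.
Qed.

(* From the pair (w, x) times (Sf, Cf - 1), subtracting V (x Sf). *)
Lemma V_wC m : cB (fun x => (w x)%:C * Cf m x) /\ isVc (fun x => (w x)%:C * Cf m x)
  (fun x => pi%:C * x%:C - pi%:C * (w x)%:C * Sf m x + cintegral I (Sf m)).
Proof.
have [BS BC] := cB_SC m; split; first by apply: cBM => //; exact: cB_w.
have PS : cpair (Sf m) (fun x => Cf m x - 1) by split=> //; [exact: cBB BC (cB_cst 1)|exact: V_S].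
have [B1 _ V1] := cpair_mul cpair_w PS.
have V2 := V_Xc (cB_1 BS) (V_S m).
have Bx : cB (fun x => x%:C * Sf m x) by apply: cBM => //; exact: cB_x.
have [_ _ V3] := cpair_w.
have := isVcD (cL1B (cB_1 B1) (cB_1 Bx)) (cB_1 cB_w) (isVcB (cB_1 B1) (cB_1 Bx) V1 V2) V3.
by apply: isVc_eq => x _; ring.
Qed.

End Explicit.

(** * The cosh-weighted transform *)

Section Inversion.
Variable R : realType.
Local Notation leb := (@lebesgue_measure R).
Local Notation I := (@unit_itv R).
Local Notation w := (@wt R).
Local Notation re := (@complex.Re R).
Local Notation im := (@complex.Im R).
Implicit Types (f g h a b c d F G : R -> R[i]) (x y t u s e : R) (k m z q : R[i]).

Lemma cexp_pair m x : cexp (- m * x%:C) * cexp (m * x%:C) = 1.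
Proof. by rewrite mulNr cexpNK. Qed.

Lemma SC_neg m x : Sf (- m) x = - (csin (m * (w x)%:C) * cexp (- m * x%:C)) /\
  Cf (- m) x = ccos (m * (w x)%:C) * cexp (- m * x%:C).
Proof.
rewrite /Sf /Cf /csin /ccos !mulNr !mulrN !opprK; split; last by rewrite [X in X / 2]addrC.
by ring.
Qed.

Definition psi m f u := cexp (- m * u%:C) * f u.

Lemma cB_E m : cB (fun u : R => cexp (m * u%:C)).
Proof. by apply/cB_cexp/cBZ/cB_x. Qed.

Lemma psi_Lm m f : cLm f -> cLm (psi m f).
Proof.
move=> Lf; have -> : psi m f = (fun u => f u * cexp (- m * u%:C)) by apply/funext => u; rewrite /psi mulrC.
exact: cLmM Lf (cB_E _).
Qed.

Lemma psi_Ld m f : cLd f -> cLd (psi m f).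
Proof.
move=> Lf; have -> : psi m f = (fun u => f u * cexp (- m * u%:C)) by apply/funext => u; rewrite /psi mulrC.
exact: cLdM Lf (cB_E _).
Qed.

Section Formulas.
Variables (m : R[i]) (f Gp Gm : R -> R[i]).
Hypotheses (Lf : cLm f) (Vp : isVc (psi m f) Gp) (Vm : isVc (psi (- m) f) Gm).

Let p x := cexp (m * x%:C).
Let q x := cexp (- m * x%:C).
Let S x := csin (m * (w x)%:C).
Let C x := ccos (m * (w x)%:C).

(* The value of F at x when Gp, Gm are the transforms of e^{-m u} f, e^{m u} f. *)
Definition FHT_val x := (pi^-1)%:C * (1/2 * (p x * Gp x + q x * Gm x)).
(** The combination of the two transforms that occurs in V (F K) for all three kernels K and cancels
    in the final formulas. *)
Definition FHT_diff x := p x * Gp x - q x * Gm x.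

Let psip x : psi m f x = q x * f x. Proof. by []. Qed.
Let psim x : psi (- m) f x = p x * f x. Proof. by rewrite /psi opprK. Qed.
Let Sp x : Sf m x = S x * p x. Proof. by []. Qed.
Let Sm x : Sf (- m) x = - (S x * q x). Proof. by rewrite (SC_neg m x).1. Qed.
Let Cp x : Cf m x = C x * p x. Proof. by []. Qed.
Let Cm x : Cf (- m) x = C x * q x. Proof. by rewrite (SC_neg m x).2. Qed.
Let pq x : q x * p x = 1. Proof. exact: cexp_pair. Qed.

(** The formulas for m and - m are subtracted, because [Sf] changes sign under m -> - m while its
    cosine factor does not. The terms in C f cancel, and [V3] compensates for what the subtraction
    of 1 in [V_S] leaves behind. *)
Lemma V_sin : cL1 (fun x => FHT_val x * S x) /\
  isVc (fun x => FHT_val x * S x) (fun x => 1/2 * C x * FHT_diff x - pi%:C * (S x * f x)).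
Proof.
have Lp := psi_Lm m Lf; have Lm := psi_Lm (- m) Lf.
have [BS _] := cB_SC m; have [BS' _] := cB_SC (- m).
have T1 := tricomic Lp Vp (cB_Ld BS) (V_S m); have T2 := tricomic Lm Vm (cB_Ld BS') (V_S (- m)).
have [I1 I2] := L1_FGc Lp Vp (cB_Ld BS) (V_S m); have [J1 J2] := L1_FGc Lm Vm (cB_Ld BS') (V_S (- m)).
have V3 := isVcZ pi%:C (cL1B (cLm_1 Lp) (cLm_1 Lm)) (isVcB (cLm_1 Lp) (cLm_1 Lm) Vp Vm).
have K1 := cL1B (cL1D I1 I2) (cL1D J1 J2); have K3 := cL1Z pi%:C (cL1B (cLm_1 Lp) (cLm_1 Lm)).
have V4 := isVcB (cL1D I1 I2) (cL1D J1 J2) T1 T2.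
have V5 := isVcZ (1/2 * (pi^-1)%:C) (cL1D K1 K3) (isVcD K1 K3 V4 V3).
have K5 := cL1Z (1/2 * (pi^-1)%:C) (cL1D K1 K3).
have E x : 1/2 * (pi^-1)%:C * (psi m f x * (pi%:C * (Cf m x - 1)) + Gp x * Sf m x -
    (psi (- m) f x * (pi%:C * (Cf (- m) x - 1)) + Gm x * Sf (- m) x) +
    pi%:C * (psi m f x - psi (- m) f x)) = FHT_val x * S x.
  by rewrite psip psim Sp Sm Cp Cm /FHT_val; ring.
split; first by move: K5; congr cL1; apply/funext => x; rewrite E.
apply: isVc_eq V5 => x _; first by rewrite E.
rewrite pi2 psip psim Sp Sm Cp Cm.
transitivity (((pi^-1)%:C * pi%:C) * (1/2 * C x * FHT_diff x - pi%:C * (S x * f x) * (q x * p x))); last first.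
  by rewrite pq piV mul1r mulr1.
by rewrite /FHT_diff; move: (pi^-1)%:C => pv1; field.
Qed.

(** The kernel takes the place in L^2(w), so f has to lie in L^2(1/w). The formulas for m and - m
    are added, and the terms in S f cancel. *)
Lemma V_cosd : cLd f -> cL1 (fun x => FHT_val x * (C x * ((w x)^-1)%:C)) /\
  isVc (fun x => FHT_val x * (C x * ((w x)^-1)%:C))
    (fun x => - (1/2 * S x * FHT_diff x * ((w x)^-1)%:C) - pi%:C * (C x * f x * ((w x)^-1)%:C)).
Proof.
move=> Ldf; have Lp := psi_Ld m Ldf; have Lm := psi_Ld (- m) Ldf.
have [LC VC] := V_Cinvw m; have [LC' VC'] := V_Cinvw (- m).
have T1 := tricomic LC VC Lp Vp; have T2 := tricomic LC' VC' Lm Vm.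
have [I1 I2] := L1_FGc LC VC Lp Vp; have [J1 J2] := L1_FGc LC' VC' Lm Vm.
have K := cL1D (cL1D I1 I2) (cL1D J1 J2).
have V5 := isVcZ (1/2 * (pi^-1)%:C) K (isVcD (cL1D I1 I2) (cL1D J1 J2) T1 T2).
have K5 := cL1Z (1/2 * (pi^-1)%:C) K.
pose W x := ((w x)^-1)%:C : R[i].
have E x : 1/2 * (pi^-1)%:C * (Cf m x * W x * Gp x + - pi%:C * Sf m x * W x * psi m f x +
    (Cf (- m) x * W x * Gm x + - pi%:C * Sf (- m) x * W x * psi (- m) f x)) = FHT_val x * (C x * W x).
  by rewrite psip psim Sp Sm Cp Cm /FHT_val; ring.
split; first by move: K5; congr cL1; apply/funext => x; rewrite E.
apply: isVc_eq V5 => x _; first by rewrite E.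
rewrite pi2 psip psim Sp Sm Cp Cm -/(W x).
transitivity (((pi^-1)%:C * pi%:C) * (- (1/2 * S x * FHT_diff x * W x) - pi%:C * (C x * f x * W x) * (q x * p x))); last first.
  by rewrite pq piV mul1r mulr1.
by rewrite /FHT_diff; move: (pi^-1)%:C (W x) => pv1 W1; field.
Qed.

(** The transform in [V_wC] contains pi x and a constant, which produce multiples of x psi and psi.
    Subtracting the transforms of these removes them, and by [V_Xc] leaves the integrals of psi:
    this is the origin of the integral of cosh(mu u) f(u). *)
Lemma V_cosm : cL1 (fun x => FHT_val x * (C x * (w x)%:C)) /\
  isVc (fun x => FHT_val x * (C x * (w x)%:C))
    (fun x => - (1/2 * S x * FHT_diff x * (w x)%:C) - pi%:C * (C x * f x * (w x)%:C) +
      1/2 * (cintegral I (psi m f) + cintegral I (psi (- m) f))).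
Proof.
have Lp := psi_Lm m Lf; have Lm := psi_Lm (- m) Lf.
have [BC VC] := V_wC m; have [BC' VC'] := V_wC (- m).
have T1 := tricomic Lp Vp (cB_Ld BC) VC; have T2 := tricomic Lm Vm (cB_Ld BC') VC'.
have [I1 I2] := L1_FGc Lp Vp (cB_Ld BC) VC; have [J1 J2] := L1_FGc Lm Vm (cB_Ld BC') VC'.
have X1 := V_Xc (cLm_1 Lp) Vp; have X2 := V_Xc (cLm_1 Lm) Vm.
pose k1 := cintegral I (Sf m); pose k2 := cintegral I (Sf (- m)).
have cx g : cL1 g -> cL1 (fun x => x%:C * g x).
  by move=> Ig; have := cL1M Ig (cB_x R); congr cL1; apply/funext => x; rewrite mulrC.
have Y1 := isVcD (cL1Z pi%:C (cx _ (cLm_1 Lp))) (cL1Z k1 (cLm_1 Lp))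
  (isVcZ pi%:C (cx _ (cLm_1 Lp)) X1) (isVcZ k1 (cLm_1 Lp) Vp).
have Y2 := isVcD (cL1Z pi%:C (cx _ (cLm_1 Lm))) (cL1Z k2 (cLm_1 Lm))
  (isVcZ pi%:C (cx _ (cLm_1 Lm)) X2) (isVcZ k2 (cLm_1 Lm) Vm).
have A1 := cL1D (cL1Z pi%:C (cx _ (cLm_1 Lp))) (cL1Z k1 (cLm_1 Lp)).
have A2 := cL1D (cL1Z pi%:C (cx _ (cLm_1 Lm))) (cL1Z k2 (cLm_1 Lm)).
have U1 := isVcB (cL1D I1 I2) A1 T1 Y1; have U2 := isVcB (cL1D J1 J2) A2 T2 Y2.
have B1 := cL1B (cL1D I1 I2) A1; have B2 := cL1B (cL1D J1 J2) A2.
have V5 := isVcZ (1/2 * (pi^-1)%:C) (cL1D B1 B2) (isVcD B1 B2 U1 U2).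
have K5 := cL1Z (1/2 * (pi^-1)%:C) (cL1D B1 B2).
pose W x := (w x)%:C : R[i].
have E x : 1/2 * (pi^-1)%:C * (psi m f x * (pi%:C * x%:C - pi%:C * W x * Sf m x + k1) + Gp x * (W x * Cf m x)
     - (pi%:C * (x%:C * psi m f x) + k1 * psi m f x) +
    (psi (- m) f x * (pi%:C * x%:C - pi%:C * W x * Sf (- m) x + k2) + Gm x * (W x * Cf (- m) x)
     - (pi%:C * (x%:C * psi (- m) f x) + k2 * psi (- m) f x))) = FHT_val x * (C x * W x).
  by rewrite psip psim Sp Sm Cp Cm /FHT_val; ring.
split; first by move: K5; congr cL1; apply/funext => x; rewrite E.
apply: isVc_eq V5 => x _; first by rewrite E.
rewrite pi2 psip psim Sp Sm Cp Cm -/(W x) -/k1 -/k2.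
move: (cintegral I (psi m f)) (cintegral I (psi (- m) f)) => j1 j2.
transitivity (((pi^-1)%:C * pi%:C) * (- (1/2 * S x * FHT_diff x * W x) - pi%:C * (C x * f x * W x) * (q x * p x) + 1/2 * (j1 + j2))); last first.
  by rewrite pq piV mul1r mulr1.
by rewrite /FHT_diff; move: (pi^-1)%:C => pv1; field.
Qed.

End Formulas.

(** * From truncated integrals to principal values *)

Lemma HD e (f g : R -> R) x : 0 < e -> L1 I f -> L1 I g -> H e (fun u => f u + g u) x = H e f x + H e g x.
Proof.
move=> e0 If Ig; rewrite /H -iD.
- by apply: eq_int => u _; rewrite mulrDr.
- by apply: (LI_eq (f := fun u => f u * hk e (x - u))) => [u _|]; [rewrite mulrC|apply: (LI_bndM (C := e^-1)) => // [|u _]; [exact: meas_hk|exact: hk_bnd]].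
- by apply: (LI_eq (f := fun u => g u * hk e (x - u))) => [u _|]; [rewrite mulrC|apply: (LI_bndM (C := e^-1)) => // [|u _]; [exact: meas_hk|exact: hk_bnd]].
Qed.

Lemma L1_hk e (f : R -> R) x : 0 < e -> L1 I f -> L1 I (fun u => hk e (x - u) * f u).
Proof.
move=> e0 If; apply: (LI_eq (f := fun u => f u * hk e (x - u))) => [u _|]; first by rewrite mulrC.
by apply: (LI_bndM (C := e^-1)) => // [|u _]; [exact: meas_hk|exact: hk_bnd].
Qed.

Lemma HZ e (k : R) (f : R -> R) x : 0 < e -> L1 I f -> H e (fun u => k * f u) x = k * H e f x.
Proof.
move=> e0 If; rewrite /H -iZ; last exact: L1_hk.
by apply: eq_int => u _; rewrite mulrCA.
Qed.

Definition Dset x e : set R := [set s | I s /\ e < `|s - x|].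

Lemma mDset x e : measurable (Dset x e).
Proof.
rewrite (_ : Dset x e = I `&` ((fun s => `|s - x|) @^-1` `]e, +oo[)); last first.
  by apply/seteqP; split => s /=; rewrite in_itv /= andbT.
have mf : measurable_fun I (fun s => `|s - x|).
  by apply: measurableT_comp => //; exact: measurable_funB.
by apply: mf; [exact: mI|exact: measurable_itv].
Qed.

Lemma int_Dset e (f : R -> R) x : 0 < e ->
  \int[leb]_(u in Dset x e) (hk e (x - u) * f u) = H e f x.
Proof.
move=> e0; rewrite /H (@Rintegral_mkcond _ _ _ leb (Dset x e)) (@Rintegral_mkcond _ _ _ leb I).
apply: eq_int => u _; rewrite /patch.
case: ifPn => [/set_mem [Iu eu]|nD]; first by rewrite mem_set.
case: ifPn => // /set_mem Iu; rewrite /hk distrC; case: ifPn => // eu; last by rewrite mul0r.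
by case/negP: nD; apply/mem_set.
Qed.

Lemma invC (t : R) : (t%:C)^-1 = (t^-1)%:C :> R[i].
Proof. by rewrite fmorphV. Qed.

Lemma cvg_C (a_ b_ : R -> R) (a b : R) : a_ e @[e --> 0^'+] --> a -> b_ e @[e --> 0^'+] --> b ->
  ((a_ e +i* b_ e) : R[i]^o) @[e --> 0^'+] --> ((a +i* b) : R[i]^o).
Proof.
move=> ca cb; apply/cvgrPdist_lt => eps eps0.
have [e1 e2] : 0 < re eps /\ im eps = 0.
  by move: eps0; case: eps => er ei; rewrite ltcE /= => /andP[/eqP -> ?].
have cL1 : \forall e \near 0^'+, `|a - a_ e| < re eps / 2.
  by move/cvgrPdist_lt : ca; apply; rewrite divr_gt0.
have c2 : \forall e \near 0^'+, `|b - b_ e| < re eps / 2.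
  by move/cvgrPdist_lt : cb; apply; rewrite divr_gt0.
near=> e.
have h1 : `|a - a_ e| < re eps / 2 by near: e.
have h2 : `|b - b_ e| < re eps / 2 by near: e.
rewrite normc_def ltcE /= e2 eqxx /=.
apply: (le_lt_trans (@sqrt_le _ _ (`|a - a_ e| + `|b - b_ e|) _ _)); first exact: addr_ge0.
  rewrite [leRHS]sqrrD !real_normK ?num_real// lerD2r lerDl mulrn_wge0//; exact: mulr_ge0.
by lra.
Unshelve. all: by end_near. Qed.

Lemma has_pvE (k g : R -> R[i]) x (a b : R) : (forall u, I u -> k u = g u / (x - u)%:C) ->
  cL1 g -> H e (cre g) x @[e --> 0^'+] --> a -> H e (cim g) x @[e --> 0^'+] --> b ->
  has_pv k x /\ pv k x = a +i* b.
Proof.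
move=> kg [I1 I2] ca cb.
have rk e u : 0 < e -> Dset x e u -> re (k u) = hk e (x - u) * cre g u /\ im (k u) = hk e (x - u) * cim g u.
  move=> e0 [Iu eu]; rewrite kg// invC reM imM /= !mulr0 subr0 add0r /hk distrC eu.
  by rewrite ![_ * (_^-1)]mulrC; split=> //; ring.
have ci e : 0 < e -> cintegrable (Dset x e) k.
  move=> e0; split.
    apply: (@L1_eq _ _ (fun u => hk e (x - u) * cre g u) _ (mDset x e)) => [u Du|]; first by have [-> _] := rk e u e0 Du.
    by apply: (@L1S _ I) (L1_hk x e0 I1); [exact: mI|exact: mDset|move=> u []].
  apply: (@L1_eq _ _ (fun u => hk e (x - u) * cim g u) _ (mDset x e)) => [u Du|]; first by have [_ ->] := rk e u e0 Du.
  by apply: (@L1S _ I) (L1_hk x e0 I2); [exact: mI|exact: mDset|move=> u []].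
have E e : 0 < e -> pv_trunc k x e = (H e (cre g) x +i* H e (cim g) x).
  move=> e0; rewrite /pv_trunc /cintegral -!int_Dset//; congr (_ +i* _).
    by apply: eq_int => u Du; have [-> _] := rk e u e0 Du.
  by apply: eq_int => u Du; have [_ ->] := rk e u e0 Du.
have c : pv_trunc k x e @[e --> 0^'+] --> ((a +i* b) : R[i]^o).
  have cc := cvg_C ca cb.
  apply: cvg_trans cc; apply: near_eq_cvg; near=> e; rewrite E//.
split; first by split; [exact: ci|exact: (cvgP _ c)].
exact: (cvg_lim _ c).
Unshelve. all: by end_near. Qed.

(** At common Lebesgue points of both components the limits of [Q] become limits of truncated
    integrals. Quantifying over k lets the integrand be written in any form that agrees with it on
    I. *)
Lemma V_pv g F : cL1 g -> isVc g F -> {ae leb, forall x, I x ->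
  [/\ H e (cre g) x @[e --> 0^'+] --> re (F x), H e (cim g) x @[e --> 0^'+] --> im (F x) &
   forall k : R -> R[i], (forall u, I u -> k u = g u / (x - u)%:C) -> has_pv k x /\ pv k x = F x]}.
Proof.
move=> [I1 I2] [[_ V1] [_ V2]].
apply: ae_imply2 (ae_and V1 V2) (ae_and (lebp_ae I1) (lebp_ae I2)) => x [v1 v2] [l1 l2] Ix.
have h1 := Q_to_H I1 Ix (l1 Ix) (v1 Ix); have h2 := Q_to_H I2 Ix (l2 Ix) (v2 Ix).
split=> // k kg; have [A B] := has_pvE kg (conj I1 I2) h1 h2.
by split=> //; rewrite B; apply: cplx_eq.
Qed.

End Inversion.

(** * Measurability of the principal value *)

Section Measurability.
Variable R : realType.
Local Notation leb := (@lebesgue_measure R).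
Local Notation I := (@unit_itv R).
Local Notation w := (@wt R).
Local Notation re := (@complex.Re R).
Local Notation im := (@complex.Im R).
Implicit Types (f g h F G : R -> R[i]) (x y t u s e a b : R) (k m z : R[i]).

Lemma meas_forall_rat (S : rat -> set R) : (forall q, measurable (S q)) ->
  measurable [set s | forall q, S q s].
Proof.
move=> mS; rewrite -[X in measurable X]setCK; apply: measurableC.
rewrite (_ : ~` _ = \bigcup_(q : rat) ~` S q); last first.
  apply/seteqP; split => s /=; first by move/existsNP => [q nq]; exists q.
  by move=> [q _ nq] h; exact: nq.
by apply: countable_bigcupT_measurable => [|q]; [exact: countableP|exact: measurableC].
Qed.

(** * Measurability of the set where a one-sided limit exists *)

Section ConvergenceSet.
Variable A : R -> R -> R.
Hypotheses (mA : forall e, 0 < e -> measurable_fun I (A e))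
  (rcA : forall e s, 0 < e -> I s -> A (e + y) s @[y --> 0^'+] --> A e s).

Definition cvset : set R := [set s | I s /\ cvg (A e s @[e --> 0^'+])].

(* Right continuity in e reduces the Cauchy criterion to rational e, so that
   only countable operations are needed. *)
Definition cvS (i n : nat) (q : rat) : set R := [set s | I s /\
  (0 < (ratr q : R) < n.+1%:R^-1 -> `|A (ratr q) s - A n.+2%:R^-1 s| <= i.+1%:R^-1)].

Lemma invS_gt0 (n : nat) : 0 < n.+1%:R^-1 :> R. Proof. by rewrite invr_gt0 ltr0n. Qed.

Lemma meas_cvS i n q : measurable (cvS i n q).
Proof.
have [qb|nq] := boolP (0 < (ratr q : R) < n.+1%:R^-1).
  have [q0 _] := andP qb.
  have mf : measurable_fun I (fun s => `|A (ratr q) s - A n.+2%:R^-1 s|).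
    by apply: measurableT_comp => //; apply: measurable_funB; exact: mA.
  have -> : cvS i n q = I `&` (fun s => `|A (ratr q) s - A n.+2%:R^-1 s|) @^-1` `]-oo, i.+1%:R^-1].
    by apply/seteqP; split => s /=; rewrite in_itv /= => -[Is h]; split=> //; exact: h.
  by apply: mf; [exact: mI|exact: measurable_itv].
have -> : cvS i n q = I.
  by apply/seteqP; split => s /= => [[]//|Is]; split=> // h; rewrite h in nq.
exact: mI.
Qed.

(** Cauchy's criterion with the reference value at 1 / (n + 2), a point inside the window from 0 to
    1 / (n + 1). A real e of the window is approximated by rationals to its right, which right
    continuity allows. *)
Lemma cvsetE : cvset = [set s | forall i, exists n, forall q, cvS i n q s].
Proof.
apply/seteqP; split=> s.
  move=> [Is /cvg_ex[l cl]] i.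
  have c : \forall e \near 0^'+, `|l - A e s| < i.+1%:R^-1 / 2.
    by move/cvgrPdist_lt : cl; apply; rewrite divr_gt0.
  have [d /= d0 hd] := c.
  have hd' e : 0 < e -> e < d -> `|l - A e s| < i.+1%:R^-1 / 2.
    by move=> e0 ed; apply: hd => //=; rewrite sub0r normrN gtr0_norm.
  have [n nd] : exists n : nat, n.+1%:R^-1 < d.
    exists (Num.truncn d^-1); rewrite invf_plt ?posrE ?ltr0n//.
    by apply: truncnS_gt; rewrite invr_ge0 ltW.
  exists n => q; split=> // /andP[q0 qn].
  have h1 := hd' _ q0 (lt_trans qn nd).
  have n2 : n.+2%:R^-1 < d.
    by apply: le_lt_trans nd; rewrite lef_pV2 ?posrE ?ltr0n// ler_nat.
  have h2 := hd' _ (invS_gt0 n.+1) n2.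
  have -> : A (ratr q) s - A n.+2%:R^-1 s = (l - A n.+2%:R^-1 s) - (l - A (ratr q) s) by ring.
  by apply: (le_trans (ler_normB _ _)); rewrite [leRHS]splitr ltW// ltrD.
move=> h; have Is : I s by have [n /(_ 0)[]] := h 0%N.
split=> //; apply: cauchy_cvg; apply: cauchy_exP => eps eps0.
have [i ie] : exists i : nat, i.+1%:R^-1 < eps.
  exists (Num.truncn eps^-1); rewrite invf_plt ?posrE ?ltr0n//.
  by apply: truncnS_gt; rewrite invr_ge0 ltW.
have [n hn] := h i; exists (A n.+2%:R^-1 s).
have key e : 0 < e -> e < n.+1%:R^-1 -> `|A e s - A n.+2%:R^-1 s| <= i.+1%:R^-1.
  move=> e0 en; apply/ler_addgt0Pl => eta eta0.
  have c : \forall y \near 0^'+, `|A e s - A (e + y) s| < eta.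
    by have /cvgrPdist_lt := rcA e0 Is; apply.
  have [d /= d0 hd] := c.
  have md : e < Num.min (e + d) n.+1%:R^-1 by rewrite lt_min en ltrDl d0.
  have [q] := rat_in_itvoo md; rewrite in_itv /= lt_min => /andP[eq /andP[qd qn]].
  have [_] := hn q; rewrite (lt_trans e0 eq) qn => /(_ isT) h1.
  have h2 : `|A e s - A (ratr q) s| < eta.
    have := hd (ratr q - e); rewrite /= [e + _]addrC subrK; apply; last by rewrite subr_gt0.
    by rewrite sub0r normrN gtr0_norm ?subr_gt0// ltrBlDl.
  have -> : A e s - A n.+2%:R^-1 s = (A e s - A (ratr q) s) + (A (ratr q) s - A n.+2%:R^-1 s) by ring.
  by apply: (le_trans (ler_normD _ _)); apply: lerD => //; exact: ltW.
suff : \forall e \near 0^'+, ball (A n.+2%:R^-1 s) eps (A e s) by [].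
by near=> e; rewrite -ball_normE /= distrC; apply: le_lt_trans ie; apply: key => //.
Unshelve. all: by end_near. Qed.

Lemma meas_cvset : measurable cvset.
Proof.
rewrite cvsetE (_ : [set s | _] = \bigcap_i \bigcup_n [set s | forall q, cvS i n q s]).
  apply: bigcapT_measurable => i; apply: bigcupT_measurable => n.
  by apply: meas_forall_rat => q; exact: meas_cvS.
apply/seteqP; split => s /=.
  by move=> h i _; have [n hn] := h i; exists n.
by move=> h i; have [n _ hn] := h i Logic.I; exists n.
Qed.

Lemma meas_lim : measurable_fun cvset (fun s => lim (A e s @[e --> 0^'+])).
Proof.
apply: (@meas_right _ _ A) => [y y0|s [Is c]]; last exact: c.
by apply: (measurable_funS mI _ (mA y0)) => s [].
Qed.

End ConvergenceSet.

Lemma meas_H e (f : R -> R) : 0 < e -> L1 I f -> measurable_fun I (H e f).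
Proof.
move=> e0 If; apply: (@meas_param _ (fun x u => hk e (x - u)) e^-1) => //.
  exact: meas2_hk.
by move=> x u; exact: hk_bnd.
Qed.

(** The truncation condition is a strict inequality, so for a fixed u the kernel at level e + y
    coincides with the one at level e as soon as y is small. *)
Lemma right_cont_H e (f : R -> R) x : 0 < e -> L1 I f -> H (e + y) f x @[y --> 0^'+] --> H e f x.
Proof.
move=> e0 If.
have [] := @dct_right R I (fun y u => hk (e + y) (x - u) * f u) (fun u => hk e (x - u) * f u) (fun u => e^-1 * `|f u|) mI => //.
- by move=> y y0; apply: L1_meas; apply: L1_hk => //; rewrite addr_gt0.
- by apply: L1_meas; exact: L1_hk.
- apply: nearW => u Iu; apply: cvgM; last exact: cvg_cst.
  apply: cvg_near_cst; have [eu|ue] := ltP e `|x - u|.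
    near=> y; rewrite /hk eu ifT// addrC -ltrBrDr.
    near: y; apply: nbhs_right_lt; by rewrite subr_gt0.
  near=> y; rewrite /hk !ifN// -leNgt//.
  by apply: (le_trans ue); rewrite lerDl.
- by apply/LIZ/L1_abs.
- move=> y u y0 Iu; rewrite normrM; apply: ler_wpM2r => //.
  apply: (le_trans (hk_bnd _ _)); first by rewrite addr_gt0.
  by rewrite lef_pV2 ?posrE ?addr_gt0// lerDl ltW.
Unshelve. all: by end_near. Qed.

Lemma HB e (f g : R -> R) x : 0 < e -> L1 I f -> L1 I g ->
  H e (fun u => f u - g u) x = H e f x - H e g x.
Proof.
move=> e0 If Ig; have -> : (fun u => f u - g u) = (fun u => f u + -1 * g u).
  by apply/funext => u; rewrite mulN1r.
by rewrite HD ?HZ ?mulN1r//; exact: LIZ.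
Qed.

Lemma ReIm z : re z +i* im z = z. Proof. by case: z. Qed.

Definition Hc e g x : R[i] := H e (cre g) x +i* H e (cim g) x.

Lemma HcD e f g x : 0 < e -> cL1 f -> cL1 g -> Hc e (fun u => f u + g u) x = Hc e f x + Hc e g x.
Proof.
move=> e0 [f1 f2] [g1 g2]; rewrite /Hc creD cimD !HD//.
Qed.

Lemma HcZ e k g x : 0 < e -> cL1 g -> Hc e (fun u => k * g u) x = k * Hc e g x.
Proof.
move=> e0 [g1 g2]; rewrite /Hc creZ cimZ HB ?HD ?HZ//; try exact: LIZ.
by apply: cplx_eq; rewrite ?reM ?imM /=.
Qed.

Lemma cvg_C_re (T_ : R -> R[i]) (l : R[i]) : (T_ e : R[i]^o) @[e --> 0^'+] --> (l : R[i]^o) ->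
  re (T_ e) @[e --> 0^'+] --> re l /\ im (T_ e) @[e --> 0^'+] --> im l.
Proof.
move=> /cvgrPdist_lt c.
have key eps : 0 < eps -> \forall e \near 0^'+, `|re l - re (T_ e)| < eps /\ `|im l - im (T_ e)| < eps.
  move=> eps0; have e0 : 0 < eps%:C :> R[i] by rewrite ltcE /= eqxx.
  have := c _ e0; apply: filterS => e.
  rewrite normc_def ltcE /= eqxx /= reD imD reN imN.
  move: (re l - _) (im l - _) => a b h; split; apply: le_lt_trans h; rewrite -sqrtr_sqr ler_wsqrtr//.
    by rewrite lerDl sqr_ge0.
  by rewrite lerDr sqr_ge0.
by split; apply/cvgrPdist_lt => eps /key; apply: filterS => e [].
Qed.

(** * The truncated cosh transform and the measurability of F *)

Section CoshTransform.
Variables (m : R[i]) (f : R -> R[i]).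
Hypotheses (Ip : cL1 (psi m f)) (Im : cL1 (psi (- m) f)).

Let p s := cexp (m * s%:C).
Let q s := cexp (- m * s%:C).

Definition Tc e s := 1/2 * (p s * Hc e (psi m f) s + q s * Hc e (psi (- m) f) s).

Let g s u := 1/2 * p s * psi m f u + 1/2 * q s * psi (- m) f u.

Lemma cL1_g s : cL1 (g s). Proof. by apply: cL1D; exact: cL1Z. Qed.

Lemma cosh_kernelE s u : cosh_kernel m f s u = g s u / (s - u)%:C.
Proof.
rewrite /cosh_kernel /ccosh /g /psi /p /q opprK.
have -> : m * (s - u)%:C = m * s%:C + - m * u%:C by rewrite rmorphB mulrBr mulNr.
have -> : - (m * s%:C + - m * u%:C) = - m * s%:C + m * u%:C by ring.
by rewrite !cexpD; ring.
Qed.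

Lemma HcgE e s : 0 < e -> Hc e (g s) s = Tc e s.
Proof.
move=> e0; rewrite HcD ?HcZ//; try exact: cL1Z.
by rewrite /Tc; ring.
Qed.

Lemma trunc_cosh e s : 0 < e -> pv_trunc (cosh_kernel m f s) s e = Tc e s.
Proof.
move=> e0; rewrite -HcgE// /pv_trunc /cintegral /Hc -!int_Dset//; congr (_ +i* _); apply: eq_int => u [Iu eu];
  by rewrite cosh_kernelE invC ?reM ?imM /= mulr0 ?subr0 ?add0r /hk distrC eu mulrC.
Qed.

Lemma pv_cosh s (l : R[i]) : I s -> (Tc e s : R[i]^o) @[e --> 0^'+] --> (l : R[i]^o) ->
  has_pv (cosh_kernel m f s) s /\ pv (cosh_kernel m f s) s = l.
Proof.
move=> Is /cvg_C_re[cL1 c2].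
have [] := @has_pvE _ (cosh_kernel m f s) (g s) s (re l) (im l) (fun u _ => cosh_kernelE s u) (cL1_g s).
- by apply: cvg_right_ext cL1 => e e0; rewrite -HcgE.
- by apply: cvg_right_ext c2 => e e0; rewrite -HcgE.
by move=> A B; split=> //; rewrite B; apply: cplx_eq.
Qed.

Let A e s := re (Tc e s).
Let B e s := im (Tc e s).

Lemma meas_Tc e : 0 < e -> measurable_fun I (A e) /\ measurable_fun I (B e).
Proof.
move=> e0; have [p1 p2 _] := cB_E m; have [q1 q2 _] := cB_E (- m).
have mH (h : R -> R) : L1 I h -> measurable_fun I (H e h) by exact: meas_H.
have [a1 a2] := Ip; have [b1 b2] := Im.
have eA : A e = (fun s => re (1/2) * (cre p s * H e (cre (psi m f)) s - cim p s * H e (cim (psi m f)) s +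
    (cre q s * H e (cre (psi (- m) f)) s - cim q s * H e (cim (psi (- m) f)) s))
   - im (1/2) * (cre p s * H e (cim (psi m f)) s + cim p s * H e (cre (psi m f)) s +
    (cre q s * H e (cim (psi (- m) f)) s + cim q s * H e (cre (psi (- m) f)) s))).
  by apply/funext => s; rewrite /A /Tc !(reM, imM, reD, imD).
have eB : B e = (fun s => re (1/2) * (cre p s * H e (cim (psi m f)) s + cim p s * H e (cre (psi m f)) s +
    (cre q s * H e (cim (psi (- m) f)) s + cim q s * H e (cre (psi (- m) f)) s))
   + im (1/2) * (cre p s * H e (cre (psi m f)) s - cim p s * H e (cim (psi m f)) s +
    (cre q s * H e (cre (psi (- m) f)) s - cim q s * H e (cim (psi (- m) f)) s))).
  by apply/funext => s; rewrite /B /Tc !(reM, imM, reD, imD).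
have M (h k : R -> R) : measurable_fun I h -> L1 I k -> measurable_fun I (fun s => h s * H e k s).
  by move=> meas_h Ik; apply: measurable_funM => //; exact: mH.
have R1 : measurable_fun I (fun s => cre p s * H e (cre (psi m f)) s - cim p s * H e (cim (psi m f)) s +
    (cre q s * H e (cre (psi (- m) f)) s - cim q s * H e (cim (psi (- m) f)) s)).
  by apply: measurable_funD; apply: measurable_funB; exact: M.
have R2 : measurable_fun I (fun s => cre p s * H e (cim (psi m f)) s + cim p s * H e (cre (psi m f)) s +
    (cre q s * H e (cim (psi (- m) f)) s + cim q s * H e (cre (psi (- m) f)) s)).
  by apply: measurable_funD; apply: measurable_funD; exact: M.
rewrite eA eB; split.
  by apply: measurable_funB; exact: measurable_funM.
by apply: measurable_funD; exact: measurable_funM.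
Qed.

Lemma right_cont_Tc e s : 0 < e -> (Tc (e + y) s : R[i]^o) @[y --> 0^'+] --> (Tc e s : R[i]^o).
Proof.
move=> e0; have [a1 a2] := Ip; have [b1 b2] := Im.
have c (h : R -> R[i]) : cL1 h -> (Hc (e + y) h s : R[i]^o) @[y --> 0^'+] --> (Hc e h s : R[i]^o).
  by move=> [h1 h2]; apply: cvg_C; exact: right_cont_H.
apply: (@cvgM _ _ _ _ (fun=> 1/2 : R[i]) (fun y => p s * Hc (e + y) (psi m f) s + q s * Hc (e + y) (psi (- m) f) s)).
  exact: cvg_cst.
apply: (@cvgD _ _ _ _ _ (fun y => (p s * Hc (e + y) (psi m f) s) : R[i]^o)).
  by apply: (@cvgM _ _ _ _ (fun=> p s)); [exact: cvg_cst|exact: c].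
by apply: (@cvgM _ _ _ _ (fun=> q s)); [exact: cvg_cst|exact: c].
Qed.

(** The integrability demanded by [has_pv] includes measurability of F itself, which almost
    everywhere equality with [FHT_val] does not provide. On the set where the truncated integrals
    converge F is a limit of measurable functions, and on the rest of I it is constant. *)
Lemma meas_FHT : cmeasurable_fun I (cosh_FHT m f).
Proof.
have mA e (e0 : 0 < e) := (meas_Tc e0).1; have mB e (e0 : 0 < e) := (meas_Tc e0).2.
have rA e s : 0 < e -> I s -> A (e + y) s @[y --> 0^'+] --> A e s.
  by move=> e0 _; exact: (@cvg_C_re (fun y => Tc (e + y) s) _ (@right_cont_Tc e s e0)).1.
have rB e s : 0 < e -> I s -> B (e + y) s @[y --> 0^'+] --> B e s.
  by move=> e0 _; exact: (@cvg_C_re (fun y => Tc (e + y) s) _ (@right_cont_Tc e s e0)).2.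
pose E := cvset A `&` cvset B.
have mE : measurable E by apply: measurableI; exact: meas_cvset.
have mN : measurable (I `\` E) by apply: measurableD => //; exact: mI.
have IE : I = E `|` (I `\` E).
  by apply/seteqP; split => s; [move=> Is; have [?|?] := pselect (E s); [left|right]|move=> [[[]]|[]]].
pose l s : R[i] := lim (A e s @[e --> 0^'+]) +i* lim (B e s @[e --> 0^'+]).
have onE s : E s -> cosh_FHT m f s = (pi^-1)%:C * l s.
  move=> [[Is cA] [_ cB]]; rewrite /cosh_FHT.
  have [|_ ->//] := @pv_cosh s (l s) Is.
  have := cvg_C cA cB; apply: cvg_trans; apply: near_eq_cvg; near=> e.
  by apply: cplx_eq.
(* Off the convergence set [lim] is the default value of the pointed type. *)
pose c0 : R[i] := (point : R[i]^o).
have offE s : (I `\` E) s -> cosh_FHT m f s = (pi^-1)%:C * c0.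
  move=> [Is nE]; rewrite /cosh_FHT /pv dvgP// => /cvg_ex[z cz].
  apply: nE.
  have exp_sum : (Tc e s : R[i]^o) @[e --> 0^'+] --> (z : R[i]^o).
    by apply: cvg_trans cz; apply: near_eq_cvg; near=> e; rewrite trunc_cosh.
  have [cA cB] := cvg_C_re exp_sum.
  by split; split=> //; apply/cvg_ex; [exists (re z)|exists (im z)].
have mlA : measurable_fun E (fun s => lim (A e s @[e --> 0^'+])).
  by apply: (measurable_funS _ _ (meas_lim mA)); [exact: meas_cvset|move=> s []].
have mlB : measurable_fun E (fun s => lim (B e s @[e --> 0^'+])).
  by apply: (measurable_funS _ _ (meas_lim mB)); [exact: meas_cvset|move=> s []].
split; rewrite IE; apply/(measurable_funU _ mE mN); split.
- apply: (eq_measurable_fun (fun s => pi^-1 * lim (A e s @[e --> 0^'+]))).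
    by move=> s /set_mem /onE ->; rewrite reM /= mul0r subr0.
  exact: measurable_funM.
- apply: (eq_measurable_fun (fun=> re ((pi^-1)%:C * c0))); last exact: measurable_cst.
  by move=> s /set_mem /offE ->.
- apply: (eq_measurable_fun (fun s => pi^-1 * lim (B e s @[e --> 0^'+]))).
    by move=> s /set_mem /onE ->; rewrite imM /= mul0r addr0.
  exact: measurable_funM.
- apply: (eq_measurable_fun (fun=> im ((pi^-1)%:C * c0))); last exact: measurable_cst.
  by move=> s /set_mem /offE ->.
Unshelve. all: by end_near. Qed.

Lemma FHT_ae Gp Gm : isVc (psi m f) Gp -> isVc (psi (- m) f) Gm ->
  {ae leb, forall s, I s -> has_pv (cosh_kernel m f s) s /\ cosh_FHT m f s = FHT_val m Gp Gm s}.
Proof.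
move=> Vp Vm; apply: ae_imply2 (V_pv Ip Vp) (V_pv Im Vm) => s h1 h2 Is.
have [a1 a2 _] := h1 Is; have [b1 b2 _] := h2 Is.
have ca : (Hc e (psi m f) s : R[i]^o) @[e --> 0^'+] --> (Gp s : R[i]^o).
  by have := cvg_C a1 a2; rewrite ReIm.
have cb : (Hc e (psi (- m) f) s : R[i]^o) @[e --> 0^'+] --> (Gm s : R[i]^o).
  by have := cvg_C b1 b2; rewrite ReIm.
have exp_sum : (Tc e s : R[i]^o) @[e --> 0^'+] --> ((1/2 * (p s * Gp s + q s * Gm s)) : R[i]^o).
  apply: (@cvgM _ _ _ _ (fun=> 1/2 : R[i]) (fun e => p s * Hc e (psi m f) s + q s * Hc e (psi (- m) f) s)).
    exact: cvg_cst.
  apply: (@cvgD _ _ _ _ _ (fun e => (p s * Hc e (psi m f) s) : R[i]^o)).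
    by apply: (@cvgM _ _ _ _ (fun=> p s)); [exact: cvg_cst|exact: ca].
  by apply: (@cvgM _ _ _ _ (fun=> q s)); [exact: cvg_cst|exact: cb].
have [hp E] := pv_cosh Is exp_sum.
by split=> //; rewrite /cosh_FHT E /FHT_val.
Qed.

End CoshTransform.
End Measurability.

(** * The inversion formulas *)

Section Final.
Variable R : realType.
Local Notation leb := (@lebesgue_measure R).
Local Notation I := (@unit_itv R).
Local Notation w := (@wt R).
Local Notation re := (@complex.Re R).
Local Notation im := (@complex.Im R).
Implicit Types (f g h F G K : R -> R[i]) (x y t u s e : R) (k m z : R[i]).

Lemma normc_sqr z : Normc.normc z ^+ 2 = re z ^+ 2 + im z ^+ 2.
Proof. by case: z => a b /=; rewrite sqr_sqrtr// addr_ge0 ?sqr_ge0. Qed.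

Lemma Lr_complex (r : R -> R) f : (forall x, I x -> 0 < r x) -> measurable_fun I r ->
  cmeasurable_fun I f ->
  (\int[leb]_(t in I) (Normc.normc (f t) ^+ 2 * r t)%:E < +oo)%E ->
  Lr r (cre f) /\ Lr r (cim f).
Proof.
move=> r0 mr [m1 m2] fin.
have m0 : measurable_fun I (fun x => Normc.normc (f x) ^+ 2 * r x).
  apply: (eq_measurable_fun (fun x => (cre f x ^+ 2 + cim f x ^+ 2) * r x)).
    by move=> x _; rewrite normc_sqr.
  by apply: measurable_funM => //; apply: measurable_funD; exact: measurable_funX.
have J : L1 I (fun x => Normc.normc (f x) ^+ 2 * r x).
  apply/integrableP; split; first exact: meas_EFin.
  apply: le_lt_trans fin; rewrite le_eqVlt; apply/orP; left; apply/eqP.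
  apply: eq_integral => x /set_mem Ix.
  by rewrite gee0_abs// lee_fin mulr_ge0 ?sqr_ge0// ltW// r0.
have key (q : R -> R) : measurable_fun I q -> (forall x, q x ^+ 2 <= Normc.normc (f x) ^+ 2) -> Lr r q.
  move=> mq qf; split=> //; apply: (LI_le _ _ J).
    by apply: measurable_funM => //; exact: measurable_funX.
  move=> x Ix; rewrite ger0_norm; last by rewrite mulr_ge0 ?sqr_ge0// ltW// r0.
  by rewrite mulrC; apply: ler_wpM2r; [exact: ltW (r0 x Ix)|exact: qf].
by split; apply: key => // x; rewrite normc_sqr ?lerDl ?lerDr sqr_ge0.
Qed.

Lemma L2m_cLm f : L2m f -> cLm f.
Proof.
move=> [mf fin]; apply: Lr_complex fin => //; [exact: wt_gt0|exact: meas_wt].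
Qed.

Lemma L2d_cLd f : L2d f -> cLd f.
Proof.
move=> [mf fin]; apply: Lr_complex fin => //; [exact: wi_gt0|exact: L1_meas (LI_wi R)].
Qed.

Lemma cintD f g : cL1 f -> cL1 g -> cintegral I (fun x => f x + g x) = cintegral I f + cintegral I g.
Proof.
move=> [f1 f2] [g1 g2]; apply: cplx_eq; rewrite ?reD ?imD /=; rewrite -iD//; apply: eq_int => x _;
  by rewrite ?reD ?imD.
Qed.

Lemma cintZ k f : cL1 f -> cintegral I (fun x => k * f x) = k * cintegral I f.
Proof.
move=> [f1 f2]; apply: cplx_eq; rewrite ?reM ?imM /=.
  rewrite -!iZ// -iB; [|exact: LIZ|exact: LIZ].
  by apply: eq_int => x _; rewrite reM.
rewrite -!iZ// -iD; [|exact: LIZ|exact: LIZ].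
by apply: eq_int => x _; rewrite imM.
Qed.

Lemma isV_transfer (f g F : R -> R) : measurable_fun I g -> {ae leb, forall x, I x -> f x = g x} ->
  L1 I f -> isV f F -> L1 I g /\ isV g F.
Proof.
move=> mg E If [mF V]; split.
  have [] := @dct R I (fun _ x => f x) g (fun x => `|f x|) mI => //.
  - by move=> _; exact: L1_meas.
  - by apply: ae_imply E => x e Ix; rewrite -e//; exact: cvg_cst.
  - exact: L1_abs.
split=> //; apply: ae_imply V => x V Ix.
apply: cvg_right_ext (V Ix) => y y0; apply: int_ae_eq.
- exact: mI.
- exact: L1_meas (L1_qk x y0 If).
- by apply: measurable_funM => //; exact: meas_qk.
- by apply: ae_imply E => u e Iu; rewrite e.
Qed.

Lemma isVc_transfer f g F : cmeasurable_fun I g -> {ae leb, forall x, I x -> f x = g x} ->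
  cL1 f -> isVc f F -> cL1 g /\ isVc g F.
Proof.
move=> [m1 m2] E [f1 f2] [V1 V2].
have E1 : {ae leb, forall x, I x -> cre f x = cre g x} by apply: ae_imply E => x e Ix; rewrite /cre e.
have E2 : {ae leb, forall x, I x -> cim f x = cim g x} by apply: ae_imply E => x e Ix; rewrite /cim e.
by have [A B] := isV_transfer m1 E1 f1 V1; have [C D] := isV_transfer m2 E2 f2 V2.
Qed.

Lemma cmeasM f g : cmeasurable_fun I f -> cmeasurable_fun I g -> cmeasurable_fun I (fun x => f x * g x).
Proof.
move=> [a1 a2] [b1 b2]; split.
  apply: (eq_measurable_fun (fun x => cre f x * cre g x - cim f x * cim g x)).
    by move=> x _; rewrite reM.
  by apply: measurable_funB; exact: measurable_funM.
apply: (eq_measurable_fun (fun x => cre f x * cim g x + cim f x * cre g x)).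
  by move=> x _; rewrite imM.
by apply: measurable_funD; exact: measurable_funM.
Qed.

Lemma ccos_cB m : cB (fun x => ccos (m * (w x)%:C)) /\ cB (fun x => csin (m * (w x)%:C)).
Proof.
have B1 z : cB (fun x => cexp (z * (m * (w x)%:C))).
  by apply/cB_cexp/cBZ/cBZ/cB_w.
have B2 : cB (fun x => cexp (- ('i%C * (m * (w x)%:C)))).
  by apply: cB_eq (B1 (- 'i%C)) => x; rewrite mulNr.
split.
  by apply: cBM (cB_cst _); apply: cBD.
by apply: cBM (cB_cst _); apply: cBB.
Qed.

Section Kernel.
Variables (m : R[i]) (f Gp Gm : R -> R[i]).
Hypotheses (Ip : cL1 (psi m f)) (Im : cL1 (psi (- m) f)).
Hypotheses (Vp : isVc (psi m f) Gp) (Vm : isVc (psi (- m) f) Gm).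

(** The outer kernel 1 / (s - t) is the opposite of the kernel of V at t, hence the sign. F is
    replaced by [FHT_val] under the integral, where null sets are harmless. *)
Lemma pv_FK K V : cmeasurable_fun I K -> cL1 (fun x => FHT_val m Gp Gm x * K x) ->
  isVc (fun x => FHT_val m Gp Gm x * K x) V ->
  {ae leb, forall t, I t ->
    has_pv (fun s => cosh_FHT m f s / (s - t)%:C * K s) t /\
    pv (fun s => cosh_FHT m f s / (s - t)%:C * K s) t = - V t}.
Proof.
move=> mK IK VK.
have E : {ae leb, forall x, I x -> FHT_val m Gp Gm x * K x = cosh_FHT m f x * K x}.
  by apply: ae_imply (FHT_ae Ip Im Vp Vm) => x h Ix; have [_ ->] := h Ix.
have mFK := cmeasM (meas_FHT Ip Im) mK.
have [I1 V1] := isVc_transfer mFK E IK VK.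
apply: ae_imply (V_pv (cL1Z (-1) I1) (isVcZ (-1) I1 V1)) => t h It.
have [_ _ /(_ (fun s => cosh_FHT m f s / (s - t)%:C * K s))] := h It.
rewrite mulN1r; apply => u _.
rewrite -[(t - u)%R]opprB rmorphN invrN; ring.
Qed.

End Kernel.

(** The algebra of part (i) at a point t: C and S are the cosine and sine factors, W the weight, a
    and b the numbers 1 / pi and pi, D the value of [FHT_diff], z that of f. The two terms in D
    cancel. *)
Lemma inversion_d (C S a b W D z : R[i]) : W != 0 -> C * C + S * S = 1 -> a * b = 1 ->
  z = C * W * (a * - (- (1/2 * S * D * W^-1) - b * (C * z * W^-1))) +
      S * (a * - (1/2 * C * D - b * (S * z))).
Proof.
move=> w0 e p; transitivity ((a * b) * (C * C + S * S) * z); first by rewrite p e !mul1r.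
by field.
Qed.

(** The same for part (ii), where j is the sum of the integrals of e^{-mu u} f and e^{mu u} f: the
    term from [V_cosm] cancels against the integral of cosh(mu u) f(u) in the formula. *)
Lemma inversion_m (C S a b W D z j : R[i]) : W != 0 -> C * C + S * S = 1 -> a * b = 1 ->
  z = C / W * (a * - (- (1/2 * S * D * W) - b * (C * z * W) + 1/2 * j) + a * (1/2 * j)) +
      S * (a * - (1/2 * C * D - b * (S * z))).
Proof.
move=> w0 e p; transitivity ((a * b) * (C * C + S * S) * z); first by rewrite p e !mul1r.
by field.
Qed.

End Final.

Theorem theorem1 (R : realType) (mu : R[i]) :
  let leb := @lebesgue_measure R in
  (forall f : R -> R[i], L2d f ->
    let F := cosh_FHT mu f in
    let gcos t s := F s / (s - t)%:C * (ccos (mu * (wt s)%:C) / (wt s)%:C) in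
    let gsin t s := F s / (s - t)%:C * csin (mu * (wt s)%:C) in
    {ae leb, forall s, unit_itv s -> has_pv (cosh_kernel mu f s) s} /\
    {ae leb, forall t, unit_itv t ->
      [/\ has_pv (gcos t) t, has_pv (gsin t) t &
        f t = ccos (mu * (wt t)%:C) * (wt t)%:C * ((pi^-1)%:C * pv (gcos t) t)
            + csin (mu * (wt t)%:C) * ((pi^-1)%:C * pv (gsin t) t)]}) /\
  (forall f : R -> R[i], L2m f ->
    let F := cosh_FHT mu f in
    let gcos t s := F s / (s - t)%:C * (ccos (mu * (wt s)%:C) * (wt s)%:C) in
    let gsin t s := F s / (s - t)%:C * csin (mu * (wt s)%:C) in
    let h u := ccosh (mu * u%:C) * f u in
    [/\ {ae leb, forall s, unit_itv s -> has_pv (cosh_kernel mu f s) s},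
      cintegrable unit_itv h &
      {ae leb, forall t, unit_itv t ->
        [/\ has_pv (gcos t) t, has_pv (gsin t) t &
          f t = ccos (mu * (wt t)%:C) / (wt t)%:C
                * ((pi^-1)%:C * pv (gcos t) t
                   + (pi^-1)%:C * cintegral unit_itv h)
              + csin (mu * (wt t)%:C) * ((pi^-1)%:C * pv (gsin t) t)]}]).
Proof.
move=> leb; have wn0 t : unit_itv t -> (wt t)%:C != 0 :> R[i].
  by move=> It; rewrite fmorph_eq0 gt_eqF// wt_gt0.
have [[c1m c2m _] [s1m s2m _]] := ccos_cB mu.
have mS : cmeasurable_fun unit_itv (fun s => csin (mu * (wt s)%:C)) by [].
have mC : cmeasurable_fun unit_itv (fun s => ccos (mu * (wt s)%:C)) by [].
have cs t := cosin2 (mu * (wt t)%:C).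
split=> f Lf0 F gcos gsin.
- have Ld := L2d_cLd Lf0; have Lf := cLd_Lm Ld.
  have Ip := cLm_1 (psi_Lm mu Lf); have Im := cLm_1 (psi_Lm (- mu) Lf).
  have [Gp Vp] := Vc_ex (psi_Lm mu Lf); have [Gm Vm] := Vc_ex (psi_Lm (- mu) Lf).
  split; first by apply: ae_imply (FHT_ae Ip Im Vp Vm) => s h Is; have [] := h Is.
  have [Is Vs] := V_sin Lf Vp Vm; have [Ic Vc] := V_cosd Vp Vm Ld.
  have [w1 w2] : cmeasurable_fun unit_itv (fun s => ((wt s)^-1)%:C : R[i]).
    by split; [exact: L1_meas (LI_wi R)|exact: measurable_cst].
  have mK : cmeasurable_fun unit_itv (fun s => ccos (mu * (wt s)%:C) * ((wt s)^-1)%:C) by exact: cmeasM.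
  apply: ae_imply2 (pv_FK Ip Im Vp Vm mK Ic Vc) (pv_FK Ip Im Vp Vm mS Is Vs) => t hc hs It.
  have [c_pv c_eq] := hc It; have [s_pv s_eq] := hs It.
  have eg : gcos t = (fun s => cosh_FHT mu f s / (s - t)%:C * (ccos (mu * (wt s)%:C) * ((wt s)^-1)%:C)).
    by apply/funext => s; rewrite /gcos -invC.
  split; [by rewrite eg|exact: s_pv|].
  rewrite eg c_eq /gsin /F s_eq -(invC (wt t)).
  exact: (inversion_d _ _ (wn0 t It) (cs t) (piV R)).
- move=> h; have Lf := L2m_cLm Lf0.
  have Ip := cLm_1 (psi_Lm mu Lf); have Im := cLm_1 (psi_Lm (- mu) Lf).
  have [Gp Vp] := Vc_ex (psi_Lm mu Lf); have [Gm Vm] := Vc_ex (psi_Lm (- mu) Lf).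
  have eh : h = (fun u => 1/2 * (psi mu f u + psi (- mu) f u)).
    by apply/funext => u; rewrite /h /ccosh /psi opprK mulNr; ring.
  split; first by apply: ae_imply (FHT_ae Ip Im Vp Vm) => s h' Is; have [] := h' Is.
    by rewrite eh; exact: (cL1Z (1/2) (cL1D Ip Im)).
  have Eh : cintegral unit_itv h = 1/2 * (cintegral unit_itv (psi mu f) + cintegral unit_itv (psi (- mu) f)).
    by rewrite eh cintZ ?cintD//; exact: cL1D.
  have [Is Vs] := V_sin Lf Vp Vm; have [Ic Vc] := V_cosm Lf Vp Vm.
  have [w1 w2] : cmeasurable_fun unit_itv (fun s => (wt s)%:C : R[i]).
    by split; [exact: meas_wt|exact: measurable_cst].
  have mK : cmeasurable_fun unit_itv (fun s => ccos (mu * (wt s)%:C) * (wt s)%:C) by exact: cmeasM.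
  apply: ae_imply2 (pv_FK Ip Im Vp Vm mK Ic Vc) (pv_FK Ip Im Vp Vm mS Is Vs) => t hc hs It.
  have [c_pv c_eq] := hc It; have [s_pv s_eq] := hs It.
  split; [exact: c_pv|exact: s_pv|].
  rewrite /gcos /gsin /F c_eq s_eq Eh.
  exact: (inversion_m _ _ _ (wn0 t It) (cs t) (piV R)).
Qed.
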